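(* Let $\{\phi_i: i=1,\dots,N_J\}$ be the (nodal) basis of $V_{h,0}^{\rm IFE}$ and let $\mathbf A$ be the stiffness matrix defined by $\mathbf A(i,j)=A_h(\phi_i,\phi_j)$ for all $i,j=1,\dots,N_J$. Suppose that the family of triangulations is also quasi-uniform, i.e. there is a constant $C$ such that $h_T^{-1}\le Ch^{-1}$ for any $T\in\mathcal T_h$ and any triangulation $\mathcal T_h$. Then the $l_2$ condition number of $\mathbf A$ satisfies $$\mathrm{cond}_2(\mathbf A)\le Ch^{-2},$$ where the constant $C$ is independent of $h$ and the interface location relative to the mesh.
   Context: Geometry. $N\in\{2,3\}$; $\Omega\subset\mathbb R^N$ is a bounded convex polygonal/polyhedral domain; $\Gamma$ is a $C^2$ compact hypersurface without boundary embedded in $\Omega$, dividing $\Omega$ into disjoint subdomains $\Omega^+,\Omega^-$ with $\Omega^-$ strictly inside $\Omega$ and $\Gamma=\partial\Omega^-$. $\mathbf n$ is the unit normal on $\Gamma$ pointing from $\Omega^-$ to $\Omega^+$. $\beta|_{\Omega^\pm}=\beta^\pm\in C^1(\overline{\Omega^\pm})$ with positive lower and upper bounds. $d$ is the signed distance to $\Gamma$ (positive in $\Omega^+$), $U(\Gamma,\delta)=\{\mathbf x:\mathrm{dist}(\mathbf x,\Gamma)<\delta\}$, and $\delta_0>0$ is such that $d\in C^2(U(\Gamma,\delta_0))$ and each $\mathbf x\in U(\Gamma,\delta_0)$ has a unique closest point $\mathbf p(\mathbf x)\in\Gamma$; $\mathbf n=\nabla d$ on $U(\Gamma,\delta_0)$.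 With $\Omega^\pm_{\delta_0}=\Omega^\pm\cup U(\Gamma,\delta_0)$, $\beta_E^\pm\in C^1(\overline{\Omega^\pm_{\delta_0}})$ are fixed extensions of $\beta^\pm$ with positive lower and upper bounds. Mesh. $\{\mathcal T_h\}$ is a family of simplicial triangulations of $\Omega$ (independent of $\Gamma$) with open elements $T$ and open faces $F$ (edges if $N=2$), $h_T=\mathrm{diam}\,T$, $h=\max_Th_T$, shape-regular: $h_T\le\varrho r_T$, $r_T$ the radius of the largest ball inscribed in $T$, $\varrho$ fixed. $\mathcal F_h,\mathcal F_h^\circ,\mathcal F_h^b$: all, interior, boundary faces. $\mathcal T_h^\Gamma=\{T:T\cap\Gamma\ne\emptyset\}$, $\mathcal T_h^{non}=\mathcal T_h\setminus\mathcal T_h^\Gamma$, $\mathcal F_h^\Gamma=\{F:F\cap\Gamma\neq\emptyset\}$, $h_\Gamma=\max_{T\in\mathcal T_h^\Gamma}h_T$. Standing assumption: $h_\Gamma$ is sufficiently small; in particular $h_\Gamma<\delta_0$ (so $\overline T\subset U(\Gamma,\delta_0)$ for $T\in\mathcal T_h^\Gamma$), and for any triangle in $\mathcal T_h^\Gamma$ ($N=2$) or in $\mathcal F_h^\Gamma$ ($N=3$), $\Gamma$ meets its boundary at two points, not on the same closed edge. The case of faces contained in $\Gamma$ or with all vertices on $\Gamma$ is excluded. Discrete interface. $\Gamma_h$ is a continuous hypersurface partitioning $\Omega$ into $\Omega_h^+,\Omega_h^-$ with $\partial\Omega_h^-=\Gamma_h$, composed of $\Gamma_{h,T}=\Gamma_h\cap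 T$, $T\in\mathcal T_h^\Gamma$, each a line/planar segment in a hyperplane $\Gamma_{h,T}^{ext}$; $\mathbf p|_{\Gamma_h}:\Gamma_h\to\Gamma$ is a bijection; with $\Gamma_T=\Gamma\cap T$, for all $T\in\mathcal T_h^\Gamma$: $\|d\|_{L^\infty(\Gamma_{h,T})}\le Ch_T^2$, $\|\mathrm{dist}(\cdot,\Gamma_{h,T}^{ext})\|_{L^\infty(\Gamma_T)}\le Ch_T^2$, $\|\mathbf n-\mathbf n_h\|_{L^\infty(\Gamma_T)}\le Ch_T$, where $\mathbf n_h|_T$ is the constant unit normal to $\Gamma_{h,T}$ pointing from $\Omega_h^-$ to $\Omega_h^+$. $T_h^\pm=T\cap\Omega_h^\pm$. $\beta^{BK}$ is defined by $\beta^{BK}|_{\Omega_h^\pm}=\beta_E^\pm$. IFE space. For $T\in\mathcal T_h^\Gamma$, $\beta_T^\pm$ are positive constants, bounded above and away from $0$ uniformly, with $\|\beta_E^\pm-\beta_T^\pm\|_{L^\infty(T)}\le Ch_T$, $\beta_T|_{T_h^\pm}=\beta_T^\pm$, and $S_h(T)=\{\phi\in L^2(T):\phi|_{T_h^\pm}\in\mathbb P_1(T_h^\pm),\ [\phi]_{\Gamma_{h,T}}=0,\ [\beta_T\nabla\phi\cdot\mathbf n_h]_{\Gamma_{h,T}}=0\}$; functions in $S_h(T)$ are uniquely determined by their mean values on the $N+1$ faces of $T$. $V_h^{\rm IFE}$ consists of $v$ with $v|_T\in\mathbb P_1(T)$ for $T\in\mathcal T_h^{non}$, $v|_T\in S_h(T)$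 for $T\in\mathcal T_h^\Gamma$, $\int_F[v]_F=0$ for $F\in\mathcal F_h^\circ$; $V_{h,0}^{\rm IFE}=\{v\in V_h^{\rm IFE}:\int_Fv=0\ \forall F\in\mathcal F_h^b\}$. The nodal basis: $\phi_i\in V_{h,0}^{\rm IFE}$ has mean value $1$ on the $i$-th interior face and $0$ on all other faces ($N_J$ is the number of interior faces). For $F\in\mathcal F_h^\circ$ shared by $T_1^F,T_2^F$ with unit normal $\mathbf n_F$ pointing from $T_1^F$ to $T_2^F$: $[v]_F=v|_{T_1^F}-v|_{T_2^F}$, $\{v\}_F=(v|_{T_1^F}+v|_{T_2^F})/2$. Bilinear form. $\nabla_h$ is the gradient taken on each $T\in\mathcal T_h^{non}$ and on each $T_h^\pm$, $T\in\mathcal T_h^\Gamma$. For $F\in\mathcal F_h^\Gamma$, $\mathbf Q_F=\{\mathbf q\in L^2(\Omega)^N:\mathbf q|_{T_i^F}\in\nabla S_h(T_i^F),\,i=1,2,\ \mathbf q=\mathbf 0\text{ on }\Omega\setminus(T_1^F\cup T_2^F)\}$ with $\nabla S_h(T)=\{\nabla v_h:v_h\in S_h(T)\}$, and $\mathbf r_F:L^2(F)\to\mathbf Q_F$ is defined by $\int_{T_1^F\cup T_2^F}\beta^{BK}\mathbf r_F(v)\cdot\mathbf q=\int_F\{\beta^{BK}\mathbf q\cdot\mathbf n_F\}_Fv$ for all $\mathbf q\in\mathbf Q_F$. Set $a_h(z,v)=\int_\Omega\beta^{BK}\nabla_hz\cdot\nabla_hv$, $b_h(z,v)=-\sum_{F\in\mathcal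 F_h^\Gamma}\int_F(\{\beta^{BK}\nabla_hz\cdot\mathbf n_F\}_F[v]_F+\{\beta^{BK}\nabla_hv\cdot\mathbf n_F\}_F[z]_F)$, $s_h(z,v)=8\sum_{F\in\mathcal F_h^\Gamma}\int_{T_1^F\cup T_2^F}\beta^{BK}\mathbf r_F([z]_F)\cdot\mathbf r_F([v]_F)$, $A_h=a_h+b_h+s_h$. Constants. ''Independent of $h$ and the interface location relative to the mesh'' means $C$ may depend on $N,\Omega,\Gamma,\delta_0,\beta^\pm$, the extensions, $\varrho$, the quasi-uniformity constant and the constants in the standing assumptions, but not on the particular mesh or the position of $\Gamma$ relative to it. *)

(* Defs.v *)
From HB Require Import structures.
From mathcomp Require Import all_boot all_order all_algebra.
From mathcomp Require Import all_classical all_reals all_analysis.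

Set Implicit Arguments.
Unset Strict Implicit.
Unset Printing Implicit Defensive.

Import Order.TTheory GRing.Theory Num.Theory.
Import numFieldNormedType.Exports.
Local Open Scope classical_set_scope.
Local Open Scope ring_scope.

Section lebesgue_step.
Context {R : realType} (n : nat).
Variable mu : {sigma_finite_measure set (n.-tuple (measurableTypeR R)) -> \bar R}.

Definition cons_pair (p : measurableTypeR R * n.-tuple (measurableTypeR R)) :
  n.+1.-tuple (measurableTypeR R) := [tuple of p.1 :: p.2].

Lemma measurable_cons_pair : measurable_fun [set: _] cons_pair.
Proof. exact: (measurable_cons measurable_fst measurable_snd). Qed.

Definition lebesgue_cons := pushforward (@lebesgue_measure R \x mu)%E cons_pair.

Let lebesgue_cons0 : lebesgue_cons set0 = 0%E.
Proof. by rewrite /lebesgue_cons /pushforward preimage_set0 measure0. Qed.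

Let lebesgue_cons_ge0 A : (0 <= lebesgue_cons A)%E.
Proof. by rewrite /lebesgue_cons /pushforward; exact: measure_ge0. Qed.

Let lebesgue_cons_additive : semi_sigma_additive lebesgue_cons.
Proof.
move=> F mF tF mUF; rewrite /lebesgue_cons /pushforward preimage_bigcup.
apply: measure_semi_sigma_additive.
- by move=> k; rewrite -[X in measurable X]setTI; exact: measurable_cons_pair.
- apply/trivIsetP => /= i j _ _ ij; rewrite -preimage_setI.
  by move/trivIsetP : tF => /(_ _ _ _ _ ij) ->//; rewrite preimage_set0.
- rewrite -preimage_bigcup -[X in measurable X]setTI.
  exact: measurable_cons_pair.
Qed.

HB.instance Definition _ := isMeasure.Build _ _ _ lebesgue_cons
  lebesgue_cons0 lebesgue_cons_ge0 lebesgue_cons_additive.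

Let lebesgue_cons_sigma_finite : sigma_finite setT lebesgue_cons.
Proof.
have [F FT Foo] : sigma_finite setT (@lebesgue_measure R \x mu)%E.
  have /sigma_finiteP[F [TF ndF Foo]] := sigma_finiteT (@lebesgue_measure R).
  have /sigma_finiteP[G [TG ndG Goo]] := sigma_finiteT mu.
  exists (fun k => F k `*` G k).
    rewrite -setXTT TF TG predeqE => -[x y]; split.
      move=> [/= [k _ Fkx] [l _ Gly]]; exists (maxn k l) => //; split.
      - by move: x Fkx; exact/subsetPset/ndF/leq_maxl.
      - by move: y Gly; exact/subsetPset/ndG/leq_maxr.
    by move=> [k _ []/= ? ?]; split; exists k.
  move=> k; have [? ?] := Foo k; have [? ?] := Goo k.
  split; first exact: measurableX.
  by rewrite product_measure1E// lte_mul_pinfty// ge0_fin_numE.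
pose g (t : n.+1.-tuple (measurableTypeR R)) :
  measurableTypeR R * n.-tuple (measurableTypeR R) :=
  (thead t, [tuple of behead t]).
have mg : measurable_fun setT g.
  apply: measurable_fun_pair; first exact: measurable_tnth.
  exact: measurable_behead.
have gK p : g (cons_pair p) = p.
  by case: p => x t; rewrite /g/= theadE; congr pair; apply/val_inj.
exists (fun i => g @^-1` F i).
  by rewrite -preimage_bigcup -FT preimage_setT.
move=> i; have [mF Fi] := Foo i; split.
  by rewrite -[X in measurable X]setTI; exact: mg.
rewrite /lebesgue_cons /pushforward (_ : _ @^-1` _ = F i)//.
by apply/seteqP; split=> p /=; rewrite gK.
Qed.

HB.instance Definition _ := Measure_isSigmaFinite.Build _ _ _ lebesgue_cons
  lebesgue_cons_sigma_finite.

End lebesgue_step.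

Fixpoint lebesgue_tuple {R : realType} (n : nat) :
    {sigma_finite_measure set (n.-tuple (measurableTypeR R)) -> \bar R} :=
  match n with
  | 0 => \d_[tuple]
  | n'.+1 => lebesgue_cons (lebesgue_tuple n')
  end.

Section vectors.
Context {R : realType} {N : nat}.
Implicit Types (A B : set 'rV[R]_N) (x y : 'rV[R]_N) (f : 'rV[R]_N -> R).

Definition vec_of_tuple (t : N.-tuple (measurableTypeR R)) : 'rV[R]_N :=
  \row_i (tnth t i : R).

Definition vol_integral A f : R :=
  (\int[lebesgue_tuple N]_(t in [set t | A (vec_of_tuple t)])
     f (vec_of_tuple t))%R.

(** The library norm on matrices is the sup norm (with the same topology);
    all lengths below are Euclidean. *)
Definition dot x y : R := \sum_i x 0 i * y 0 i.
Definition enorm x : R := Num.sqrt (dot x x).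

Definition dist x A : R := inf [set enorm (x - y) | y in A].
Definition diam A : R := sup [set enorm (x - y) | x in A & y in A].
Definition eball x (r : R) : set 'rV[R]_N := [set y | enorm (y - x) < r].
Definition inradius A : R :=
  sup [set r | 0 <= r /\ exists c, eball c r `<=` A].

Definition boundary A : set 'rV[R]_N := closure A `\` interior A.

Definition grad f x : 'rV[R]_N := \row_i 'D_(delta_mx 0 i) f x.

(** [C1_on] and [C2_on] are meant for open sets. *)
Definition C1_on A f : Prop :=
  (forall x, A x -> differentiable f x) /\
  (forall x, A x -> {for x, continuous (grad f)}).

Definition C2_on A f : Prop :=
  C1_on A f /\ forall i, C1_on A (fun x => grad f x 0 i).

Definition C1_closure A f : Prop :=
  [/\ forall x, A x -> differentiable f x,
      {within closure A, continuous f} &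
      exists G : 'rV[R]_N -> 'rV[R]_N,
        {within closure A, continuous G} /\ (forall x, A x -> G x = grad f x)].

Definition pos_bounded A f : Prop :=
  exists m M : R, 0 < m /\ forall x, A x -> m <= f x <= M.

Definition C2_hypersurface A : Prop :=
  forall x, A x -> exists (U : set 'rV[R]_N) (g : 'rV[R]_N -> R),
    [/\ open U, U x, C2_on U g, forall y, U y -> grad g y != 0 &
        forall y, U y -> (A y <-> g y = 0)].

(** Bounded, nonempty, finite intersection of open half-spaces: the bounded
    convex polygonal ([N = 2]) or polyhedral ([N = 3]) domains. *)
Definition convex_polytope_domain A : Prop :=
  [/\ A !=set0, bounded_set A &
      exists (m : nat) (a : 'I_m -> 'rV[R]_N) (b : 'I_m -> R),
        A = [set x | forall i, dot (a i) x < b i]].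

End vectors.

(** Integral over the (relatively open or closed) simplex of dimension
    [(size s).-1] with vertices [s], with respect to surface measure: pull-back
    to the reference simplex, weighted by the Gram determinant. *)
Section simplex_integral.
Context {R : realType} {N k : nat}.

Definition ref_simplex : set 'rV[R]_k :=
  [set t | (forall i, 0 <= t 0 i) /\ \sum_i t 0 i <= 1].

Definition edge_mx (s : seq 'rV[R]_N) : 'M[R]_(k, N) :=
  \matrix_(i, j) (s`_i.+1 - s`_0) 0 j.

Definition simplex_integral (s : seq 'rV[R]_N) (f : 'rV[R]_N -> R) : R :=
  Num.sqrt (\det (edge_mx s *m (edge_mx s)^T)) *
  vol_integral ref_simplex (fun t => f (s`_0 + t *m edge_mx s)).

End simplex_integral.

(** Throughout, a sign is a boolean: [true] for [+], [false] for [-]. *)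
Record interface_problem (R : realType) (N : nat) := InterfaceProblem {
  Omega : set 'rV[R]_N;
  Omegas : bool -> set 'rV[R]_N;
  Gamma : set 'rV[R]_N;
  delta0 : R;
  beta : bool -> 'rV[R]_N -> R;
  betaE : bool -> 'rV[R]_N -> R }.

Section interface_problem_theory.
Context {R : realType} {N : nat} (P : interface_problem R N).
Implicit Types (x y : 'rV[R]_N).

Definition tube (delta : R) : set 'rV[R]_N :=
  [set x | dist x (Gamma P) < delta].

Definition sdist x : R :=
  if `[< Omegas P false x >] then - dist x (Gamma P) else dist x (Gamma P).

(** The unit normal [n] on [tube delta0], extending the one on [Gamma] that
    points from [Omegas false] to [Omegas true]. *)
Definition normal x : 'rV[R]_N := grad sdist x.

Definition closest x y : Prop :=
  Gamma P y /\ enorm (x - y) = dist x (Gamma P).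

Definition closest_proj x : 'rV[R]_N := xget 0 [set y | closest x y].

Definition Omegas_ext (s : bool) : set 'rV[R]_N :=
  Omegas P s `|` tube (delta0 P).

Definition well_posed : Prop :=
  [/\ convex_polytope_domain (Omega P),
      [/\ forall s, [/\ open (Omegas P s), connected (Omegas P s) &
                        Omegas P s !=set0],
          Omega P = Omegas P true `|` Omegas P false `|` Gamma P,
          [/\ Omegas P true `&` Omegas P false = set0,
              Omegas P true `&` Gamma P = set0 &
              Omegas P false `&` Gamma P = set0] &
          closure (Omegas P false) `<=` Omega P],
      [/\ compact (Gamma P), C2_hypersurface (Gamma P) &
          Gamma P = boundary (Omegas P false)],
      [/\ 0 < delta0 P, C2_on (tube (delta0 P)) sdist &
          forall x, tube (delta0 P) x -> exists! y, closest x y] &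
      forall s,
        [/\ C1_closure (Omegas P s) (beta P s),
            pos_bounded (closure (Omegas P s)) (beta P s),
            C1_closure (Omegas_ext s) (betaE P s),
            pos_bounded (closure (Omegas_ext s)) (betaE P s) &
            forall x, Omegas P s x -> betaE P s x = beta P s x]].

End interface_problem_theory.

(** Elements and faces are sets of vertex indices; [T1], [T2] and [nF] fix the
    numbering of the two elements sharing an interior face and its normal. *)
Record mesh (R : realType) (N : nat) := Mesh {
  nv : nat;
  vtx : 'I_nv -> 'rV[R]_N;
  cells : {set {set 'I_nv}};
  T1 : {set 'I_nv} -> {set 'I_nv};
  T2 : {set 'I_nv} -> {set 'I_nv};
  nF : {set 'I_nv} -> 'rV[R]_N }.

Section mesh_theory.
Context {R : realType} {N : nat} (P : interface_problem R N) (M : mesh R N).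
Local Notation simplex := {set 'I_(nv M)}.
Implicit Types (S T F : simplex) (x y : 'rV[R]_N).

Definition osimplex S : set 'rV[R]_N :=
  [set x | exists w : 'I_(nv M) -> R,
     [/\ forall i, i \in S -> 0 < w i, forall i, i \notin S -> w i = 0,
         \sum_i w i = 1 & x = \sum_i w i *: vtx i]].

Definition csimplex S : set 'rV[R]_N :=
  [set x | exists w : 'I_(nv M) -> R,
     [/\ forall i, i \in S -> 0 <= w i, forall i, i \notin S -> w i = 0,
         \sum_i w i = 1 & x = \sum_i w i *: vtx i]].

Definition affinely_independent S : Prop :=
  forall w : 'I_(nv M) -> R,
    (forall i, i \notin S -> w i = 0) -> \sum_i w i = 0 ->
    \sum_i w i *: vtx i = 0 -> forall i, w i = 0.

Definition faces : {set simplex} :=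
  [set F : simplex | (#|F| == N) && [exists T in cells M, F \subset T]].

Definition face_cells F : {set simplex} := [set T in cells M | F \subset T].

Definition interior_faces : {set simplex} :=
  [set F in faces | #|face_cells F| == 2%N].

Definition boundary_faces : {set simplex} :=
  [set F in faces | #|face_cells F| == 1%N].

Definition triangulation : Prop :=
  [/\ forall T, T \in cells M -> #|T| = N.+1 /\ affinely_independent T,
      [set x | exists2 T, T \in cells M & csimplex T x] = closure (Omega P),
      forall T T', T \in cells M -> T' \in cells M ->
        csimplex T `&` csimplex T' = csimplex (T :&: T')%SET &
      forall F, F \in interior_faces ->
        [/\ face_cells F = [set T1 F; T2 F]%SET, enorm (nF F) = 1,
            forall x y, csimplex F x -> csimplex F y -> dot (nF F) (y - x) = 0 &
            forall x y, osimplex (T1 F) x -> osimplex (T2 F) y ->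
              0 < dot (nF F) (y - x)]].

Definition hT T : R := diam (osimplex T).
Definition rT T : R := inradius (osimplex T).
Definition hmax : R := \big[Num.max/0]_(T in cells M) hT T.

Definition shape_regular (rho : R) : Prop :=
  forall T, T \in cells M -> hT T <= rho * rT T.

Definition quasi_uniform (C : R) : Prop :=
  forall T, T \in cells M -> (hT T)^-1 <= C * hmax^-1.

Definition Gcells : {set simplex} :=
  [set T in cells M | `[< osimplex T `&` Gamma P !=set0 >]].

Definition Gfaces : {set simplex} :=
  [set F in faces | `[< osimplex F `&` Gamma P !=set0 >]].

Definition hGamma : R := \big[Num.max/0]_(T in Gcells) hT T.

Definition Gtriangles : {set simplex} := if N == 2%N then Gcells else Gfaces.

Definition crosses_two_edges S : Prop :=
  exists x y, [/\ x <> y,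
    (csimplex S `\` osimplex S) `&` Gamma P = [set x; y] &
    forall e : simplex, e \subset S -> #|e| = 2%N ->
      ~ (csimplex e x /\ csimplex e y)].

Definition resolves_interface : Prop :=
  [/\ hGamma < delta0 P,
      forall S, S \in Gtriangles -> crosses_two_edges S,
      forall F, F \in faces -> ~ (osimplex F `<=` Gamma P) &
      forall F, F \in faces -> ~ (forall i, i \in F -> Gamma P (vtx i))].

Definition face_integral F (f : 'rV[R]_N -> R) : R :=
  simplex_integral (k := N.-1) [seq vtx i | i <- enum F] f.

Definition face_mean F (f : 'rV[R]_N -> R) : R :=
  face_integral F f / face_integral F (cst 1).

End mesh_theory.

(** [{x | dot (nh T) x = ch T}] is the hyperplane containing the part of
    [Gammah] inside the interface element [T]. *)
Record discrete_interface (R : realType) (N : nat) (M : mesh R N) :=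
  DiscreteInterface {
  Omegah : bool -> set 'rV[R]_N;
  Gammah : set 'rV[R]_N;
  nh : {set 'I_(nv M)} -> 'rV[R]_N;
  ch : {set 'I_(nv M)} -> R;
  betaT : {set 'I_(nv M)} -> bool -> R }.

Record constants (R : realType) := Constants {
  c_shape : R;
  c_quasi : R;
  c_dist : R;
  c_plane : R;
  c_normal : R;
  c_coef : R;
  coef_min : R;
  coef_max : R }.

Section discrete_interface_theory.
Context {R : realType} {N : nat} (P : interface_problem R N) (M : mesh R N).
Context (D : discrete_interface M).
Local Notation simplex := {set 'I_(nv M)}.
Implicit Types (T F : simplex) (x : 'rV[R]_N).

Definition hyperplane T : set 'rV[R]_N := [set x | dot (nh D T) x = ch D T].

(** The condition that [Gammah] is a continuous hypersurface is not listed: the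
    continuous bijection [closest_proj] from the compact set [Gammah] onto
    [Gamma] is a homeomorphism. The inclusions [Omegah s `<=` Omegas_ext P s] say that
    [betaE] is defined where [betaBK] below uses it. *)
Definition discrete_interface_ok (K : constants R) : Prop :=
  [/\ [/\ forall s, open (Omegah D s),
          Omega P = Omegah D true `|` Omegah D false `|` Gammah D,
          [/\ Omegah D true `&` Omegah D false = set0,
              Omegah D true `&` Gammah D = set0 &
              Omegah D false `&` Gammah D = set0],
          Gammah D = boundary (Omegah D false) &
          forall s, Omegah D s `<=` Omegas_ext P s],
      [/\ Gammah D = [set x | exists2 T, T \in Gcells P M &
                        closure (Gammah D `&` osimplex T) x],
          forall T, T \in Gcells P M ->
            [/\ enorm (nh D T) = 1,
                Gammah D `&` osimplex T !=set0,
                Omegah D true `&` osimplex T =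
                  [set x | osimplex T x /\ ch D T < dot (nh D T) x] &
                Omegah D false `&` osimplex T =
                  [set x | osimplex T x /\ dot (nh D T) x < ch D T]] &
          set_bij (Gammah D) (Gamma P) (closest_proj P)],
      forall T, T \in Gcells P M ->
        [/\ forall x, (Gammah D `&` osimplex T) x ->
              `|sdist P x| <= c_dist K * hT T ^+ 2,
            forall x, (Gamma P `&` osimplex T) x ->
              dist x (hyperplane T) <= c_plane K * hT T ^+ 2 &
            forall x, (Gamma P `&` osimplex T) x ->
              enorm (normal P x - nh D T) <= c_normal K * hT T] &
      forall T s, T \in Gcells P M ->
        coef_min K <= betaT D T s <= coef_max K /\
        forall x, osimplex T x ->
          `|betaE P s x - betaT D T s| <= c_coef K * hT T].

Definition side x : bool := `[< Omegah D true x >].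

Definition betaBK x : R := betaE P (side x) x.

(** [(g, c)] stands for the affine function [x |-> dot g x + c]. A broken
    function has an affine function for each element and each sign; its value
    and its gradient on an element (and its trace on the faces of the element)
    are those of the sign given by [Omegah]. *)
Definition affine := ('rV[R]_N * R)%type.
Definition aff (p : affine) x : R := dot p.1 x + p.2.

Definition broken := simplex -> bool -> affine.
Definition value (v : broken) T x : R := aff (v T (side x)) x.

Definition bfield := simplex -> bool -> 'rV[R]_N.
Definition gradh (v : broken) : bfield := fun T s => (v T s).1.
Definition on_Omega (q : bfield) x : 'rV[R]_N :=
  \sum_(T in cells M) \1_(osimplex T) x *: q T (side x).

Definition immersed T (p : bool -> affine) : Prop :=
  (forall x, (Gammah D `&` osimplex T) x -> aff (p true) x = aff (p false) x) /\
  betaT D T true * dot (p true).1 (nh D T) =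
  betaT D T false * dot (p false).1 (nh D T).

Definition local_space T (p : bool -> affine) : Prop :=
  if T \in Gcells P M then immersed T p else p true = p false.

Definition jump (v : broken) F x : R := value v (T1 F) x - value v (T2 F) x.

Definition VIFE (v : broken) : Prop :=
  (forall T, T \in cells M -> local_space T (v T)) /\
  (forall F, F \in interior_faces M -> face_integral F (jump v F) = 0).

Definition VIFE0 (v : broken) : Prop :=
  VIFE v /\
  forall F T, F \in boundary_faces M -> T \in face_cells F ->
    face_integral F (value v T) = 0.

Definition nodal_basis (phi : 'I_#|interior_faces M| -> broken) : Prop :=
  forall i, VIFE0 (phi i) /\
    forall F T, F \in faces M -> T \in face_cells F ->
      face_mean F (value (phi i) T) = (F == enum_val i)%:R.

Definition flux_average (q : bfield) F x : R :=
  (betaBK x * dot (q (T1 F) (side x)) (nF F) +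
   betaBK x * dot (q (T2 F) (side x)) (nF F)) / 2.

Definition patch F : set 'rV[R]_N := osimplex (T1 F) `|` osimplex (T2 F).

Definition grad_space T (q : bool -> 'rV[R]_N) : Prop :=
  exists p, local_space T p /\ forall s, q s = (p s).1.

Definition QF F (q : bfield) : Prop :=
  [/\ grad_space (T1 F) (q (T1 F)), grad_space (T2 F) (q (T2 F)) &
      forall T s, T != T1 F -> T != T2 F -> q T s = 0].

Definition is_lifting F (g : 'rV[R]_N -> R) (r : bfield) : Prop :=
  QF F r /\ forall q, QF F q ->
    vol_integral (patch F)
      (fun x => betaBK x * dot (on_Omega r x) (on_Omega q x)) =
    face_integral F (fun x => flux_average q F x * g x).

Definition lifting F (g : 'rV[R]_N -> R) : bfield :=
  xget (fun _ _ => 0) [set r | is_lifting F g r].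

Definition form_a (z v : broken) : R :=
  vol_integral (Omega P) (fun x =>
    betaBK x * dot (on_Omega (gradh z) x) (on_Omega (gradh v) x)).

Definition form_b (z v : broken) : R :=
  - \sum_(F in Gfaces P M) face_integral F (fun x =>
      flux_average (gradh z) F x * jump v F x +
      flux_average (gradh v) F x * jump z F x).

Definition form_s (z v : broken) : R :=
  8 * \sum_(F in Gfaces P M) vol_integral (patch F) (fun x =>
    betaBK x * dot (on_Omega (lifting F (jump z F)) x)
                   (on_Omega (lifting F (jump v F)) x)).

Definition form_A (z v : broken) : R := form_a z v + form_b z v + form_s z v.

Definition stiffness (phi : 'I_#|interior_faces M| -> broken) :
    'M[R]_#|interior_faces M| :=
  \matrix_(i, j) form_A (phi i) (phi j).

End discrete_interface_theory.

Section condition_number.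
Context {R : realType} {n : nat}.

Definition opnorm2 (A : 'M[R]_n) : R :=
  sup [set enorm (A *m x)^T | x in [set x : 'cV[R]_n | enorm x^T = 1]].

Definition cond2 (A : 'M[R]_n) : \bar R :=
  if A \in unitmx then (opnorm2 A * opnorm2 (invmx A))%:E else +oo%E.

End condition_number.

(* Main.v *)
Require Import Defs.
From HB Require Import structures.
From mathcomp Require Import all_boot all_order all_algebra.
From mathcomp Require Import all_classical all_reals all_analysis.
From mathcomp Require Import measurable_realfun ring lra.

Set Implicit Arguments.
Unset Strict Implicit.
Unset Printing Implicit Defensive.

Import Order.TTheory GRing.Theory Num.Theory.
Import numFieldNormedType.Exports.
Local Open Scope classical_set_scope.
Local Open Scope ring_scope.

(** Write [v] for the combination of basis functions with coefficients [x]. By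
    the definition of the liftings, the quadratic form of the stiffness matrix at
    [x] is [a(v,v) - 2 * \sum_F (r_F, grad v)_F + 8 * \sum_F (r_F, r_F)_F], where
    [r_F] lifts the jump of [v] and [( , )_F] is the weighted scalar product on the
    patch of [F]. Young's inequality and the fact that a cell lies in at most
    [N.+1 <= 4] patches give [a(v,v) / 2 <= x^T A x <= 3/2 * a(v,v) + 16 * \sum_F
    (r_F, r_F)_F].

    Upper bound, of order [h^(N-2) |x|^2]: on a cell, [h] times the gradient of
    [v] is bounded by the mean values on the faces. Indeed the mean over a face of
    the positive part of an affine function [l] is, for the faces of one simplex,
    an affine function of the value of [l] at the opposite vertex, with slope
    between [-1/N] and 0 (Hermite-Genocchi formula for divided differences), so
    the face means determine the gradient up to a controlled rank one
    perturbation. The liftings are then bounded by testing with themselves.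

    Lower bound, of order [h^N |x|^2]: a discrete Poincare inequality. From a
    generic point of each cell, a ray in a fixed direction crosses only interiors
    of faces and meets O(1/h) cells before reaching a boundary face, where the mean
    value is 0; along the ray, the face means vary by at most [C h |grad v|] in each
    cell. Conversely, a cell is met by the rays of O(1/h) cells. Both counts
    come from the volume of a tube. *)

(** * Euclidean vectors and the condition number *)

(** The obstacle is uniformity in the position of the interface: a cut may leave an arbitrarily thin
    piece of a cell, so no estimate may divide by the size of a piece. Two devices avoid this. The
    pair of affine functions on a cut cell is encoded by a single gradient through [ext], which
    distorts norms by a factor between [contrast^-1] and [contrast], so energies are compared on
    whole cells. The rank one perturbation linking face means to the gradient has normal factor
    [N^-1 + kap T * G] with [0 <= G <= N^-1] and [1 + kap T >= contrast^-1]; it is at least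
    [(N * contrast)^-1] wherever the cut passes. Traces on faces are cut as well, which is why
    integrals of positive parts over faces are studied through divided differences. Smallness of the
    interface cells enters through [interface_clearance]: a closed cut cell stays inside [Omega], so
    each point of its faces is on a discrete side or on [Gammah], and the sign used on a face can be
    tied to the equation of the hyperplane. *)

Section euclidean.
Context {R : realType} {N : nat}.
Implicit Types (x y z : 'rV[R]_N) (a : R).

Lemma dotC x y : dot x y = dot y x.
Proof. by apply: eq_bigr => i _; rewrite mulrC. Qed.

Lemma dotDl x y z : dot (x + y) z = dot x z + dot y z.
Proof. by rewrite -big_split; apply: eq_bigr => i _; rewrite mxE mulrDl. Qed.

Lemma dotZl a x y : dot (a *: x) y = a * dot x y.
Proof. by rewrite mulr_sumr; apply: eq_bigr => i _; rewrite mxE mulrA. Qed.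

Lemma dot0l x : dot 0 x = 0.
Proof. by rewrite /dot big1// => i _; rewrite mxE mul0r. Qed.

Lemma dotNl x y : dot (- x) y = - dot x y.
Proof. by rewrite -scaleN1r dotZl mulN1r. Qed.

Lemma dotBl x y z : dot (x - y) z = dot x z - dot y z.
Proof. by rewrite dotDl dotNl. Qed.

Lemma dotDr x y z : dot z (x + y) = dot z x + dot z y.
Proof. by rewrite ![dot z _]dotC dotDl. Qed.

Lemma dotZr a x y : dot y (a *: x) = a * dot y x.
Proof. by rewrite ![dot y _]dotC dotZl. Qed.

Lemma dot0r x : dot x 0 = 0.
Proof. by rewrite dotC dot0l. Qed.

Lemma dotNr x y : dot y (- x) = - dot y x.
Proof. by rewrite ![dot y _]dotC dotNl. Qed.

Lemma dotBr x y z : dot z (x - y) = dot z x - dot z y.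
Proof. by rewrite dotDr dotNr. Qed.

Lemma dot_suml (I : Type) (r : seq I) (Q : pred I) (f : I -> 'rV[R]_N) y :
  dot (\sum_(i <- r | Q i) f i) y = \sum_(i <- r | Q i) dot (f i) y.
Proof.
by apply: (big_morph (fun x => dot x y)) => [u v|]; rewrite ?dotDl ?dot0l.
Qed.

Lemma dot_sumr (I : Type) (r : seq I) (Q : pred I) (f : I -> 'rV[R]_N) y :
  dot y (\sum_(i <- r | Q i) f i) = \sum_(i <- r | Q i) dot y (f i).
Proof. by rewrite dotC dot_suml; apply: eq_bigr => i _; rewrite dotC. Qed.

Lemma dot_delta x i : dot x (delta_mx 0 i) = x 0 i.
Proof.
rewrite /dot (bigD1 i)//= mxE !eqxx mulr1 big1 ?addr0// => j ji.
by rewrite mxE (negPf ji) andbF mulr0.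
Qed.

Lemma dot_ge0 x : 0 <= dot x x.
Proof. by apply: sumr_ge0 => i _; rewrite -expr2 sqr_ge0. Qed.

Lemma dot_eq0 x : (dot x x == 0) = (x == 0).
Proof.
apply/idP/eqP => [|->]; last by rewrite dot0l.
rewrite /dot psumr_eq0 => [/allP x0|i _]; last by rewrite -expr2 sqr_ge0.
apply/rowP => i; apply/eqP; have := x0 i (mem_index_enum _).
by rewrite mxE -expr2 sqrf_eq0.
Qed.

Lemma enorm_ge0 x : 0 <= enorm x.
Proof. exact: sqrtr_ge0. Qed.

Lemma enorm_sqr x : enorm x ^+ 2 = dot x x.
Proof. by rewrite sqr_sqrtr// dot_ge0. Qed.

Lemma enorm0 : enorm (0 : 'rV[R]_N) = 0.
Proof. by rewrite /enorm dot0l sqrtr0. Qed.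

Lemma enorm_eq0 x : (enorm x == 0) = (x == 0).
Proof. by rewrite -dot_eq0 -enorm_sqr sqrf_eq0. Qed.

Lemma enormZ a x : enorm (a *: x) = `|a| * enorm x.
Proof.
by rewrite /enorm dotZl dotZr mulrA -expr2 sqrtrM ?sqr_ge0// sqrtr_sqr.
Qed.

Lemma enormN x : enorm (- x) = enorm x.
Proof. by rewrite -scaleN1r enormZ normrN1 mul1r. Qed.

Lemma dot_sqr_le x y : dot x y ^+ 2 <= dot x x * dot y y.
Proof.
have [->|y0] := eqVneq y 0; first by rewrite !dot0r expr0n mulr0.
have yy : 0 < dot y y by rewrite lt_neqAle eq_sym dot_eq0 y0 dot_ge0.
have := dot_ge0 (dot y y *: x - dot x y *: y).
rewrite dotBl !dotBr !dotZl !dotZr (dotC y x).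
rewrite (_ : _ - _ = dot y y * (dot x x * dot y y - dot x y ^+ 2)); last by ring.
by rewrite pmulr_rge0// subr_ge0.
Qed.

Lemma dot_le x y : `|dot x y| <= enorm x * enorm y.
Proof.
rewrite -[leRHS]ger0_norm ?mulr_ge0 ?enorm_ge0//.
by rewrite -ler_sqr ?nnegrE// !real_normK ?num_real// exprMn !enorm_sqr dot_sqr_le.
Qed.

Lemma enormD x y : enorm (x + y) <= enorm x + enorm y.
Proof.
rewrite -ler_sqr ?nnegrE ?addr_ge0 ?enorm_ge0//.
rewrite enorm_sqr sqrrD dotDl !dotDr (dotC y x) !enorm_sqr.
have := le_trans (ler_norm _) (dot_le x y); lra.
Qed.

Lemma enorm_sum (I : Type) (r : seq I) (Q : pred I) (f : I -> 'rV[R]_N) :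
  enorm (\sum_(i <- r | Q i) f i) <= \sum_(i <- r | Q i) enorm (f i).
Proof.
elim/big_ind2 : _ => [|u a v b ua vb|//]; first by rewrite enorm0.
by rewrite (le_trans (enormD _ _))// lerD.
Qed.

Lemma coord_le_enorm x i : `|x 0 i| <= enorm x.
Proof.
rewrite -ler_sqr ?nnegrE ?enorm_ge0// enorm_sqr real_normK ?num_real//.
rewrite /dot (bigD1 i)//= expr2 lerDl sumr_ge0// => j _.
by rewrite -expr2 sqr_ge0.
Qed.

Lemma enorm_le_sup x a : 0 <= a -> (forall i, `|x 0 i| <= a) ->
  enorm x <= N%:R * a.
Proof.
move=> a0 xa; rewrite -ler_sqr ?nnegrE ?mulr_ge0 ?enorm_ge0 ?ler0n//.
rewrite enorm_sqr exprMn.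
have [N0|N0] := posnP N.
  by rewrite /dot big1 ?mulr_ge0 ?sqr_ge0// => i; have := ltn_ord i; rewrite {2}N0.
apply: (@le_trans _ _ (N%:R * a ^+ 2)); last first.
  by rewrite ler_wpM2r ?sqr_ge0// -natrX ler_nat -{1}(expn1 N) leq_pexp2l.
rewrite mulr_natl -[X in _ *+ X]card_ord -sumr_const; apply: ler_sum => i _.
by rewrite -expr2 -real_normK ?num_real// ler_sqr ?nnegrE//.
Qed.

Lemma enorm_le_norm x : enorm x <= N%:R * `|x|.
Proof.
apply: enorm_le_sup => // i; rewrite [leRHS]/Num.norm/= mx_normrE.
exact: (le_bigmax _ (fun ij => `|x ij.1 ij.2|) (0, i)).
Qed.

End euclidean.

Section condition_number_bound.
Context {R : realType} {n : nat}.
Implicit Types (A : 'M[R]_n) (x y : 'cV[R]_n).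

Definition qform A x y : R := (x^T *m A *m y) 0 0.

Lemma qformE A x y : qform A x y = dot x^T (A *m y)^T.
Proof.
by rewrite /qform -mulmxA mxE; apply: eq_bigr => i _; rewrite !mxE.
Qed.

Lemma qform_sum A x y :
  qform A x y = \sum_i \sum_j x i 0 * y j 0 * A i j.
Proof.
rewrite qformE; apply: eq_bigr => i _; rewrite !mxE mulr_sumr.
by apply: eq_bigr => j _; rewrite mulrA mulrAC.
Qed.

Lemma qformC A x y : A^T = A -> qform A x y = qform A y x.
Proof.
move=> sA; rewrite !qform_sum exchange_big; apply: eq_bigr => i _ /=.
by apply: eq_bigr => j _; rewrite (mulrC (x j 0)) -{1}sA mxE.
Qed.

Lemma qform_CS A x y : A^T = A -> (forall z, 0 <= qform A z z) ->
  qform A x y ^+ 2 <= qform A x x * qform A y y.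
Proof.
move=> sA pA.
have H t : 0 <= qform A x x + t * (2 * qform A x y) + t ^+ 2 * qform A y y.
  have := pA (x + t *: y); rewrite qformE mulmxDr -scalemxAr.
  have tr u v : (u + t *: v : 'cV[R]_n)^T = u^T + t *: v^T.
    by rewrite linearD/= linearZ.
  rewrite !tr dotDl !dotDr !dotZl !dotZr -!qformE (qformC y x sA).
  by rewrite [X in 0 <= X -> _](_ : _ = qform A x x + t * (2 * qform A x y) +
    t ^+ 2 * qform A y y)//; ring.
have [yy0|yy0] := eqVneq (qform A y y) 0.
  rewrite yy0 mulr0; have [->|xy0] := eqVneq (qform A x y) 0.
    by rewrite expr0n.
  (* If [y] is isotropic the polynomial in [H] is affine in [t], and this [t] would give it the
     value -1. *)
  have := H (- (qform A x x + 1) / (2 * qform A x y)).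
  rewrite yy0 mulr0 addr0 mulfVK ?mulf_neq0 ?pnatr_eq0//; lra.
have yy : 0 < qform A y y by rewrite lt_neqAle eq_sym yy0 pA.
(* The minimizer of the quadratic polynomial in [H]. *)
have := H (- qform A x y / qform A y y).
have -> : qform A x x + - qform A x y / qform A y y * (2 * qform A x y) +
    (- qform A x y / qform A y y) ^+ 2 * qform A y y =
    (qform A x x * qform A y y - qform A x y ^+ 2) / qform A y y by field.
by rewrite pmulr_lge0 ?invr_gt0// subr_ge0.
Qed.

Lemma posdef_unitmx A : (forall x, x != 0 -> 0 < qform A x x) -> A \in unitmx.
Proof.
move=> pA; rewrite -unitmx_tr -row_free_unit; apply/row_freeP.
have kA : kermx A^T == 0.
  apply/eqP/row_matrixP => i; rewrite row0; apply/eqP/negP => /negP k0.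
  have kt : (row i (kermx A^T))^T != 0.
    by apply: contra k0 => /eqP k0; rewrite -[row _ _]trmxK k0 trmx0.
  have := pA _ kt; rewrite qformE (_ : A *m _ = 0) ?trmx0 ?dot0r ?ltxx//.
  apply: trmx_inj; rewrite trmx_mul trmxK trmx0.
  by rewrite -row_mul mulmx_ker row0.
have : row_free A^T by rewrite -kermx_eq0.
by move/row_freeP.
Qed.

Lemma opnorm2_le A (b : R) : 0 <= b ->
  (forall x, enorm (A *m x)^T <= b * enorm x^T) -> opnorm2 A <= b.
Proof.
move=> b0 Ab; rewrite /opnorm2.
set S := [set _ | x in _].
have [->|/set0P S0] := eqVneq S set0; first by rewrite sup0.
apply: ge_sup => // _ [x /= x1 <-].
by rewrite (le_trans (Ab x))// x1 mulr1.
Qed.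

(** [sup] is 0 by convention on an empty or unbounded set, so these cases are settled by the default
    value. *)
Lemma opnorm2_ge0 A : 0 <= opnorm2 A.
Proof.
rewrite /opnorm2; set S := [set _ | x in _].
have [->|/set0P[y Sy]] := eqVneq S set0; first by rewrite sup0.
have [_|nS] := pselect (has_sup S); last by rewrite sup_out.
case: Sy => x /= x1 yE; have [ubS|nub] := pselect (has_ubound S).
  by rewrite (le_trans (enorm_ge0 (A *m x)^T))// ub_le_sup//; exists x.
by rewrite sup_out// => -[].
Qed.

(** Eigenvalues are avoided. Cauchy-Schwarz for the form [qform A] at the pair [A *m x], [x] reads
    [|A x|^4 <= (hi |A x|^2) (hi |x|^2)], which bounds [A]. For the inverse, with [x = A *m y],
    coercivity gives [lo |y|^2 <= dot y x <= |y| |x|]. *)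
Lemma cond2_le A (lo hi : R) : A^T = A -> 0 < lo -> 0 <= hi ->
  (forall x, lo * dot x^T x^T <= qform A x x) ->
  (forall x, qform A x x <= hi * dot x^T x^T) ->
  (cond2 A <= (hi / lo)%:E)%E.
Proof.
move=> sA lo0 hi0 Alo Ahi.
have pA x : 0 <= qform A x x.
  by rewrite (le_trans _ (Alo x))// mulr_ge0 ?dot_ge0// ltW.
have uA : A \in unitmx.
  apply: posdef_unitmx => x x0; rewrite (lt_le_trans _ (Alo x))// mulr_gt0//.
  rewrite lt_neqAle dot_ge0 andbT eq_sym dot_eq0.
  by apply: contra x0 => /eqP x0; rewrite -[x]trmxK x0 trmx0.
rewrite /cond2 uA lee_fin.
have A1 : opnorm2 A <= hi.
  apply: opnorm2_le => // x.
  have := qform_CS (A *m x) x sA pA; rewrite qformE -enorm_sqr -exprM => CS.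
  have {CS} : enorm (A *m x)^T ^+ 4 <=
      (hi * (enorm (A *m x)^T ^+ 2)) * (hi * enorm x^T ^+ 2).
    by rewrite (le_trans CS)// !enorm_sqr ler_pM.
  have := enorm_ge0 (A *m x)^T; have := enorm_ge0 x^T.
  move: (enorm x^T) (enorm (A *m x)^T) hi hi0 {Ahi} => b a m m0 b0 a0 H.
  have [->|aN0] := eqVneq a 0; first by rewrite mulr_ge0.
  rewrite -ler_sqr ?nnegrE ?mulr_ge0//.
  have a2 : 0 < a ^+ 2 by rewrite exprn_gt0// lt_neqAle eq_sym aN0.
  rewrite -(ler_pM2l a2); apply: (le_trans _ (le_trans H _)).
    by rewrite -exprD.
  by rewrite le_eqVlt; apply/orP; left; apply/eqP; ring.
have A2 : opnorm2 (invmx A) <= lo^-1.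
  apply: opnorm2_le => [|x]; first by rewrite invr_ge0 ltW.
  set y := invmx A *m x; have xE : x = A *m y by rewrite mulKVmx.
  rewrite -(ler_pM2l lo0) mulrA divff ?gt_eqF// mul1r.
  have [->|yN0] := eqVneq (enorm y^T) 0; first by rewrite mulr0 enorm_ge0.
  have y0 : 0 < enorm y^T by rewrite lt_neqAle eq_sym yN0 enorm_ge0.
  rewrite -(ler_pM2r y0) -mulrA -expr2 enorm_sqr (le_trans (Alo y))//.
  by rewrite qformE -xE (le_trans (ler_norm _))// (le_trans (dot_le _ _))// mulrC.
by rewrite ler_pM ?opnorm2_ge0.
Qed.

End condition_number_bound.

(** * Lebesgue measure and volume integrals *)

Section null_sets.
Context d (T : measurableType d) (R : realType).
Variable mu : {measure set T -> \bar R}.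
Import HBNNSimple.
Local Open Scope ereal_scope.

(** The function [f] and the domain [D] are arbitrary: the integral is a supremum over simple
    functions below [f], and cutting such a function off on [Z] keeps its integral. This lets traces
    on faces be changed on a null set before their measurability is discussed. *)
Lemma ge0_integral_setD_null (D Z : set T) (f : T -> \bar R) :
  measurable Z -> mu Z = 0 -> (forall x, D x -> 0 <= f x) ->
  \int[mu]_(x in D) f x = \int[mu]_(x in D `\` Z) f x.
Proof.
move=> mZ Z0 f0; rewrite !ge0_integralE//; last by move=> x [/f0].
apply/eqP; rewrite eq_le; apply/andP; split; last first.
  apply: ereal_sup_le => _ [h hf <-]; exists h => // x.
  rewrite (le_trans (hf x))// /patch; case: ifPn => [|_].
    by rewrite inE => -[Dx _]; rewrite ifT ?inE.
  by case: ifPn => //; rewrite inE => /f0.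
apply: ge_ereal_sup => _ [h /= hf <-]; apply: ereal_sup_ubound => /=.
have mZC : measurable (~` Z) by exact: measurableC.
exists (proj_nnsfun h mZC) => [x|].
  rewrite -(mrestrict h mZC) /patch in_setC.
  case: ifPn => [xZ|_]; last by case: ifPn => //; rewrite inE => -[/f0].
  have := hf x; rewrite /patch; case: ifPn => [xD|xD].
    by rewrite ifT// inE; split; [exact: set_mem xD|by move: xZ; rewrite notin_setE].
  by rewrite ifN// notin_setE; rewrite notin_setE in xD => -[].
rewrite -(mrestrict h mZC) -integral_nnsfun//.
rewrite [RHS](_ : _ = sintegral mu (h \_ setT)); last by rewrite patch_setT.
rewrite -integral_nnsfun// [in RHS](@ge0_negligible_integral _ _ _ _ _ Z)//.
- by rewrite setTD.
- exact/measurable_EFinP.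
- by move=> x _; rewrite lee_fin.
Qed.

Lemma integral_setD_null (D Z : set T) (f : T -> \bar R) :
  measurable Z -> mu Z = 0 ->
  \int[mu]_(x in D) f x = \int[mu]_(x in D `\` Z) f x.
Proof.
move=> mZ Z0; rewrite integralE [RHS]integralE.
by rewrite -!(ge0_integral_setD_null mZ Z0)// => x _; rewrite ?funepos_ge0 ?funeneg_ge0.
Qed.

End null_sets.

(** * Lebesgue measure on tuples: open sets, boxes, hyperplanes *)

Section tuple_measure.
Context {R : realType}.
Local Notation vec := (@vec_of_tuple R _).

Lemma measurable_coord n (i : 'I_n) :
  measurable_fun setT (fun t : n.-tuple (measurableTypeR R) => vec t 0 i).
Proof.
rewrite (_ : (fun _ => _) = (@tnth n (measurableTypeR R)) ^~ i).
  exact: measurable_tnth.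
by apply/funext => t; rewrite mxE.
Qed.

(** The measurable sets come from the product structure on tuples and the open sets from the matrix
    topology. The bridge is that an open set is a countable union of cubes with rational centres and
    radii [k.+1%:R^-1]. *)
Lemma measurable_vec_open n (U : set 'rV[R]_n) : open U ->
  measurable (@vec_of_tuple R n @^-1` U).
Proof.
move=> oU.
pose box (qk : 'rV[rat]_n * nat) : set 'rV[R]_n :=
  [set x | forall i, `|x 0 i - ratr (qk.1 0 i)| < qk.2.+1%:R^-1].
have mbox qk : measurable (@vec_of_tuple R n @^-1` box qk).
  rewrite (_ : _ @^-1` _ = \bigcap_(i in [set: 'I_n])
     ((fun t => vec t 0 i) @^-1` ball (ratr (qk.1 0 i) : R) qk.2.+1%:R^-1)).
    apply: fin_bigcap_measurable => // i _.
    rewrite -[X in measurable X]setTI; apply: measurable_coord => //.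
    exact: measurable_ball.
  apply/seteqP; split => t /= tq i; first by move=> _; rewrite /ball/= distrC.
  by have := tq i Logic.I; rewrite /ball/= distrC.
have -> : @vec_of_tuple R n @^-1` U =
    \bigcup_(qk in [set: 'rV[rat]_n * nat])
      (if `[< box qk `<=` U >] then @vec_of_tuple R n @^-1` box qk else set0).
  apply/seteqP; split => t /=; last first.
    by case=> qk _; case: asboolP => // + ?; exact.
  move=> Ut; have /nbhs_ballP[e /= e0 eU] := open_nbhs_nbhs (conj oU Ut).
  have [k ke] : exists k : nat, k.+1%:R^-1 < e / 2 :> R.
    have [k /= _ /(_ k)] := near_infty_natSinv_lt (PosNum (divr_gt0 e0 (ltr0n _ 2))).
    by move=> /(_ (leqnn _)); exists k.
  have qP i : exists q : rat, `|vec t 0 i - ratr q| < k.+1%:R^-1.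
    have b0 : ball (vec t 0 i : R) k.+1%:R^-1 !=set0.
      by exists (vec t 0 i); exact: ballxx.
    have [x [bx [q _ qx]]] := dense_rat b0 (ball_open _ _).
    by exists q; rewrite qx.
  have [q qE] := choice qP.
  exists (\row_i q i, k) => //; case: asboolP => [_ i|].
    by rewrite /= mxE.
  case=> y yb; apply: eU; split => // i j; rewrite ord1.
  have := yb j; rewrite /= mxE distrC => /(lt_trans)/(_ ke) b1.
  have /lt_trans/(_ ke) b2 := qE j.
  rewrite /ball/= -(subrKA (ratr (q j))) (le_lt_trans (ler_normD _ _))//.
  by rewrite (splitr e) ltrD.
apply: countable_bigcupT_measurable; first exact: countableP.
by move=> qk; case: ifPn.
Qed.

Definition closed_box n (a b : 'rV[R]_n) : set 'rV[R]_n :=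
  [set x | forall i, a 0 i <= x 0 i <= b 0 i].

Lemma measurable_closed_box n (a b : 'rV[R]_n) :
  measurable (@vec_of_tuple R n @^-1` closed_box a b).
Proof.
rewrite (_ : _ @^-1` _ = \bigcap_(i in [set: 'I_n])
   ((fun t => vec t 0 i) @^-1` `[a 0 i, b 0 i])).
  apply: fin_bigcap_measurable => // i _.
  by rewrite -[X in measurable X]setTI; apply: measurable_coord.
apply/seteqP; split => t /= tq i; first by move=> _; rewrite /= in_itv; apply: tq.
by have := tq i Logic.I; rewrite /= in_itv.
Qed.

Lemma measurable_vec_closed n (F : set 'rV[R]_n) : closed F ->
  measurable (@vec_of_tuple R n @^-1` F).
Proof.
move=> /closed_openC/measurable_vec_open.
by rewrite preimage_setC => /measurableC; rewrite setCK.
Qed.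

Lemma vec_cons0 n x (t : n.-tuple (measurableTypeR R)) :
  vec (cons_pair (x, t)) 0 ord0 = x.
Proof. by rewrite mxE tnth0. Qed.

Lemma vec_consS n x (t : n.-tuple (measurableTypeR R)) i :
  vec (cons_pair (x, t)) 0 (lift ord0 i) = vec t 0 i.
Proof. by rewrite !mxE tnthS. Qed.

Lemma closed_box_measure n (a b : 'rV[R]_n) : (forall i, a 0 i <= b 0 i) ->
  lebesgue_tuple n (@vec_of_tuple R n @^-1` closed_box a b) =
  (\prod_i (b 0 i - a 0 i))%:E.
Proof.
elim: n => [|n IH] in a b * => ab.
  rewrite big_ord0 /= diracE mem_set// => -[]//.
pose a' := \row_i a 0 (lift ord0 i); pose b' := \row_i b 0 (lift ord0 i).
rewrite /= /lebesgue_cons /pushforward.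
rewrite (_ : _ @^-1` _ = `[a 0 ord0, b 0 ord0] `*`
   (@vec_of_tuple R n @^-1` closed_box a' b')); last first.
  apply/seteqP; split => -[x t] /=.
    move=> H; split; first by have := H ord0; rewrite vec_cons0 in_itv.
    by move=> i; have := H (lift ord0 i); rewrite vec_consS /a' /b' !mxE.
  move=> [H0 H] i; have [j ->|->] := unliftP ord0 i.
    by have := H j; rewrite vec_consS /a' /b' !mxE.
  by move: H0; rewrite vec_cons0 in_itv.
rewrite product_measure1E//; last exact: measurable_closed_box.
rewrite IH => [|i]; last by rewrite !mxE.
have L : lebesgue_measure (`[a 0 ord0, b 0 ord0]%classic : set R) =
    (b 0 ord0 - a 0 ord0)%:E.
  rewrite lebesgue_measure_itv/= lte_fin.
  by have := ab ord0; rewrite le_eqVlt => /predU1P[->|->]; rewrite ?ltxx ?subrr.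
rewrite big_ord_recl EFinM; congr (_ * _)%E; first exact: L.
by congr EFin; apply: eq_bigr => i _; rewrite !mxE.
Qed.

Lemma dot_continuous n (a : 'rV[R]_n) : continuous (dot a).
Proof.
suff H (r : seq 'I_n) : continuous (fun y : 'rV[R]_n => \sum_(i <- r) a 0 i * y 0 i).
  exact: H.
elim: r => [|i r IH].
  have -> : (fun y : 'rV[R]_n => \sum_(i <- [::]) a 0 i * y 0 i) = cst 0.
    by apply/funext => y; rewrite big_nil.
  exact: cst_continuous.
have -> : (fun y : 'rV[R]_n => \sum_(i <- i :: r) a 0 i * y 0 i) =
    (fun y => a 0 i * y 0 i + \sum_(i <- r) a 0 i * y 0 i).
  by apply/funext => y; rewrite big_cons.
move=> x; apply: (@continuousD R R^o _ (fun y : 'rV[R]_n => a 0 i * y 0 i)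
  (fun y : 'rV[R]_n => \sum_(i <- r) a 0 i * y 0 i)); last exact: IH.
apply: (@continuousM R _ (fun _ : 'rV[R]_n => a 0 i) (fun y : 'rV[R]_n => y 0 i)).
  exact: cst_continuous.
exact: coord_continuous.
Qed.

Lemma closed_hyperplane n (a : 'rV[R]_n) b : closed [set x | dot a x = b].
Proof.
rewrite (_ : [set x | _] = dot a @^-1` [set b])//.
by apply: preimage_closed => [x _|]; [exact: dot_continuous|exact: closed_eq].
Qed.

(** Fubini along the first coordinate. If it does not enter the equation, the slices are hyperplanes
    in one dimension less; otherwise, with the order of integration exchanged, the slices are single
    points. *)
Lemma hyperplane_null n (a : 'rV[R]_n) b : a != 0 ->
  lebesgue_tuple n (@vec_of_tuple R n @^-1` [set x | dot a x = b]) = 0%E.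
Proof.
elim: n => [|n IH] in a b *; first by rewrite [a]thinmx0 eqxx.
move=> a0; pose a' := \row_i a 0 (lift ord0 i).
have mB := measurable_vec_closed (@closed_hyperplane n.+1 a b).
rewrite /= /lebesgue_cons /pushforward; set B := _ @^-1` (_ @^-1` _).
have {}mB : measurable B.
  by rewrite -[B]setTI; exact: measurable_cons_pair.
have BE x t : B (x, t) <-> a 0 ord0 * x + dot a' (vec t) = b.
  rewrite /B/= {1}/dot big_ord_recl vec_cons0.
  suff -> : \sum_(i < n) a 0 (lift ord0 i) * vec (cons_pair (x, t)) 0 (lift ord0 i)
    = dot a' (vec t) by [].
  by apply: eq_bigr => i _; rewrite vec_consS [a' _ _]mxE.
have [a00|a00] := eqVneq (a 0 ord0) 0.
  apply: integral0_eq => x _ /=.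
  rewrite (_ : xsection B x = vec @^-1` [set y | dot a' y = b]).
    apply: IH; apply: contra a0 => /eqP a'0; apply/eqP/rowP => i; rewrite mxE.
    have [j ->|->//] := unliftP ord0 i.
    by have /rowP/(_ j) := a'0; rewrite !mxE.
  apply/seteqP; split => t.
    by rewrite /xsection/= inE BE a00 mul0r add0r.
  by rewrite /xsection/= inE BE a00 mul0r add0r.
rewrite (product_measure_unique (m' := (lebesgue_measure \x^ lebesgue_tuple n)%E))//.
- apply: integral0_eq => t _ /=.
  rewrite (_ : ysection B t = [set (b - dot a' (vec t)) / a 0 ord0]).
    exact: lebesgue_measure_set1.
  apply/seteqP; split => x; rewrite /ysection/= inE BE => H.
    by rewrite -H addrK mulrAC divff// mul1r.
  by rewrite H mulrC divfK// subrK.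
- by move=> A1 A2 mA1 mA2; exact: product_measure2E.
Qed.

End tuple_measure.

(** * Volume integrals of bounded measurable functions *)

Section vol_integral_theory.
Context {R : realType} {n : nat}.
Local Notation mu := (@lebesgue_tuple R n).
Local Notation vec := (@vec_of_tuple R n).
Implicit Types (A B S : set 'rV[R]_n) (f g : 'rV[R]_n -> R).

Definition vmeas A := measurable (vec @^-1` A).
Definition ebounded A := exists M : R, forall x, A x -> enorm x <= M.
(** On a bounded measurable set this implies integrability, and it is stable under products, which
    integrability alone is not. *)
Definition mbounded A f :=
  measurable_fun (vec @^-1` A) (f \o vec) /\
  exists M : R, forall x, A x -> `|f x| <= M.
Definition vol A : R := fine (mu (vec @^-1` A)).

Lemma ebounded_box A M : (forall x, A x -> enorm x <= M) ->
  A `<=` closed_box (const_mx (- M)) (const_mx M).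
Proof.
move=> AM x /AM xM i; rewrite !mxE -ler_norml.
exact: le_trans (coord_le_enorm x i) xM.
Qed.

Lemma vol_fin A : vmeas A -> ebounded A -> (mu (vec @^-1` A) < +oo)%E.
Proof.
move=> mA [M AM]; have AB : A `<=` closed_box (const_mx (- `|M|)) (const_mx `|M|).
  by apply: ebounded_box => x /AM/le_trans; apply; rewrite ler_norm.
apply: (@le_lt_trans _ _
    (mu (vec @^-1` closed_box (const_mx (- `|M|)) (const_mx `|M|)))).
  apply: le_measure; rewrite ?inE//; first exact: measurable_closed_box.
  by move=> t; exact: AB.
by rewrite closed_box_measure ?ltry// => i; rewrite !mxE ge0_cp.
Qed.

Lemma volE A : vmeas A -> ebounded A -> (vol A)%:E = mu (vec @^-1` A).
Proof.
by move=> mA bA; rewrite fineK// ge0_fin_numE// vol_fin.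
Qed.

Lemma vol_ge0 A : 0 <= vol A.
Proof. exact: fine_ge0. Qed.

Lemma le_vol A B : vmeas A -> vmeas B -> ebounded B -> A `<=` B -> vol A <= vol B.
Proof.
move=> mA mB bB AB; have bA : ebounded A.
  by case: bB => M BM; exists M => x /AB/BM.
rewrite -lee_fin !volE//; apply: le_measure; rewrite ?inE// => t; exact: AB.
Qed.

Lemma vmeasI A B : vmeas A -> vmeas B -> vmeas (A `&` B).
Proof. by move=> mA mB; exact: measurableI. Qed.

Lemma vmeasD A B : vmeas A -> vmeas B -> vmeas (A `\` B).
Proof. by move=> mA mB; exact: measurableD. Qed.

Lemma mboundedS A B f : vmeas B -> A `<=` B -> mbounded B f -> mbounded A f.
Proof.
move=> mB AB [mf [M fM]]; split; last by exists M => x /AB/fM.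
by apply: measurable_funS mf => // t; exact: AB.
Qed.

Lemma mbounded_cst A c : mbounded A (cst c).
Proof. by split; [exact: measurable_cst|exists `|c|]. Qed.

Lemma mboundedD A f g : mbounded A f -> mbounded A g ->
  mbounded A (fun x => f x + g x).
Proof.
move=> [mf [M fM]] [mg [M' gM]]; split; first exact: measurable_funD.
by exists (M + M') => x Ax; rewrite (le_trans (ler_normD _ _))// lerD ?fM ?gM.
Qed.

Lemma mboundedM A f g : mbounded A f -> mbounded A g ->
  mbounded A (fun x => f x * g x).
Proof.
move=> [mf [M fM]] [mg [M' gM]]; split; first exact: measurable_funM.
by exists (M * M') => x Ax; rewrite normrM ler_pM ?fM ?gM.
Qed.

Lemma mboundedZ A c f : mbounded A f -> mbounded A (fun x => c * f x).
Proof. by move=> bf; apply: mboundedM => //; exact: mbounded_cst. Qed.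

Lemma mboundedB A f g : mbounded A f -> mbounded A g ->
  mbounded A (fun x => f x - g x).
Proof.
move=> bf bg; have := mboundedD bf (mboundedZ (-1) bg).
by under eq_fun do rewrite mulN1r.
Qed.

Lemma mbounded_sum A (I : Type) (r : seq I) (P : pred I) (f : I -> 'rV[R]_n -> R) :
  (forall i, P i -> mbounded A (f i)) ->
  mbounded A (fun x => \sum_(i <- r | P i) f i x).
Proof.
move=> bf; elim: r => [|i r IH].
  by under [X in mbounded _ X]eq_fun do rewrite big_nil; exact: mbounded_cst.
under [X in mbounded _ X]eq_fun do rewrite big_cons.
by case: (boolP (P i)) => // Pi; exact: mboundedD (bf i Pi) IH.
Qed.

Lemma mbounded_coord A i : ebounded A -> mbounded A (fun x => x 0 i).
Proof.
move=> [M AM]; split.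
  by apply: measurable_funTS; exact: measurable_coord.
by exists M => x /AM; apply/le_trans/coord_le_enorm.
Qed.

Lemma mbounded_dot A a : ebounded A -> mbounded A (dot a).
Proof.
move=> bA; apply: mbounded_sum => i _.
exact/mboundedZ/mbounded_coord.
Qed.

Lemma mbounded_if A S f g : vmeas A -> vmeas S ->
  mbounded (A `&` S) f -> mbounded (A `\` S) g ->
  mbounded A (fun x => if `[< S x >] then f x else g x).
Proof.
move=> mA mS [mf [M fM]] [mg [M' gM]]; split; last first.
  exists (Num.max M M') => x Ax; case: asboolP => Sx.
    by rewrite le_max fM.
  by rewrite le_max gM ?orbT.
have trueE : (fun t => `[< S (vec t) >]) @^-1` [set true] = vec @^-1` S.
  by apply/seteqP; split => t /=; [exact: asboolW|exact: asboolT].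
have falseE : (fun t => `[< S (vec t) >]) @^-1` [set false] = ~` (vec @^-1` S).
  apply/seteqP; split => t /=; last by move=> ?; exact: asboolF.
  by move=> + St; rewrite asboolT.
apply: (@measurable_fun_if _ _ _ _ (f \o vec) (g \o vec) _ mA
  (fun t => `[< S (vec t) >])); rewrite ?trueE ?falseE//.
by apply: (@measurable_fun_bool _ _ _ _ true); rewrite trueE; exact: measurableI.
Qed.

Lemma mbounded_indic A A' f : vmeas A -> vmeas A' ->
  mbounded (A `&` A') f -> mbounded A (fun x => \1_A' x * f x).
Proof.
move=> mA mA' bf; have b0 : mbounded (A `\` A') (cst 0) := mbounded_cst _ 0.
have := mbounded_if mA mA' bf b0; congr mbounded; apply/funext => x.
rewrite indicE; case: asboolP => Ax; first by rewrite mem_set// mul1r.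
by rewrite memNset// mul0r.
Qed.

(** Preimages of open intervals are traces on [A] of open sets. The lemma serves [betaE], which is
    continuous only relative to the closure of each extended subdomain. *)
Lemma mbounded_within A B f (M : R) : vmeas A -> A `<=` B ->
  {within B, continuous f} -> (forall x, A x -> `|f x| <= M) -> mbounded A f.
Proof.
move=> mA AB cf fM; split; last by exists M.
move/continuous_subspaceW : cf => /(_ _ AB)/continuousP cf.
apply: (measurability _ (RGenOpens.measurableE R)) => _ [_ [a [b ->] <-]].
have /open_subspaceP[V oV VA] := cf _ (@interval_open _ (BRight a) (BLeft b) isT isT).
rewrite (_ : _ `&` _ = vec @^-1` (V `&` A)); first by apply: vmeasI => //; exact: measurable_vec_open.
by rewrite VA setIC.
Qed.

Lemma integrable_mbounded A f : vmeas A -> ebounded A -> mbounded A f ->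
  mu.-integrable (vec @^-1` A) (EFin \o (f \o vec)).
Proof.
move=> mA bA [mf [M fM]]; apply: measurable_bounded_integrable => //.
  exact: vol_fin.
exists M; split; first exact: num_real.
by move=> x Mx t At; apply: (le_trans (fM _ At)); exact: ltW.
Qed.

Section integrals.
Variables (A : set 'rV[R]_n) (mA : vmeas A) (bA : ebounded A).

Lemma vol_integralD f g : mbounded A f -> mbounded A g ->
  vol_integral A (fun x => f x + g x) = vol_integral A f + vol_integral A g.
Proof. by move=> bf bg; apply: RintegralD => //; exact: integrable_mbounded. Qed.

Lemma vol_integralZ c f : mbounded A f ->
  vol_integral A (fun x => c * f x) = c * vol_integral A f.
Proof. by move=> bf; apply: RintegralZl => //; exact: integrable_mbounded. Qed.

Lemma vol_integral_cst c : vol_integral A (cst c) = c * vol A.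
Proof. exact: Rintegral_cst. Qed.

Lemma vol_integral_sum (I : Type) (r : seq I) (P : pred I) (f : I -> 'rV[R]_n -> R) :
  (forall i, P i -> mbounded A (f i)) ->
  vol_integral A (fun x => \sum_(i <- r | P i) f i x) =
  \sum_(i <- r | P i) vol_integral A (f i).
Proof.
move=> bf; elim: r => [|i r IH].
  rewrite big_nil -[RHS](mul0r (vol A)) -vol_integral_cst.
  by congr vol_integral; apply/funext => x; rewrite big_nil.
rewrite big_cons; case: ifPn => [Pi|nPi]; last first.
  by rewrite -IH; congr vol_integral; apply/funext => x; rewrite big_cons (negPf nPi).
rewrite -IH -vol_integralD; [|exact: bf|exact: mbounded_sum].
by congr vol_integral; apply/funext => x; rewrite big_cons Pi.
Qed.

Lemma le_vol_integral f g : mbounded A f -> mbounded A g ->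
  (forall x, A x -> f x <= g x) -> vol_integral A f <= vol_integral A g.
Proof.
move=> bf bg fg; apply: le_Rintegral => //; try exact: integrable_mbounded.
by move=> t; exact: fg.
Qed.

Lemma vol_integral_ge0 f : (forall x, A x -> 0 <= f x) -> 0 <= vol_integral A f.
Proof. by move=> f0; apply: Rintegral_ge0 => t; exact: f0. Qed.

Lemma vol_integral_le f c : mbounded A f -> (forall x, A x -> f x <= c) ->
  vol_integral A f <= c * vol A.
Proof.
move=> bf fc; rewrite -vol_integral_cst; apply: le_vol_integral => //.
exact: mbounded_cst.
Qed.

Lemma vol_integral_ge f c : mbounded A f -> (forall x, A x -> c <= f x) ->
  c * vol A <= vol_integral A f.
Proof.
move=> bf fc; rewrite -vol_integral_cst; apply: le_vol_integral => //.
exact: mbounded_cst.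
Qed.

End integrals.

Lemma eq_vol_integral A f g : (forall x, A x -> f x = g x) ->
  vol_integral A f = vol_integral A g.
Proof. by move=> fg; apply: eq_Rintegral => t /set_mem; exact: fg. Qed.

Lemma vol_integral_indic A B f : A `<=` B ->
  vol_integral B (fun x => \1_A x * f x) = vol_integral A f.
Proof.
move=> AB; rewrite /vol_integral (_ : [set t | A (vec t)] =
  [set t | B (vec t)] `&` (vec @^-1` A)); last first.
  by apply/seteqP; split => t /= => [At|[]//]; split=> //; exact: AB.
rewrite Rintegral_mkcondr; apply: eq_Rintegral => t _.
rewrite /patch indicE; case: ifPn; rewrite ?inE => tA.
  by rewrite mem_set// mul1r.
by rewrite memNset ?mul0r// => At; move: tA; rewrite mem_set.
Qed.

Lemma vol_integral_null A S f : vmeas S -> mu (vec @^-1` S) = 0%E ->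
  vol_integral A f = vol_integral (A `\` S) f.
Proof. by move=> mS S0; congr fine; exact: integral_setD_null. Qed.

End vol_integral_theory.

(** * Integrals of ridge functions over the reference simplex *)

Section ftc_affine.
Context {R : realType}.
Variables (psi Phi : R -> R) (cpsi : continuous psi)
  (dPhi : forall x : R, is_derive x 1 Phi (psi x)).

Lemma integral_comp_affine (al d L : R) : d != 0 -> 0 <= L ->
  (\int[lebesgue_measure]_(x in `[0%R, L]) (psi (al + x * d)%R)%:E =
   ((Phi (al + L * d) - Phi al) / d)%:E)%E.
Proof.
move=> d0; rewrite le_eqVlt => /predU1P[<-|L0].
  by rewrite set_itv1 integral_set1 mul0r addr0 subrr mul0r.
pose F x := Phi (al + x * d) / d.
have caff : continuous (fun x : R => al + x * d).
  move=> x; apply: (@cvgD _ R^o); first exact: cvg_cst.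
  by apply: (@cvgM R); [exact: cvg_id|exact: cvg_cst].
have dF (x : R) : is_derive x 1 F (psi (al + x * d)).
  have daff : is_derive x 1 (fun x : R => al + x * d) d.
    by apply: is_derive_eq; rewrite add0r mul1r scaler0 add0r /GRing.scale/= mulr1.
  have := @is_derive1_comp _ Phi (fun x : R => al + x * d) x _ _ (dPhi _) daff.
  move=> /(is_deriveZ d^-1) dc.
  rewrite (_ : F = d^-1 \*: (Phi \o (fun x : R => al + x * d))); last first.
    by apply/funext => y; rewrite /F /= /GRing.scale/= mulrC.
  by apply: is_derive_eq; rewrite /GRing.scale/= mulrCA mulVf ?mulr1.
have cF : continuous F.
  by move=> x; apply/differentiable_continuous/derivable1_diffP; case: (dF x).
rewrite (@continuous_FTC2 _ _ F)//.
- by rewrite /F mul0r addr0 -EFinB mulrBl.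
- by apply: continuous_subspaceT => x; apply: continuous_comp; [exact: caff|exact: cpsi].
- split.
  + by move=> x _; case: (dF x).
  + by apply: cvg_at_right_filter; exact: cF.
  + by apply: cvg_at_left_filter; exact: cF.
- by move=> x _; rewrite derive1E; case: (dF x).
Qed.

End ftc_affine.

Section ridge_integrals.
Context {R : realType}.
Local Notation vec := (@vec_of_tuple R _).

Lemma mbounded_comp n (A : set 'rV[R]_n) psi g :
  continuous psi -> mbounded A g -> mbounded A (psi \o g).
Proof.
move=> cpsi [mg [M gM]]; split.
  by apply: (@measurableT_comp _ _ _ _ _ _ psi) => //; exact: continuous_measurable_fun.
have M0 : - `|M| <= `|M| by rewrite ge0_cp.
have cn : continuous (fun x : R => `|psi x|).
  by move=> x; apply: continuous_comp; [exact: cpsi|exact: norm_continuous].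
have [c _ cmax] := @EVT_max R _ _ _ M0 (continuous_subspaceT cn).
exists `|psi c| => x Ax; apply: cmax.
by rewrite in_itv/= -ler_norml (le_trans (gM _ Ax))// ler_norm.
Qed.

Lemma ref_simplex_closed k : closed (@ref_simplex R k).
Proof.
rewrite (_ : ref_simplex = \bigcap_(i in [set: 'I_k])
    [set t : 'rV[R]_k | 0 <= t 0 i] `&`
    [set t : 'rV[R]_k | dot (const_mx 1) t <= 1]); last first.
  have dE (t : 'rV[R]_k) : dot (const_mx 1) t = \sum_i t 0 i.
    by apply: eq_bigr => i _; rewrite mxE mul1r.
  apply/seteqP; split => t [t0 t1]; split.
  - by move=> i _; exact: t0.
  - by rewrite /= dE.
  - by move=> i; apply: t0.
  - by rewrite -dE.
apply: closedI; last first.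
  by apply: (@preimage_closed _ _ (dot _) [set x | x <= 1]) => [x _|];
    [exact: dot_continuous|exact: closed_le].
apply: closed_bigI => i _.
by apply: (@preimage_closed _ _ (fun t : 'rV[R]_k => t 0 i) [set x | 0 <= x]) => [x _|];
    [exact: coord_continuous|exact: closed_ge].
Qed.

Lemma vmeas_ref_simplex k : vmeas (@ref_simplex R k).
Proof. by apply: measurable_vec_closed; exact: ref_simplex_closed. Qed.

Lemma ref_simplex_coord k (t : 'rV[R]_k) i : ref_simplex t -> 0 <= t 0 i <= 1.
Proof.
move=> [t0 t1]; rewrite t0 (le_trans _ t1)//= (bigD1 i)//= lerDl.
by apply: sumr_ge0.
Qed.

Lemma ebounded_ref_simplex k : ebounded (@ref_simplex R k).
Proof.
exists k%:R => t rt; rewrite -[leRHS]mulr1; apply: enorm_le_sup => // i.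
by have /andP[? ?] := ref_simplex_coord i rt; rewrite ger0_norm.
Qed.

(** [psi] composed with the affine function whose values at the vertices of the reference simplex
    are [a] at the origin and [b 0 i] at the [i]-th unit vector. *)
Definition ridge k (psi : R -> R) (a : R) (b : 'rV[R]_k) (t : 'rV[R]_k) : R :=
  psi (a + \sum_i t 0 i * (b 0 i - a)).

Definition ridge_integral k psi (a : R) (b : 'rV[R]_k) : R :=
  vol_integral (@ref_simplex R k) (ridge psi a b).

Lemma mbounded_ridge k psi a (b : 'rV[R]_k) : continuous psi ->
  mbounded ref_simplex (ridge psi a b).
Proof.
move=> cpsi; apply: mbounded_comp => //; apply: mboundedD.
  exact: mbounded_cst.
apply: mbounded_sum => i _; under [X in mbounded _ X]eq_fun do rewrite mulrC.
by apply/mboundedZ/mbounded_coord/ebounded_ref_simplex.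
Qed.

Lemma ref_simplex_cons k x (t : k.-tuple (measurableTypeR R)) :
  ref_simplex (vec (cons_pair (x, t))) <->
  ref_simplex (vec t) /\ 0 <= x <= 1 - \sum_i vec t 0 i.
Proof.
rewrite /ref_simplex /=.
have -> : \sum_i vec (cons_pair (x, t)) 0 i = x + \sum_i vec t 0 i.
  by rewrite big_ord_recl vec_cons0; congr (_ + _); apply: eq_bigr => i _; rewrite vec_consS.
split=> [[c0 c1]|[[t0 t1] /andP[x0 x1]]].
  have x0 : 0 <= x by have := c0 ord0; rewrite vec_cons0.
  split; last by rewrite x0 lerBrDr.
  split=> [i|]; first by have := c0 (lift ord0 i); rewrite vec_consS.
  by rewrite (le_trans _ c1)// lerDr.
split=> [i|]; last by rewrite -lerBrDr.
by have [j ->|->] := unliftP ord0 i; rewrite ?vec_consS ?vec_cons0.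
Qed.

(** The recursion of divided differences (Hermite-Genocchi formula). *)
Lemma ridge_integral_rec k psi Phi a (b : 'rV[R]_k.+1)
    (b' := \row_i b 0 (lift ord0 i) : 'rV[R]_k) :
  continuous psi -> (forall x : R, is_derive x 1 Phi (psi x)) ->
  (b 0 0 - a) * ridge_integral psi a b =
  ridge_integral Phi (b 0 0) b' - ridge_integral Phi a b'.
Proof.
move=> cpsi dPhi.
have cPhi : continuous Phi.
  by move=> x; apply/differentiable_continuous/derivable1_diffP; case: (dPhi x).
have [ba|ba] := eqVneq (b 0 0 - a) 0.
  by rewrite ba mul0r; move/subr0_eq : ba => ->; rewrite subrr.
pose D := vec @^-1` @ref_simplex R k.+1.
(* The integrand is extended by zero to the whole space, so that Fubini applies to the product
   measure without describing slices of [D]. *)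
pose g := (EFin \o (ridge psi a b \o vec)) \_ D.
have mD : measurable D := @vmeas_ref_simplex k.+1.
have /(integrable_mkcond _ mD) ig :=
  integrable_mbounded (@vmeas_ref_simplex k.+1) (@ebounded_ref_simplex k.+1) (mbounded_ridge a b cpsi).
have mg : measurable_fun setT g by case/integrableP : ig.
pose mu := @lebesgue_tuple R k.
have igc : (lebesgue_measure \x mu)%E.-integrable setT (g \o @cons_pair R k).
  apply/integrableP; split.
    by apply: measurableT_comp => //; exact: measurable_cons_pair.
  case/integrableP : ig => _; apply: le_lt_trans.
  have /= <- := @ge0_integral_pushforward _ _ _ _ _ _ (@measurable_cons_pair R k)
    (lebesgue_measure \x mu)%E setT (abse \o g) measurableT
    (measurableT_comp (@abse_measurable R setT) mg) (fun x _ => abse_ge0 (g x)).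
  by [].
have E1 : (\int[lebesgue_tuple k.+1]_(t in D) (EFin \o (ridge psi a b \o vec)) t =
    \int[mu]_t \int[lebesgue_measure]_x g (cons_pair (x, t)))%E.
  rewrite integral_mkcond -/g.
  rewrite -[RHS]/(\int[mu]_t fubini_G lebesgue_measure (g \o @cons_pair R k) t)%E.
  rewrite (integral21_prod_meas1 igc).
  have := @integral_pushforward _ _ _ _ _ _ (@measurable_cons_pair R k)
    (lebesgue_measure \x mu)%E setT g mg.
  by rewrite preimage_setT; apply.
(* The integral over one slice. The first coordinate runs from 0 to [1 - \sum_i vec t 0 i], and at
   the far end the ridge argument is the one with base value [b 0 0] in place of [a]. *)
pose h t := (ridge Phi (b 0 0) b' t - ridge Phi a b' t) * (b 0 0 - a)^-1.
have E2 t : (\int[lebesgue_measure]_x g (cons_pair (x, t)))%E =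
    ((EFin \o (h \o vec)) \_ (vec @^-1` @ref_simplex R k)) t.
  rewrite [RHS]/patch; case: ifPn => [|] tr; last first.
    apply: integral0_eq => x _; rewrite /g /patch ifN// notin_setE /D /=.
    by move=> /ref_simplex_cons[+ _]; move: tr; rewrite notin_setE.
  have {}tr : ref_simplex (vec t) by move: tr; rewrite inE.
  have t1 : 0 <= 1 - \sum_i vec t 0 i by case: tr => _; rewrite subr_ge0.
  pose al := a + \sum_i vec t 0 i * (b' 0 i - a).
  rewrite (_ : (fun x => g (cons_pair (x, t))) =
    (fun x => (psi (al + x * (b 0 0 - a)))%:E) \_ `[0, 1 - \sum_i vec t 0 i]%classic).
    rewrite -integral_mkcond (integral_comp_affine cpsi dPhi)//=.
    congr EFin; rewrite /h; congr ((_ - _) * _); congr Phi.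
    have -> : \sum_i vec t 0 i * (b' 0 i - b 0 0) =
        \sum_i vec t 0 i * (b' 0 i - a) - (\sum_i vec t 0 i) * (b 0 0 - a).
      rewrite mulr_suml -sumrB; apply: eq_bigr => i _; ring.
    rewrite /al; ring.
  apply/funext => x; rewrite /g /patch; case: ifPn => [|] xD.
    move: xD; rewrite inE => /ref_simplex_cons[_ xt].
    rewrite ifT; last by rewrite inE/= in_itv.
    congr EFin; rewrite /= /ridge big_ord_recl vec_cons0; congr psi.
    rewrite /al -addrA (addrC (\sum_i _)); congr (_ + (_ + _)).
    by apply: eq_bigr => i _; rewrite vec_consS [b' _ _]mxE.
  rewrite ifN// notin_setE/= in_itv/= => xt.
  by move: xD; rewrite notin_setE; apply; apply/ref_simplex_cons.
have -> : ridge_integral psi a b = vol_integral (@ref_simplex R k) h.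
  rewrite /ridge_integral /vol_integral /Rintegral.
  rewrite [X in fine X = _]E1; under [X in fine X = _]eq_integral do rewrite E2.
  by rewrite -integral_mkcond.
have br c : mbounded (@ref_simplex R k) (ridge Phi c b') by exact: mbounded_ridge.
have mr := @vmeas_ref_simplex k; have er := @ebounded_ref_simplex k.
have -> : h = fun t => (b 0 0 - a)^-1 * (ridge Phi (b 0 0) b' t + (-1) * ridge Phi a b' t).
  by apply/funext => t; rewrite /h mulrC mulN1r.
rewrite vol_integralZ// ?vol_integralD// ?vol_integralZ//.
- by rewrite mulrA divff// mul1r mulN1r.
- exact: mboundedZ.
- by apply: mboundedD => //; exact: mboundedZ.
Qed.

End ridge_integrals.

(** * Low dimensional formulas on the reference simplex and the positive part *)

Section reference_means.
Context {R : realType}.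
Local Notation vec := (@vec_of_tuple R _).

Lemma ridge_integral0 psi (a : R) (b : 'rV[R]_0) : ridge_integral psi a b = psi a.
Proof.
rewrite /ridge_integral (@eq_vol_integral _ _ _ _ (cst (psi a))); last first.
  by move=> t _; rewrite /ridge big_ord0 addr0.
rewrite vol_integral_cst; last exact: vmeas_ref_simplex.
rewrite /vol.
have -> : lebesgue_tuple 0 (vec @^-1` @ref_simplex R 0) =
  \d_[tuple] (vec @^-1` @ref_simplex R 0) :> \bar R by [].
rewrite diracE mem_set ?mulr1//=.
by split=> [[]//|]; rewrite big_ord0 ler01.
Qed.

Lemma ridge_integral1 psi Phi (a : R) (b : 'rV[R]_1) :
  continuous psi -> (forall x : R, is_derive x 1 Phi (psi x)) ->
  (b 0 0 - a) * ridge_integral psi a b = Phi (b 0 0) - Phi a.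
Proof.
by move=> cpsi dPhi; rewrite (ridge_integral_rec _ _ cpsi dPhi) !ridge_integral0.
Qed.

(** The right-hand side is the second divided difference of [Psi] at the three vertex values; it
    needs them distinct. *)
Lemma ridge_integral2 psi Phi Psi (a : R) (b : 'rV[R]_2) :
  continuous psi -> (forall x : R, is_derive x 1 Phi (psi x)) ->
  (forall x : R, is_derive x 1 Psi (Phi x)) ->
  b 0 0 != a -> b 0 1 != a -> b 0 0 != b 0 1 ->
  ridge_integral psi a b =
  ((Psi (b 0 1) - Psi (b 0 0)) / (b 0 1 - b 0 0) -
   (Psi (b 0 1) - Psi a) / (b 0 1 - a)) / (b 0 0 - a).
Proof.
move=> cpsi dPhi dPsi n1 n2 n3.
have {}n1 : b 0 0 - a != 0 by rewrite subr_eq0.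
have {}n2 : b 0 1 - a != 0 by rewrite subr_eq0.
have {}n3 : b 0 0 - b 0 1 != 0 by rewrite subr_eq0.
have cPhi : continuous Phi.
  by move=> x; apply/differentiable_continuous/derivable1_diffP; case: (dPhi x).
have := ridge_integral_rec a b cpsi dPhi.
set b' := \row_i _; have b'E : b' 0 0 = b 0 1 by rewrite mxE; congr (b 0 _); apply/val_inj.
have J1 x : b 0 1 - x != 0 -> ridge_integral Phi x b' = (Psi (b 0 1) - Psi x) / (b 0 1 - x).
  move=> x0; have := ridge_integral1 x b' cPhi dPsi; rewrite b'E => <-.
  by rewrite mulrC mulKf.
rewrite !J1//; last by rewrite -opprB oppr_eq0.
by move=> <-; rewrite mulrC mulKf.
Qed.

(** On the reference simplex the argument of [psi] is a convex combination of the vertex values, so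
    moving each of them by at most [d] moves it by at most [d]. *)
Lemma ridge_lipschitz k psi (d : R) (a a' : R) (b b' t : 'rV[R]_k) :
  (forall x y : R, `|psi x - psi y| <= `|x - y|) -> ref_simplex t ->
  `|a - a'| <= d -> (forall i, `|b 0 i - b' 0 i| <= d) ->
  `|ridge psi a b t - ridge psi a' b' t| <= d.
Proof.
move=> lpsi [t0 t1] ad bd; apply: le_trans (lpsi _ _) _.
have -> : a + \sum_i t 0 i * (b 0 i - a) - (a' + \sum_i t 0 i * (b' 0 i - a')) =
  (1 - \sum_i t 0 i) * (a - a') + \sum_i t 0 i * (b 0 i - b' 0 i).
  have -> : \sum_i t 0 i * (b 0 i - b' 0 i) = \sum_i t 0 i * (b 0 i - a) -
      \sum_i t 0 i * (b' 0 i - a') + (\sum_i t 0 i) * (a - a').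
    rewrite mulr_suml -sumrB -big_split; apply: eq_bigr => i _ /=; ring.
  ring.
apply: le_trans (ler_normD _ _) _.
have -> : d = (1 - \sum_i t 0 i) * d + \sum_i t 0 i * d by rewrite -mulr_suml -mulrDl subrK mul1r.
rewrite lerD// ?normrM.
  by rewrite ger0_norm ?subr_ge0// ler_wpM2l// subr_ge0.
apply: le_trans (ler_norm_sum _ _ _) _; apply: ler_sum => i _.
by rewrite normrM ger0_norm// ler_wpM2l.
Qed.

Lemma ridge_integral_lipschitz k psi (d : R) (a a' : R) (b b' : 'rV[R]_k) :
  continuous psi ->
  (forall x y : R, `|psi x - psi y| <= `|x - y|) ->
  `|a - a'| <= d -> (forall i, `|b 0 i - b' 0 i| <= d) ->
  `|ridge_integral psi a b - ridge_integral psi a' b'| <= d * vol (@ref_simplex R k).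
Proof.
move=> cpsi lpsi ad bd.
have m := @vmeas_ref_simplex R k; have e := @ebounded_ref_simplex R k.
have r1 := mbounded_ridge a b cpsi; have r2 := mbounded_ridge a' b' cpsi.
have -> : ridge_integral psi a b - ridge_integral psi a' b' =
    vol_integral ref_simplex (fun t => ridge psi a b t + (-1) * ridge psi a' b' t).
  by rewrite vol_integralD// ?vol_integralZ// ?mulN1r//; exact: mboundedZ.
have mb : mbounded ref_simplex (fun t => ridge psi a b t + (-1) * ridge psi a' b' t).
  by apply: mboundedD => //; exact: mboundedZ.
rewrite ler_norml -mulNr; apply/andP; split.
  apply: vol_integral_ge => // t rt; rewrite mulN1r.
  by have := ridge_lipschitz lpsi rt ad bd; rewrite ler_norml => /andP[].
apply: vol_integral_le => // t rt; rewrite mulN1r.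
by have := ridge_lipschitz lpsi rt ad bd; rewrite ler_norml => /andP[].
Qed.

(** The kink of an immersed function: on a cut cell such a function is affine plus a multiple of
    [pos_part (ch D T)] applied to [dot (nh D T)]. *)
Definition pos_part (c x : R) : R := Num.max (x - c) 0.

Lemma pos_part_lipschitz c x y : `|pos_part c x - pos_part c y| <= `|x - y|.
Proof.
rewrite /pos_part; have [h1|h1] := leP (x - c) 0; have [h2|h2] := leP (y - c) 0;
  rewrite ler_norml; have [h3|h3] := leP 0 (x - y); rewrite ?(ger0_norm h3) ?(ltr0_norm h3); lra.
Qed.

Lemma continuous_pos_part c : continuous (pos_part c).
Proof.
move=> x; apply/cvgrPdist_le => e e0; near=> y.
rewrite (le_trans (pos_part_lipschitz _ _ _))//.
Unshelve. all: by end_near. Qed.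

Lemma is_derive_pos_part2 c (x : R) :
  is_derive x 1 (fun y => pos_part c y ^+ 2 / 2) (pos_part c x).
Proof.
have H : (fun h : R => h^-1 *: (((fun y => pos_part c y ^+ 2 / 2) \o shift x) (h *: 1) -
     pos_part c x ^+ 2 / 2)) @ 0^' --> pos_part c x.
  apply/cvgrPdist_le => e e0; near=> h.
  have h0 : h != 0 by near: h; exact: nbhs_dnbhs_neq.
  have he : `|h| <= e.
    near: h; apply: nbhs_dnbhs; exists e => //= y /=.
    by rewrite sub0r normrN => /ltW.
  apply: le_trans he; rewrite /= /GRing.scale/= mulr1.
  rewrite -(@ler_pM2l _ `|h|) ?normr_gt0// -normrM mulrBr mulrA divff// mul1r.
  rewrite -normrM -expr2 (ger0_norm (sqr_ge0 h)) /pos_part.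
  have [h1|h1] := leP (x - c) 0; have [h2|h2] := leP (h + x - c) 0;
    rewrite ler_norml; nra.
apply: DeriveDef; first by apply/cvg_ex; eexists; exact: H.
exact: cvg_lim H.
Unshelve. all: by end_near. Qed.

Lemma is_derive_pos_part3 c (x : R) :
  is_derive x 1 (fun y => pos_part c y ^+ 3 / 6) (pos_part c x ^+ 2 / 2).
Proof.
(* The cube is the square, whose derivative is known, times an affine factor; where that factor
   differs from the positive part, the square is zero. *)
have -> : (fun y => pos_part c y ^+ 3 / 6) =
    (fun y => (pos_part c y ^+ 2 / 2) * ((y - c) / 3)).
  apply/funext => y; rewrite /pos_part; case: leP => h; last by field.
  by rewrite !expr0n !mul0r.
have d1 := is_derive_pos_part2 c x.
have d2 : is_derive x 1 (fun y : R => (y - c) / 3) (1 / 3).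
  rewrite (_ : (fun y => _) = 3^-1 \*: (fun y : R => y - c)).
    by apply: is_derive_eq; rewrite oppr0 addr0 /GRing.scale/= mulrC.
  by apply/funext => y; rewrite /= /GRing.scale/= mulrC.
suff -> : pos_part c x ^+ 2 / 2 = (pos_part c x ^+ 2 / 2) *: (1 / 3 : R^o) +
    ((x - c) / 3) *: (pos_part c x : R^o) by exact: is_deriveM d1 d2.
rewrite /GRing.scale/= /pos_part; case: leP => h; last by field.
by rewrite !expr0n !mul0r mulr0 addr0.
Qed.

(** Volumes and first moments are read off from the divided difference formulas with [psi] constant
    or the identity and vertex values chosen distinct. *)
Lemma vol_ref_simplex1 : vol (@ref_simplex R 1) = 1.
Proof.
have H := @ridge_integral1 (cst 1) id 0 (const_mx 1) (@cst_continuous R R 1)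
  (fun x => is_derive_id x (1 : R)).
move: H; rewrite mxE !subr0 mul1r => <-.
rewrite -[LHS]mul1r -vol_integral_cst//; exact: vmeas_ref_simplex.
Qed.

Lemma vol_ref_simplex2 : vol (@ref_simplex R 2) = 2^-1.
Proof.
have dsq (x : R) : is_derive x 1 (fun y : R => y ^+ 2 / 2) x.
  rewrite (_ : (fun y => _) = 2^-1 \*: (fun y : R => y ^+ 2)).
    by apply: is_derive_eq; rewrite /GRing.scale/=; field.
  by apply/funext => y; rewrite /= /GRing.scale/= mulrC.
pose b : 'rV[R]_2 := \row_i (i.+1)%:R.
have := @ridge_integral2 (cst 1) id _ 0 b (@cst_continuous R R 1)
  (fun x => is_derive_id x (1 : R)) dsq.
rewrite /b !mxE/= !pnatr_eq0 eqr_nat => /(_ isT isT isT) H.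
rewrite -[LHS]mul1r -vol_integral_cst//; last exact: vmeas_ref_simplex.
by rewrite [LHS]H modn_small//; field.
Qed.

Lemma ridge_integral_id k (a : R) (b : 'rV[R]_k) : ridge_integral id a b =
  a * vol (@ref_simplex R k) +
  \sum_i (b 0 i - a) * vol_integral (@ref_simplex R k) (fun t => t 0 i).
Proof.
have m := @vmeas_ref_simplex R k; have e := @ebounded_ref_simplex R k.
have mc i : mbounded (@ref_simplex R k) (fun t => (b 0 i - a) * t 0 i).
  exact/mboundedZ/mbounded_coord.
rewrite -vol_integral_cst//; under eq_bigr => i _.
  rewrite -vol_integralZ//; [over|exact: mbounded_coord].
rewrite -vol_integral_sum// -vol_integralD//; last 2 first.
- exact: mbounded_cst.
- exact: mbounded_sum.
congr vol_integral; apply/funext => t; rewrite /ridge/=; congr (_ + _).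
by apply: eq_bigr => i _; rewrite mulrC.
Qed.

Lemma ref_mean_coord k (i : 'I_k) : k = 1%N \/ k = 2%N ->
  vol_integral (@ref_simplex R k) (fun t => t 0 i) =
  vol (@ref_simplex R k) / k.+1%:R.
Proof.
have dsq (x : R) : is_derive x 1 (fun y : R => y ^+ 2 / 2) x.
  rewrite (_ : (fun y => _) = 2^-1 \*: (fun y : R => y ^+ 2)).
    by apply: is_derive_eq; rewrite /GRing.scale/=; field.
  by apply/funext => y; rewrite /= /GRing.scale/= mulrC.
have dcu (x : R) : is_derive x 1 (fun y : R => y ^+ 3 / 6) (x ^+ 2 / 2).
  rewrite (_ : (fun y => _) = 6^-1 \*: (fun y : R => y ^+ 3)).
    by apply: is_derive_eq; rewrite /GRing.scale/=; field.
  by apply/funext => y; rewrite /= /GRing.scale/= mulrC.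
have cid : continuous (id : R -> R) by move=> x; exact: cvg_id.
case=> k1; subst k.
  have := @ridge_integral1 id _ 0 (const_mx 1) cid dsq.
  rewrite ridge_integral_id vol_ref_simplex1 big_ord1 mxE subr0 !mul1r mul0r add0r.
  by rewrite [i]ord1 => ->; field.
(* The vertex values [0, 1, 2] and [0, 2, 1] yield two independent linear equations for the two
   first moments. *)
pose b : 'rV[R]_2 := \row_j (j.+1)%:R.
pose b' : 'rV[R]_2 := \row_j (2 - j)%:R.
have := @ridge_integral2 id _ _ 0 b cid dsq dcu.
have := @ridge_integral2 id _ _ 0 b' cid dsq dcu.
rewrite !ridge_integral_id !big_ord_recl !big_ord0 !vol_ref_simplex2 /b /b' !mxE/=.
rewrite !pnatr_eq0 !eqr_nat !modn_small// !mul0r !add0r !addr0 !subr0.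
move=> /(_ isT isT isT) H1 /(_ isT isT isT) H2.
have bE : bump 0 0 = 1%N by [].
rewrite !bE !subn0 !subn1/= in H1 H2.
have -> : 2^-1 / 3 = 6^-1 :> R by field.
have {}H1 : 2 * vol_integral (@ref_simplex R 2) (fun t => t 0 ord0) +
  vol_integral (@ref_simplex R 2) (fun t => t 0 (lift ord0 ord0)) = 2^-1.
  by rewrite -[X in _ + X]mul1r [LHS]H1; field.
have {}H2 : vol_integral (@ref_simplex R 2) (fun t => t 0 ord0) +
  2 * vol_integral (@ref_simplex R 2) (fun t => t 0 (lift ord0 ord0)) = 2^-1.
  by rewrite -[X in X + _]mul1r [LHS]H2; field.
have [j ->|->] := unliftP ord0 i; first by rewrite [j]ord1; lra.
lra.
Qed.

End reference_means.

(** * Means of the positive part as functions of the vertex values *)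

Section ridge_means.
Context {R : realType} (c : R).
Local Notation psi := (pos_part c).

(** In the dimensions 1 and 2 used below and for distinct values, this is [k!] times the divided
    difference at [s] of the [k]-fold primitive of [pos_part c]. The integral form also makes sense,
    and is continuous, when values coincide. *)
Definition ridge_mean k (s : seq R) : R :=
  ridge_integral psi s`_0 (\row_(i < k) s`_i.+1) / vol (@ref_simplex R k).

Lemma vol_ref_simplex_gt0 k : k = 1%N \/ k = 2%N -> 0 < vol (@ref_simplex R k).
Proof. by case=> ->; rewrite ?vol_ref_simplex1 ?vol_ref_simplex2 ?invr_gt0. Qed.

Lemma ridge_mean_id k (a : R) (b : 'rV[R]_k) : k = 1%N \/ k = 2%N ->
  ridge_integral id a b / vol (@ref_simplex R k) = (a + \sum_i b 0 i) / k.+1%:R.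
Proof.
move=> hk; have v0 := vol_ref_simplex_gt0 hk.
rewrite ridge_integral_id; under eq_bigr do rewrite ref_mean_coord//.
rewrite -mulr_suml sumrB sumr_const card_ord -[a *+ k]mulr_natr.
have k0 : k.+1%:R != 0 :> R by rewrite pnatr_eq0.
have kE : k%:R = k.+1%:R - 1 :> R by rewrite -natr1 addrK.
move: (vol _) (gt_eqF v0) (\sum_i b 0 i) => v {}v0 S.
rewrite kE; move: (k.+1%:R) k0 => K K0.
by field; rewrite K0 v0.
Qed.

(** Both [pos_part c] and the difference of the identity and [pos_part c] are nondecreasing. The
    increment of the mean therefore lies between 0 and the increment of the mean of the affine
    function itself, which is the average of its vertex values. *)
Lemma ridge_monotone k (a a' : R) (b b' : 'rV[R]_k) : k = 1%N \/ k = 2%N ->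
  a <= a' -> (forall i, b 0 i <= b' 0 i) ->
  0 <= (ridge_integral psi a' b' - ridge_integral psi a b) / vol (@ref_simplex R k)
    <= ((a' - a) + \sum_i (b' 0 i - b 0 i)) / k.+1%:R.
Proof.
move=> hk aa' bb'; have v0 := vol_ref_simplex_gt0 hk.
have m := @vmeas_ref_simplex R k; have e := @ebounded_ref_simplex R k.
have cid : continuous (id : R -> R) by move=> x; exact: cvg_id.
have cpsi := @continuous_pos_part R c.
have arg t : ref_simplex t -> a + \sum_i t 0 i * (b 0 i - a) <=
     a' + \sum_i t 0 i * (b' 0 i - a').
  move=> [t0 t1]; rewrite -subr_ge0.
  have -> : a' + \sum_i t 0 i * (b' 0 i - a') - (a + \sum_i t 0 i * (b 0 i - a)) =
    (1 - \sum_i t 0 i) * (a' - a) + \sum_i t 0 i * (b' 0 i - b 0 i).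
    have -> : \sum_i t 0 i * (b' 0 i - b 0 i) = \sum_i t 0 i * (b' 0 i - a') -
       \sum_i t 0 i * (b 0 i - a) + (\sum_i t 0 i) * (a' - a).
      rewrite mulr_suml -sumrB -big_split; apply: eq_bigr => i _ /=; ring.
    ring.
  rewrite addr_ge0// ?mulr_ge0 ?subr_ge0//.
  by apply: sumr_ge0 => i _; rewrite mulr_ge0// subr_ge0.
apply/andP; split.
  rewrite divr_ge0// ?(ltW v0)// subr_ge0.
  apply: le_vol_integral => //; try exact: mbounded_ridge.
  move=> t /arg; rewrite /ridge /pos_part; move: (_ + _) (_ + _) => x y xy.
  by have [?|?] := leP (x - c) 0; have [?|?] := leP (y - c) 0; lra.
have -> : (a' - a + \sum_i (b' 0 i - b 0 i)) / k.+1%:R =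
    (ridge_integral id a' b' - ridge_integral id a b) / vol (@ref_simplex R k).
  by rewrite mulrBl !ridge_mean_id// sumrB -mulrBl; congr (_ / _); ring.
rewrite ler_wpM2r ?invr_ge0 ?(ltW v0)//.
suff : ridge_integral psi a' b' + ridge_integral id a b <=
    ridge_integral id a' b' + ridge_integral psi a b by lra.
rewrite -!vol_integralD//; try exact: mbounded_ridge.
apply: le_vol_integral => //; try by apply: mboundedD; exact: mbounded_ridge.
move=> t /arg; rewrite /ridge /pos_part/=; move: (_ + _) (_ + _) => x y xy.
by have [?|?] := leP (x - c) 0; have [?|?] := leP (y - c) 0; lra.
Qed.

Lemma lipschitz_continuous (f : R -> R) (L : R) :
  (forall x y, `|f x - f y| <= L * `|x - y|) -> continuous f.
Proof.
move=> fL x; apply/cvgrPdist_le => e e0; near=> y.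
apply: le_trans (fL x y) _; apply: (@le_trans _ _ ((`|L| + 1) * `|x - y|)).
  by rewrite ler_wpM2r// (le_trans (ler_norm _))// lerDl.
rewrite -ler_pdivlMl ?ltr_pwDr//.
near: y; apply: cvgr_dist_le => //.
by rewrite mulr_gt0// invr_gt0 ltr_pwDr.
Unshelve. all: by end_near. Qed.

Lemma ridge_path_continuous k (s p : seq R) :
  continuous (fun e : R => ridge_mean k (mkseq (fun i => s`_i + e * p`_i) k.+1)).
Proof.
pose L := \big[Num.max/0]_(i < k.+1) `|p`_i|.
apply: (@lipschitz_continuous _ (L * vol (@ref_simplex R k) * `|(vol (@ref_simplex R k))^-1|)) => x y.
rewrite -mulrBl normrM mulrAC ler_wpM2r//.
have H i : (i < k.+1)%N -> `|(mkseq (fun i => s`_i + x * p`_i) k.+1)`_i -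
    (mkseq (fun i => s`_i + y * p`_i) k.+1)`_i| <= L * `|x - y|.
  move=> ik; rewrite !nth_mkseq// opprD addrACA subrr add0r -mulrBl normrM mulrC.
  by rewrite ler_wpM2r// (le_bigmax _ (fun i : 'I_k.+1 => `|p`_i|) (Ordinal ik)).
rewrite mulrAC; apply: ridge_integral_lipschitz.
- exact: continuous_pos_part.
- exact: pos_part_lipschitz.
- exact: (H 0).
- by move=> i; rewrite !mxE; apply: H; rewrite ltnS.
Qed.

Lemma near_distinct (u k : R) : 0 < k -> \forall e \near 0^'+, u + e * k != 0.
Proof.
move=> k0; have [u0|u0] := leP 0 u.
  by near=> e; rewrite gt_eqF// ltr_wpDl// mulr_gt0.
have uk : 0 < - u / k by rewrite divr_gt0// oppr_gt0.
near=> e; rewrite lt_eqF//.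
have : e < - u / k by near: e; exact: nbhs_right_lt.
by rewrite ltr_pdivlMr//; lra.
Unshelve. all: by end_near. Qed.

Lemma eq0_right (f : R -> R) : continuous f -> (\forall e \near 0^'+, f e = 0) -> f 0 = 0.
Proof.
move=> cf f0; have H : f @ 0^'+ --> f 0 by apply: cvg_at_right_filter; exact: cf.
exact: (@closed_cvg _ _ _ _ f (fun x => x = 0) (@closed_eq R 0) f0 _ H).
Qed.

Lemma ridge_mean2 (x y : R) : x != y ->
  ridge_mean 1 [:: x; y] = (pos_part c y ^+ 2 / 2 - pos_part c x ^+ 2 / 2) / (y - x).
Proof.
move=> xy; have yx : y - x != 0 by rewrite subr_eq0 eq_sym.
have := ridge_integral1 x (\row_(i < 1) [:: x; y]`_i.+1)
  (@continuous_pos_part R c) (is_derive_pos_part2 c).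
rewrite mxE/= => <-.
by rewrite /ridge_mean vol_ref_simplex1 divr1/= mulrC mulKf.
Qed.

Lemma ridge_mean3 (x y z : R) : x != y -> x != z -> y != z ->
  ridge_mean 2 [:: x; y; z] =
  2 * (((pos_part c z ^+ 3 / 6 - pos_part c y ^+ 3 / 6) / (z - y) -
   (pos_part c z ^+ 3 / 6 - pos_part c x ^+ 3 / 6) / (z - x)) / (y - x)).
Proof.
move=> xy xz yz.
have := ridge_integral2 (a := x) (b := \row_(i < 2) [:: x; y; z]`_i.+1)
  (@continuous_pos_part R c) (is_derive_pos_part2 c) (is_derive_pos_part3 c).
rewrite !mxE/= => <-//; last 2 first.
- by rewrite eq_sym.
- by rewrite eq_sym.
by rewrite /ridge_mean vol_ref_simplex2 invrK mulrC.
Qed.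

Lemma ridge_mean_path k (s : seq R) (p : seq R) : size s = k.+1 ->
  ridge_mean k (mkseq (fun i => s`_i + 0 * p`_i) k.+1) = ridge_mean k s.
Proof.
by move=> sk; rewrite -sk -[in RHS](mkseq_nth 0 s); congr ridge_mean;
  apply: eq_mkseq => i; rewrite mul0r addr0.
Qed.

Lemma continuous_mulfun (f g : R -> R) :
  continuous f -> continuous g -> continuous (fun x => f x * g x).
Proof. by move=> cf cg x; apply: continuousM; [exact: cf|exact: cg]. Qed.

Lemma continuous_subfun (f g : R -> R) :
  continuous f -> continuous g -> continuous (fun x => f x - g x).
Proof. by move=> cf cg x; apply: (@continuousB R R^o); [exact: cf|exact: cg]. Qed.

Lemma cross_limit (f g h : R -> R) (u v p q : R) :
  continuous f -> continuous g -> continuous h ->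
  (\forall e \near 0^'+, (f e - g e) * (u + e * p) = (f e - h e) * (v + e * q)) ->
  (f 0 - g 0) * u = (f 0 - h 0) * v.
Proof.
move=> cf cg ch H.
have caff (w r : R) : continuous (fun e : R => w + e * r).
  apply: (@lipschitz_continuous _ `|r|) => x y.
  by rewrite -normrM (_ : w + x * r - (w + y * r) = r * (x - y))//; ring.
pose F e := (f e - g e) * (u + e * p) - (f e - h e) * (v + e * q).
have cF : continuous F := continuous_subfun
  (continuous_mulfun (continuous_subfun cf cg) (caff u p))
  (continuous_mulfun (continuous_subfun cf ch) (caff v q)).
have := eq0_right cF; rewrite /F !mul0r !addr0 => F0.
apply/eqP; rewrite -subr_eq0; apply/eqP/F0; near=> e.
by apply/eqP; rewrite subr_eq0; apply/eqP; near: e.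
Unshelve. all: by end_near. Qed.

Let path (s p : seq R) (e : R) : seq R := mkseq (fun i => s`_i + e * p`_i) (size s).

(** The mean without [x0] minus the mean without [xi] is [xi - x0] times a quantity symmetric in all
    the values, a divided difference of one order more. Eliminating it gives identities without
    denominators, which survive coincidences of values. *)
Lemma ridge_cross2 (x0 x1 x2 : R) (m := ridge_mean 1) :
  (m [:: x1; x2] - m [:: x0; x2]) * (x2 - x0) =
  (m [:: x1; x2] - m [:: x0; x1]) * (x1 - x0).
Proof.
pose M s p e := ridge_mean 1 (path s p e).
have cM s p : size s = 2%N -> continuous (M s p).
  by rewrite /M /path => ->; exact: ridge_path_continuous.
pose M0 := M [:: x1; x2] [:: 1; 2]; pose M1 := M [:: x0; x2] [:: 0; 2].
pose M2 := M [:: x0; x1] [:: 0; 1].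
have c0 : continuous M0 by exact: cM.
have c1 : continuous M1 by exact: cM.
have c2 : continuous M2 by exact: cM.
have Z0 : M0 0 = m [:: x1; x2] by exact: ridge_mean_path.
have Z1 : M1 0 = m [:: x0; x2] by exact: ridge_mean_path.
have Z2 : M2 0 = m [:: x0; x1] by exact: ridge_mean_path.
(* The speeds 0, 1, 2 are distinct and increasing, so every difference of values grows at a positive
   rate and is nonzero for small [e > 0]. *)
rewrite -Z0 -Z1 -Z2; apply: (cross_limit (p := 2) (q := 1)) => //; near=> e.
have d1 : x1 - x0 + e * 1 != 0 by near: e; exact: near_distinct.
have d2 : x2 - x0 + e * 2 != 0 by near: e; exact: near_distinct.
have d3 : x2 - x1 + e * 1 != 0 by near: e; exact: near_distinct.
rewrite /M0 /M1 /M2 /M /path /mkseq /= !mulr0 !addr0.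
rewrite (_ : x1 - x0 + e * 1 = x1 + e * 1 - x0) in d1 *; last by ring.
rewrite (_ : x2 - x0 + e * 2 = x2 + e * 2 - x0) in d2 *; last by ring.
rewrite (_ : x2 - x1 + e * 1 = x2 + e * 2 - (x1 + e * 1)) in d3; last by ring.
move: (x1 + e * 1) (x2 + e * 2) d1 d2 d3 => y1 y2 d1 d2 d3.
rewrite !ridge_mean2; try by rewrite eq_sym -subr_eq0.
move: (pos_part c) => P; field; rewrite d1 d2 d3//.
Unshelve. all: by end_near. Qed.

Lemma ridge_cross3 (x0 x1 x2 x3 : R) (m := ridge_mean 2) :
  [/\ (m [:: x1; x2; x3] - m [:: x0; x2; x3]) * (x2 - x0) =
      (m [:: x1; x2; x3] - m [:: x0; x1; x3]) * (x1 - x0),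
      (m [:: x1; x2; x3] - m [:: x0; x2; x3]) * (x3 - x0) =
      (m [:: x1; x2; x3] - m [:: x0; x1; x2]) * (x1 - x0) &
      (m [:: x1; x2; x3] - m [:: x0; x1; x3]) * (x3 - x0) =
      (m [:: x1; x2; x3] - m [:: x0; x1; x2]) * (x2 - x0)].
Proof.
pose M s p e := ridge_mean 2 (path s p e).
have cM s p : size s = 3%N -> continuous (M s p).
  by rewrite /M /path => ->; exact: ridge_path_continuous.
pose M0 := M [:: x1; x2; x3] [:: 1; 2; 3]; pose M1 := M [:: x0; x2; x3] [:: 0; 2; 3].
pose M2 := M [:: x0; x1; x3] [:: 0; 1; 3]; pose M3 := M [:: x0; x1; x2] [:: 0; 1; 2].
have c0 : continuous M0 by exact: cM.
have c1 : continuous M1 by exact: cM.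
have c2 : continuous M2 by exact: cM.
have c3 : continuous M3 by exact: cM.
have E : \forall e \near 0^'+,
  [/\ (M0 e - M1 e) * (x2 - x0 + e * 2) = (M0 e - M2 e) * (x1 - x0 + e * 1),
      (M0 e - M1 e) * (x3 - x0 + e * 3) = (M0 e - M3 e) * (x1 - x0 + e * 1) &
      (M0 e - M2 e) * (x3 - x0 + e * 3) = (M0 e - M3 e) * (x2 - x0 + e * 2)].
  near=> e.
  have d1 : x1 - x0 + e * 1 != 0 by near: e; exact: near_distinct.
  have d2 : x2 - x0 + e * 2 != 0 by near: e; exact: near_distinct.
  have d3 : x3 - x0 + e * 3 != 0 by near: e; exact: near_distinct.
  have d12 : x2 - x1 + e * 1 != 0 by near: e; exact: near_distinct.
  have d13 : x3 - x1 + e * 2 != 0 by near: e; exact: near_distinct.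
  have d23 : x3 - x2 + e * 1 != 0 by near: e; exact: near_distinct.
  rewrite /M0 /M1 /M2 /M3 /M /path /mkseq /= !mulr0 !addr0.
  rewrite (_ : x1 - x0 + e * 1 = x1 + e * 1 - x0) in d1 *; last by ring.
  rewrite (_ : x2 - x0 + e * 2 = x2 + e * 2 - x0) in d2 *; last by ring.
  rewrite (_ : x3 - x0 + e * 3 = x3 + e * 3 - x0) in d3 *; last by ring.
  rewrite (_ : x2 - x1 + e * 1 = x2 + e * 2 - (x1 + e * 1)) in d12; last by ring.
  rewrite (_ : x3 - x1 + e * 2 = x3 + e * 3 - (x1 + e * 1)) in d13; last by ring.
  rewrite (_ : x3 - x2 + e * 1 = x3 + e * 3 - (x2 + e * 2)) in d23; last by ring.
  move: (x1 + e * 1) (x2 + e * 2) (x3 + e * 3) d1 d2 d3 d12 d13 d23.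
  move=> y1 y2 y3 d1 d2 d3 d12 d13 d23.
  rewrite !ridge_mean3; try by rewrite eq_sym -subr_eq0.
  move: (pos_part c y1 ^+ 3) (pos_part c y2 ^+ 3) (pos_part c y3 ^+ 3) (pos_part c x0 ^+ 3).
  by move=> P1 P2 P3 P0; split; field; rewrite d1 d2 d3 d12 d13 d23.
have Z0 : M0 0 = m [:: x1; x2; x3] by exact: ridge_mean_path.
have Z1 : M1 0 = m [:: x0; x2; x3] by exact: ridge_mean_path.
have Z2 : M2 0 = m [:: x0; x1; x3] by exact: ridge_mean_path.
have Z3 : M3 0 = m [:: x0; x1; x2] by exact: ridge_mean_path.
rewrite -Z0 -Z1 -Z2 -Z3; split.
- by apply: (cross_limit (p := 2) (q := 1)) => //; apply: filterS E => e [].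
- by apply: (cross_limit (p := 3) (q := 1)) => //; apply: filterS E => e [].
- by apply: (cross_limit (p := 3) (q := 2)) => //; apply: filterS E => e [].
Unshelve. all: by end_near. Qed.

Lemma slope_bounds (u v K : R) : 0 < K ->
  (0 <= v -> 0 <= u <= v / K) -> (v <= 0 -> 0 <= - u <= (- v) / K) ->
  v != 0 -> 0 <= u / v <= K^-1.
Proof.
move=> K0 Hp Hn; case: (ltgtP v 0) => // v0 _.
  have /andP[h1 h2] := Hn (ltW v0).
  have Nv0 : 0 < - v by rewrite oppr_gt0.
  by rewrite -[u / v]divrNN divr_ge0 ?(ltW Nv0)//= ler_pdivrMr// mulrC.
have /andP[h1 h2] := Hp (ltW v0).
by rewrite divr_ge0 ?(ltW v0)//= ler_pdivrMr// mulrC.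
Qed.

(** The common slope [g] is, up to normalization, the mean of the derivative of
    [pos_part c] over the simplex of dimension [k.+1]. *)
Lemma ridge_slope2 (x0 x1 x2 : R) (m := ridge_mean 1) :
  exists g, [/\ 0 <= g <= 2^-1,
    m [:: x1; x2] - m [:: x0; x2] = (x1 - x0) * g &
    m [:: x1; x2] - m [:: x0; x1] = (x2 - x0) * g].
Proof.
have mono a b a' b' : a <= a' -> b <= b' ->
    0 <= m [:: a'; b'] - m [:: a; b] <= ((a' - a) + (b' - b)) / 2.
  move=> aa bb; rewrite /m /ridge_mean -mulrBl.
  have := @ridge_monotone 1 a a' (\row_(i < 1) [:: a; b]`_i.+1)
    (\row_(i < 1) [:: a'; b']`_i.+1) (or_introl erefl) aa.
  rewrite big_ord1 !mxE/=; apply => i; by rewrite !mxE ord1.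
have cross := ridge_cross2 x0 x1 x2; rewrite -/m in cross.
(* The slope is a quotient over the first nonzero difference, and the cross identity transfers it to
   the other difference. If all differences vanish, so do the increments, and the slope 0 serves. *)
have [x10|x10] := eqVneq (x1 - x0) 0; last first.
  exists ((m [:: x1; x2] - m [:: x0; x2]) / (x1 - x0)); split.
  - apply: slope_bounds => // v0.
    + have L : x0 <= x1 by rewrite -subr_ge0.
      by have := @mono x0 x2 x1 x2 L (lexx _); rewrite !subrr ?add0r ?addr0.
    + have L : x1 <= x0 by rewrite -subr_le0.
      by have := @mono x1 x2 x0 x2 L (lexx _); rewrite !subrr ?add0r ?addr0 !opprB.
  - by rewrite mulrC divfK.
  - by apply: (mulIf x10); rewrite -cross -mulrA divfK// mulrC.
have {}x10 : x1 = x0 by apply/subr0_eq.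
subst x1.
have [x20|x20] := eqVneq (x2 - x0) 0.
  have {}x20 : x2 = x0 by apply/subr0_eq.
  by subst x2; exists 0; rewrite lexx invr_ge0 ler0n !subrr !mul0r; split.
exists ((m [:: x0; x2] - m [:: x0; x0]) / (x2 - x0)); split; try by rewrite !subrr mul0r.
- apply: slope_bounds => // v0.
  + have L : x0 <= x2 by rewrite -subr_ge0.
    by have := @mono x0 x0 x0 x2 (lexx _) L; rewrite !subrr ?add0r ?addr0.
  + have L : x2 <= x0 by rewrite -subr_le0.
    by have := @mono x0 x2 x0 x0 (lexx _) L; rewrite !subrr ?add0r ?addr0 !opprB.
- by rewrite mulrC divfK.
Qed.

Lemma ridge_slope3 (x0 x1 x2 x3 : R) (m := ridge_mean 2) :
  exists g, [/\ 0 <= g <= 3^-1,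
    m [:: x1; x2; x3] - m [:: x0; x2; x3] = (x1 - x0) * g,
    m [:: x1; x2; x3] - m [:: x0; x1; x3] = (x2 - x0) * g &
    m [:: x1; x2; x3] - m [:: x0; x1; x2] = (x3 - x0) * g].
Proof.
have mono (a b d a' b' d' : R) : a <= a' -> b <= b' -> d <= d' ->
    0 <= m [:: a'; b'; d'] - m [:: a; b; d] <= ((a' - a) + ((b' - b) + (d' - d))) / 3.
  move=> aa bb dd; rewrite /m /ridge_mean -mulrBl.
  have := @ridge_monotone 2 a a' (\row_(i < 2) [:: a; b; d]`_i.+1)
    (\row_(i < 2) [:: a'; b'; d']`_i.+1) (or_intror erefl) aa.
  rewrite !big_ord_recl big_ord0 !mxE/= addr0; apply => i; rewrite !mxE.
  by have [j ->|->] := unliftP ord0 i; rewrite ?[j]ord1.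
have [cross1 cross2 cross3] := ridge_cross3 x0 x1 x2 x3; rewrite -/m in cross1 cross2 cross3.
have [x10|x10] := eqVneq (x1 - x0) 0; last first.
  exists ((m [:: x1; x2; x3] - m [:: x0; x2; x3]) / (x1 - x0)); split.
  - apply: slope_bounds => // v0.
    + have L : x0 <= x1 by rewrite -subr_ge0.
      by have := @mono x0 x2 x3 x1 x2 x3 L (lexx _) (lexx _); rewrite !subrr ?add0r ?addr0.
    + have L : x1 <= x0 by rewrite -subr_le0.
      by have := @mono x1 x2 x3 x0 x2 x3 L (lexx _) (lexx _); rewrite !subrr ?add0r ?addr0 !opprB.
  - by rewrite mulrC divfK.
  - by apply: (mulIf x10); rewrite -cross1 -mulrA divfK// mulrC.
  - by apply: (mulIf x10); rewrite -cross2 -mulrA divfK// mulrC.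
have {}x10 : x1 = x0 by apply/subr0_eq.
subst x1.
have [x20|x20] := eqVneq (x2 - x0) 0; last first.
  exists ((m [:: x0; x2; x3] - m [:: x0; x0; x3]) / (x2 - x0)); split; try by rewrite !subrr mul0r.
  - apply: slope_bounds => // v0.
    + have L : x0 <= x2 by rewrite -subr_ge0.
      by have := @mono x0 x0 x3 x0 x2 x3 (lexx _) L (lexx _); rewrite !subrr ?add0r ?addr0.
    + have L : x2 <= x0 by rewrite -subr_le0.
      by have := @mono x0 x2 x3 x0 x0 x3 (lexx _) L (lexx _); rewrite !subrr ?add0r ?addr0 !opprB.
  - by rewrite mulrC divfK.
  - by apply: (mulIf x20); rewrite -cross3 -mulrA divfK// mulrC.
have {}x20 : x2 = x0 by apply/subr0_eq.
subst x2.
have [x30|x30] := eqVneq (x3 - x0) 0.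
  have {}x30 : x3 = x0 by apply/subr0_eq.
  by subst x3; exists 0; rewrite lexx invr_ge0 ler0n !subrr !mul0r; split.
exists ((m [:: x0; x0; x3] - m [:: x0; x0; x0]) / (x3 - x0)); split; try by rewrite !subrr mul0r.
- apply: slope_bounds => // v0.
  + have L : x0 <= x3 by rewrite -subr_ge0.
    by have := @mono x0 x0 x0 x0 x0 x3 (lexx _) (lexx _) L; rewrite !subrr ?add0r ?addr0.
  + have L : x3 <= x0 by rewrite -subr_le0.
    by have := @mono x0 x0 x3 x0 x0 x0 (lexx _) (lexx _) L; rewrite !subrr ?add0r ?addr0 !opprB.
- by rewrite mulrC divfK.
Qed.

End ridge_means.

(** * Simplices and triangulations *)

Section simplex_geometry.
Context {R : realType} {N : nat} (M : mesh R N).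
Local Notation simplex := {set 'I_(nv M)}.
Implicit Types (S T F : simplex) (x y : 'rV[R]_N).

Definition full_simplex T := #|T| = N.+1 /\ affinely_independent T.

(** Barycentric coordinates are indexed by all vertices of the mesh and vanish outside [T], so
    coordinates for different cells can be compared and summed over one index type. *)
Definition bary_spec T (L : 'I_(nv M) -> affine (R := R) (N := N)) : Prop :=
  [/\ forall i, i \notin T -> L i = (0, 0),
      forall x, \sum_i aff (L i) x = 1 &
      forall x, \sum_i aff (L i) x *: vtx i = x].

Definition bary T : 'I_(nv M) -> affine (R := R) (N := N) :=
  xget (fun _ => (0, 0)) [set L | bary_spec T L].

Definition bc T i x : R := aff (bary T i) x.

Lemma bary_exists T : full_simplex T -> exists L, bary_spec T L.
Proof.
move=> [cT iT].
pose v (k : 'I_#|T|) := enum_val k.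
pose X : 'M[R]_(#|T|, N) := \matrix_k vtx (v k).
(* The rows are the vertices in homogeneous coordinates. Affine independence makes them free, and
   there are [N + 1] of them; a left inverse [B] then maps [(x, 1)] to the coordinates of [x]. *)
pose V : 'M[R]_(#|T|, N + 1) := row_mx X (const_mx 1).
have wX (w : 'rV[R]_#|T|) : w *m X = \sum_k w 0 k *: vtx (v k).
  by rewrite mulmx_sum_row; apply: eq_bigr => k _; rewrite rowK.
have w1 (w : 'rV[R]_#|T|) : (w *m (const_mx 1 : 'cV_#|T|)) 0 0 = \sum_k w 0 k.
  by rewrite mxE; apply: eq_bigr => k _; rewrite mxE mulr1.
have [B BV] : exists B : 'M[R]_(N + 1, #|T|), B *m V = 1%:M.
  apply/row_fullP; rewrite /row_full.
  suff /eqP -> : row_free V by rewrite cT addn1.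
  apply/row_freeP/row_freeP; rewrite -kermx_eq0; apply/eqP/row_matrixP => r.
  rewrite row0; set w := row r _.
  have wV0 : w *m V = 0 by rewrite -row_mul mulmx_ker row0.
  move: wV0; rewrite mul_mx_row -[X in _ = X]hsubmxK => /eq_row_mx[].
  rewrite !linear0 wX => w0 /matrixP/(_ 0 0); rewrite w1 mxE => ws.
  pose u i := \sum_(k | v k == i) w 0 k.
  have uT i : i \notin T -> u i = 0.
    by move=> iT'; rewrite /u big1// => k /eqP ki; move: iT'; rewrite -ki enum_valP.
  have uv k : u (v k) = w 0 k.
    by rewrite /u (big_pred1 k)// => l; rewrite /= (inj_eq enum_val_inj).
  apply/rowP => k; rewrite -uv [RHS]mxE; apply: (iT _ uT).
    rewrite (bigID [in T])/= [X in _ + X]big1 ?addr0//.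
    by rewrite big_enum_val -[RHS]ws; apply: eq_bigr => l _; exact: uv.
  rewrite (bigID [in T])/= [X in _ + X]big1 ?addr0 => [|i /uT ->]; last by rewrite scale0r.
  by rewrite big_enum_val -[RHS]w0; apply: eq_bigr => l _; rewrite -/(v l) uv.
pose l x := row_mx x (const_mx 1 : 'rV_1) *m B.
have lV x : l x *m V = row_mx x (const_mx 1) by rewrite -mulmxA BV mulmx1.
have lX x : \sum_k l x 0 k *: vtx (v k) = x.
  by have := lV x; rewrite mul_mx_row => /eq_row_mx[+ _]; rewrite wX.
have l1 x : \sum_k l x 0 k = 1.
  have := lV x; rewrite mul_mx_row => /eq_row_mx[_ /matrixP/(_ 0 0)].
  by rewrite w1 mxE.
pose a k : affine := ((col k (usubmx B))^T, dsubmx B 0 k).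
have aE k x : aff (a k) x = l x 0 k.
  rewrite /aff /l -[in RHS](vsubmxK B) mul_row_col [RHS]mxE; congr (_ + _).
    by rewrite mxE dotC; apply: eq_bigr => j _; rewrite !mxE.
  by rewrite mxE big_ord1 mxE mul1r.
pose L i := if [pick k | v k == i] is Some k then a k else (0, 0).
have Lv k : L (v k) = a k.
  rewrite /L; case: pickP => [j /eqP/enum_val_inj -> //|/(_ k)].
  by rewrite eqxx.
have LT i : i \notin T -> L i = (0, 0).
  by move=> iT'; rewrite /L; case: pickP => // k /eqP ki; move: iT'; rewrite -ki enum_valP.
have aff0 x : aff (0, 0) x = 0 by rewrite /aff dot0l addr0.
exists L; split => // x; rewrite (bigID [in T])/=.
  rewrite [X in _ + X]big1 ?addr0 => [|i /LT ->]; last exact: aff0.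
  rewrite big_enum_val -[RHS](l1 x); apply: eq_bigr => k _.
  by rewrite -/(v k) Lv aE.
rewrite [X in _ + X]big1 ?addr0 => [|i /LT ->]; last by rewrite aff0 scale0r.
rewrite big_enum_val -[RHS](lX x); apply: eq_bigr => k _.
by rewrite -/(v k) Lv aE.
Qed.

Lemma baryP T : full_simplex T -> bary_spec T (bary T).
Proof. by move=> /bary_exists[L LT]; apply: (@xgetPex _ _ [set L | bary_spec T L]); exists L. Qed.

Lemma aff_comb (p : affine) (w : 'I_(nv M) -> R) (z : 'I_(nv M) -> 'rV[R]_N) :
  \sum_i w i = 1 -> aff p (\sum_i w i *: z i) = \sum_i w i * aff p (z i).
Proof.
move=> w1; rewrite /aff dot_sumr -[X in _ + X = _]mulr1 -w1 mulr_sumr -big_split.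
by apply: eq_bigr => i _ /=; rewrite dotZr mulrDr [p.2 * _]mulrC.
Qed.

Lemma aff_seg (p : affine) x y s :
  aff p (x + s *: (y - x)) = aff p x + s * (aff p y - aff p x).
Proof. by rewrite /aff dotDr dotZr dotBr; ring. Qed.

Lemma affB (p : affine (R := R) (N := N)) x y : aff p x - aff p y = dot p.1 (x - y).
Proof. by rewrite /aff dotBr opprD addrACA subrr addr0. Qed.

Lemma aff_continuous (p : affine (R := R) (N := N)) : continuous (aff p).
Proof. by move=> x; apply: (@continuousD R R^o); [exact: dot_continuous|exact: cst_continuous]. Qed.

Section cell.
Variables (T : simplex) (nT : full_simplex T).

Lemma bc_out i x : i \notin T -> bc T i x = 0.
Proof. by have [+ _ _] := baryP nT => /(_ i)/[apply]; rewrite /bc => ->; rewrite /aff dot0l addr0. Qed.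

Lemma bc_sum x : \sum_i bc T i x = 1.
Proof. by have [_ + _] := baryP nT; apply. Qed.

Lemma bc_comb x : \sum_i bc T i x *: vtx i = x.
Proof. by have [_ _ +] := baryP nT; apply. Qed.

Lemma bc_uniq (w : 'I_(nv M) -> R) x : (forall i, i \notin T -> w i = 0) ->
  \sum_i w i = 1 -> x = \sum_i w i *: vtx i -> forall i, bc T i x = w i.
Proof.
move=> w0 w1 xw i; apply/eqP; rewrite -subr_eq0; apply/eqP.
case: nT => _ /(_ (fun i => bc T i x - w i)); apply.
- by move=> j jT; rewrite w0// bc_out// subr0.
- by rewrite sumrB bc_sum w1 subrr.
- under eq_bigr do rewrite scalerBl.
  by rewrite sumrB bc_comb -xw subrr.
Qed.

Lemma aff_bary (p : affine) x : aff p x = \sum_i bc T i x * aff p (vtx i).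
Proof. by rewrite -aff_comb ?bc_comb ?bc_sum. Qed.

Lemma osimplexE S x : S \subset T -> osimplex S x <->
  (forall i, i \in S -> 0 < bc T i x) /\ (forall i, i \notin S -> bc T i x = 0).
Proof.
move=> /fintype.subsetP ST; split=> [[w [w1 w2 w3 w4]]|[b1 b2]].
  have bw := @bc_uniq w x _ w3 w4; split => i iS; rewrite bw ?w1 ?w2//;
    by move=> j jT; apply: w2; apply: contra jT; exact: ST.
by exists (fun i => bc T i x); split=> //; rewrite ?bc_sum// bc_comb.
Qed.

Lemma csimplexE S x : S \subset T -> csimplex S x <->
  (forall i, i \in S -> 0 <= bc T i x) /\ (forall i, i \notin S -> bc T i x = 0).
Proof.
move=> /fintype.subsetP ST; split=> [[w [w1 w2 w3 w4]]|[b1 b2]].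
  have bw := @bc_uniq w x _ w3 w4; split => i iS; rewrite bw ?w1 ?w2//;
    by move=> j jT; apply: w2; apply: contra jT; exact: ST.
by exists (fun i => bc T i x); split=> //; rewrite ?bc_sum// bc_comb.
Qed.

Lemma bc_vtx i j : i \in T -> bc T j (vtx i) = (j == i)%:R.
Proof.
move=> iT; apply: (@bc_uniq (fun j => (j == i)%:R)).
- by move=> k kT; case: eqP kT => // ->; rewrite iT.
- by rewrite (bigD1 i)//= eqxx big1 ?addr0// => k /negPf ->.
- by rewrite (bigD1 i)//= eqxx scale1r big1 ?addr0// => k /negPf ->; rewrite scale0r.
Qed.

Lemma vtx_csimplex i : i \in T -> csimplex T (vtx i).
Proof.
move=> iT; apply/csimplexE => //; split => j jT; first by rewrite bc_vtx.
exact: bc_out.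
Qed.

Lemma bc_continuous i : continuous (bc T i).
Proof. exact: aff_continuous. Qed.

Lemma csimplex_bigcap : csimplex T =
  \bigcap_(i in [set` T]) [set x | 0 <= bc T i x].
Proof.
apply/seteqP; split => x.
  by move=> /csimplexE-/(_ (subxx _))[b1 _] i iT; exact: b1.
move=> H; apply/csimplexE => //; split => i iT; first exact: H.
exact: bc_out.
Qed.

Lemma osimplex_open : open (osimplex T).
Proof.
rewrite openE => x /osimplexE-/(_ (subxx _))[b1 b2].
suff H : \forall y \near x, forall i, i \in T -> 0 < bc T i y.
  apply: filterS H => y yT; apply/osimplexE => //.
  by split => i iT; [exact: yT|exact: bc_out].
apply: (@filter_forall _ _ (fun i => [set y | i \in T -> 0 < bc T i y]) (nbhs x)
  (nbhs_filter x)) => i.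
have [iT|iT] := boolP (i \in T); last exact: nearW.
have /(_ (nbhs_filter x)) := cvgr_gt (bc T i x) (@bc_continuous i x) 0 (b1 i iT).
by apply: (@filterS _ _ (nbhs_filter x)) => y yb _.
Qed.

Lemma csimplex_closed : closed (csimplex T).
Proof.
rewrite csimplex_bigcap; apply: closed_bigI => i _.
by apply: (@preimage_closed _ _ (bc T i) [set x | 0 <= x]) => [x _|];
  [exact: bc_continuous|exact: closed_ge].
Qed.

Lemma osimplex_seg S x y s : S \subset T -> osimplex S x -> csimplex S y ->
  0 <= s < 1 -> osimplex S (x + s *: (y - x)).
Proof.
move=> ST /osimplexE-/(_ ST)[x1 x2] /csimplexE-/(_ ST)[y1 y2] /andP[s0 s1].
apply/osimplexE => //; split => i iS; rewrite /bc aff_seg -!/(bc _ _ _).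
  have := x1 i iS; have := y1 i iS; nra.
by rewrite x2// y2// subrr mulr0 addr0.
Qed.

End cell.

Lemma osimplex_csimplex S : osimplex S `<=` @csimplex R N M S.
Proof. by move=> x [w [w1 w2 w3 w4]]; exists w; split => // i /w1/ltW. Qed.

Lemma osimplex_nonempty S : (0 < #|S|)%N -> @osimplex R N M S !=set0.
Proof.
move=> S0.
exists (\sum_i (if i \in S then (#|S|)%:R^-1 else 0) *: vtx i).
exists (fun i => if i \in S then (#|S|)%:R^-1 else 0); split => //.
- by move=> i ->; rewrite invr_gt0 ltr0n.
- by move=> i /negPf ->.
- by rewrite -big_mkcond sumr_const -[_ *+ _]mulr_natr mulVf// pnatr_eq0 -lt0n.
Qed.

Lemma csimplex_bounded S : ebounded (@csimplex R N M S).
Proof.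
exists (\sum_i enorm (@vtx R N M i)) => x [w [w1 w2 w3 ->]].
apply: (le_trans (enorm_sum _ _ _)); apply: ler_sum => i _.
rewrite enormZ ler_piMl ?enorm_ge0//.
have w0 j : 0 <= w j by have [/w1//|/w2 ->] := boolP (j \in S).
by rewrite ger0_norm// -w3 (bigD1 i)//= lerDl sumr_ge0.
Qed.

End simplex_geometry.

(** * Diameter, inscribed ball and volume of a cell *)

Section simplex_size.
Context {R : realType} {N : nat} (M : mesh R N).
Local Notation simplex := {set 'I_(nv M)}.
Variables (T : simplex) (nT : full_simplex T) (N0 : (0 < N)%N).
Implicit Types (x y : 'rV[R]_N).

Lemma card_cell_gt0 : (0 < #|T|)%N.
Proof. by case: nT => ->. Qed.

Lemma osimplex_dist x y : osimplex T x -> osimplex T y -> enorm (x - y) <= hT T.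
Proof.
move=> xT yT; apply: ub_le_sup; last by exists x => //; exists y.
have [B BT] := csimplex_bounded T; exists (B + B) => _ [u uT [v vT <-]].
by rewrite (le_trans (enormD _ _))// enormN lerD// BT//; exact: osimplex_csimplex.
Qed.

Lemma hT_ge0 : 0 <= hT T.
Proof.
have [b bT] := osimplex_nonempty card_cell_gt0.
by rewrite -(@enorm0 R N) -(subrr b) osimplex_dist.
Qed.

Lemma csimplex_dist x y : csimplex T x -> csimplex T y -> enorm (x - y) <= hT T.
Proof.
move=> xT yT; rewrite leNgt; apply/negP => lt.
have [b bT] := osimplex_nonempty card_cell_gt0.
have e0 : 0 < enorm (x - y) := le_lt_trans hT_ge0 lt.
(* [hT] is the diameter of the open simplex. Contracting [x] and [y] towards an interior point by
   this ratio below 1 leaves them at the distance [(hT T + enorm (x - y)) / 2], still above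
   [hT T]. *)
pose s := (hT T / enorm (x - y) + 1) / 2.
have s1 : 0 <= s < 1.
  have : hT T / enorm (x - y) < 1 by rewrite ltr_pdivrMr ?mul1r.
  have : 0 <= hT T / enorm (x - y) by rewrite divr_ge0 ?hT_ge0// ltW.
  by rewrite /s; lra.
have /andP[s0 _] := s1.
have := osimplex_dist (osimplex_seg nT (subxx _) bT xT s1) (osimplex_seg nT (subxx _) bT yT s1).
rewrite opprD addrACA subrr add0r -scalerBr opprB addrA subrK enormZ ger0_norm//.
apply/negP; rewrite -ltNge /s mulrAC mulrDl divfK ?gt_eqF// mul1r; lra.
Qed.

Lemma hT_gt0 : 0 < hT T.
Proof.
have [cT _] := nT.
have /card_gt1P[i [j [iT jT ij]]] : (1 < #|T|)%N by rewrite cT ltnS.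
apply: lt_le_trans (csimplex_dist (vtx_csimplex nT iT) (vtx_csimplex nT jT)).
rewrite lt_neqAle enorm_ge0 andbT eq_sym enorm_eq0 subr_eq0.
apply/eqP => vv; have := bc_vtx nT i iT; have := bc_vtx nT i jT.
by rewrite vv eqxx (negPf ij) => ->/eqP; rewrite eq_sym oner_eq0.
Qed.

(** [inradius] is a supremum that need not be attained, hence the lost factor 2. If the supremum did
    not exist, [sup] would be 0, against [hT_gt0]; the same inequality forces [rho] to be
    positive. *)
Lemma inscribed_ball rho : hT T <= rho * rT T ->
  0 < rho /\ exists c, eball c (hT T / (2 * rho)) `<=` osimplex T.
Proof.
move=> hr; have h0 := hT_gt0.
rewrite /rT /inradius in hr; set S := [set r | _] in hr.
have supS : has_sup S by apply: contrapT => /sup_out H; move: hr; rewrite H mulr0 leNgt h0.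
have r0 : 0 <= sup S.
  by have [[r Sr] /ub_le_sup/(_ _ Sr)] := supS; apply: le_trans; case: Sr.
have rr0 : 0 < rho * sup S := lt_le_trans h0 hr.
have rho0 : 0 < rho by rewrite ltNge; apply/negP => ?; move: rr0; rewrite ltNge mulr_le0_ge0.
have supS0 : 0 < sup S by move: rr0; rewrite pmulr_rgt0.
split=> //.
have [r [_ [c cr]] rS] := sup_adherent (divr_gt0 supS0 (ltr0n R 2)) supS.
exists c => y /= yc; apply: cr; apply: (lt_le_trans yc).
rewrite ler_pdivrMr ?mulr_gt0//.
have : sup S / 2 < r by rewrite (le_lt_trans _ rS)// {2}(splitr (sup S)) addrK.
by move=> H; nra.
Qed.

(** The difference [x - y] is a convex combination of the differences [vtx i - vtx j], with the
    products of the barycentric coordinates as weights. *)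
Lemma dot_csimplex_le (g : 'rV[R]_N) m x y :
  (forall i j, i \in T -> j \in T -> dot g (vtx i - vtx j) <= m) ->
  csimplex T x -> csimplex T y -> dot g (x - y) <= m.
Proof.
move=> gm /csimplexE-/(_ _ nT (subxx _))[x1 x2] /csimplexE-/(_ _ nT (subxx _))[y1 y2].
have -> : dot g (x - y) = \sum_i \sum_j bc T i x * bc T j y * dot g (vtx i - vtx j).
  rewrite -{1}(bc_comb nT x) -{1}(bc_comb nT y) dotBr !dot_sumr.
  transitivity (\sum_i bc T i x * dot g (vtx i) - \sum_j bc T j y * dot g (vtx j)).
    by congr (_ - _); apply: eq_bigr => i _; rewrite dotZr.
  set S := \sum_j bc T j y * _.
  transitivity (\sum_i (bc T i x * dot g (vtx i) - bc T i x * S)).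
    by rewrite sumrB -mulr_suml bc_sum// mul1r.
  apply: eq_bigr => i _; rewrite -[X in X - _]mulr1 -(bc_sum nT y).
  rewrite [X in X - _]mulr_sumr [X in _ - X]mulr_sumr -sumrB.
  by apply: eq_bigr => j _; rewrite dotBr; ring.
apply: (@le_trans _ _ (\sum_i \sum_j bc T i x * bc T j y * m)).
  apply: ler_sum => i _; apply: ler_sum => j _.
  have [iT|iT] := boolP (i \in T); last by rewrite bc_out// !mul0r.
  have [jT|jT] := boolP (j \in T); last by rewrite (bc_out _ _ jT)// mulr0 !mul0r.
  by rewrite ler_wpM2l ?gm// mulr_ge0 ?x1 ?y1.
under eq_bigr do rewrite -mulr_suml -mulr_sumr bc_sum// mulr1.
by rewrite -mulr_suml bc_sum// mul1r.
Qed.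

Lemma gradient_le rho (g : 'rV[R]_N) m : hT T <= rho * rT T ->
  (forall i j, i \in T -> j \in T -> dot g (vtx i - vtx j) <= m) ->
  enorm g * hT T <= 2 * rho * m.
Proof.
move=> /inscribed_ball[rho0 [c cT]] gm.
have [->|g0] := eqVneq g 0.
  rewrite enorm0 mul0r mulr_ge0 ?mulr_ge0 ?(ltW rho0)//.
  by have /card_gt0P[i iT] := card_cell_gt0; have := gm i i iT iT; rewrite subrr dot0r.
have e0 : 0 < enorm g by rewrite lt_neqAle eq_sym enorm_eq0 g0 enorm_ge0.
(* Half the guaranteed radius, in the direction of [g]: both [c + d] and [c - d] lie in the cell,
   and [g] varies by [enorm g * hT T / (2 * rho)] between them. *)
pose d := (hT T / (4 * rho) / enorm g) *: g.
have dE : enorm d = hT T / (4 * rho).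
  have ? : 0 <= hT T / (4 * rho) / enorm g.
    by rewrite !divr_ge0 ?hT_ge0 ?mulr_ge0 ?(ltW rho0)// enorm_ge0.
  by rewrite enormZ ger0_norm// divfK// gt_eqF.
have dlt : enorm d < hT T / (2 * rho).
  rewrite dE ltr_pM2l ?hT_gt0// ltf_pV2 ?posrE ?mulr_gt0//; nra.
have p1 : csimplex T (c + d).
  by apply/osimplex_csimplex/cT; rewrite /eball/= addrC addKr.
have p2 : csimplex T (c - d).
  by apply/osimplex_csimplex/cT; rewrite /eball/= addrC addKr enormN.
have := dot_csimplex_le gm p1 p2.
rewrite opprB (addrC d) addrACA subrr add0r -scalerDl dotZr -enorm_sqr.
move=> H.
have -> : enorm g * hT T = 2 * rho * ((hT T / (4 * rho) / enorm g + hT T / (4 * rho) / enorm g) * enorm g ^+ 2).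
  by field; rewrite !gt_eqF.
by rewrite ler_pM2l// mulr_gt0.
Qed.

Lemma vol_osimplex_le : vol (osimplex T) <= (2 * hT T) ^+ N.
Proof.
have [b bT] := osimplex_nonempty card_cell_gt0.
have mo : vmeas (osimplex T) by apply: measurable_vec_open; exact: osimplex_open.
have bo : ebounded (osimplex T).
  by have [B BT] := csimplex_bounded T; exists B => x /osimplex_csimplex/BT.
rewrite -lee_fin volE//.
pose a1 := b - const_mx (hT T); pose a2 := b + const_mx (hT T).
have sub : osimplex T `<=` closed_box a1 a2.
  move=> x xT i; rewrite !mxE -ler_distl.
  by have := coord_le_enorm (x - b) i; rewrite !mxE => /le_trans; apply; exact: osimplex_dist.
have -> : ((2 * hT T) ^+ N)%:E = lebesgue_tuple N (@vec_of_tuple R N @^-1` closed_box a1 a2).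
  rewrite closed_box_measure.
    rewrite (eq_bigr (fun=> 2 * hT T)) ?prodr_const ?card_ord// => i _.
    by rewrite !mxE; ring.
  by move=> i; rewrite !mxE lerD2l ge0_cp ?hT_ge0.
apply: le_measure; rewrite ?inE//; first exact: measurable_closed_box.
by move=> t; exact: sub.
Qed.

Lemma vol_osimplex_ge rho : hT T <= rho * rT T ->
  (hT T / (2 * rho * N%:R)) ^+ N <= vol (osimplex T).
Proof.
move=> /inscribed_ball[rho0 [c cT]]; have h0 := hT_gt0.
have mo : vmeas (osimplex T) by apply: measurable_vec_open; exact: osimplex_open.
have bo : ebounded (osimplex T).
  by have [B BT] := csimplex_bounded T; exists B => x /osimplex_csimplex/BT.
have NR : 0 < N%:R :> R by rewrite ltr0n.
(* Half the side of a cube in the inscribed ball. The Euclidean norm is bounded by [N] times the sup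
   norm, so [N%:R * d] has to stay below the radius. *)
pose d := hT T / (2 * rho * N%:R) / 2.
have d0 : 0 < d by rewrite !divr_gt0// !mulr_gt0.
pose a1 := c - const_mx d; pose a2 := c + const_mx d.
have sub : closed_box a1 a2 `<=` osimplex T.
  move=> x xT; apply: cT; rewrite /eball/=.
  apply: (@le_lt_trans _ _ (N%:R * d)).
    apply: enorm_le_sup; first exact: ltW.
    by move=> i; have := xT i; rewrite !mxE -ler_distl.
  have -> : N%:R * d = hT T / (2 * rho) / 2 by rewrite /d; field; rewrite !gt_eqF.
  by rewrite ltr_pdivrMr// ltr_pMr ?ltr1n// divr_gt0// mulr_gt0.
rewrite -lee_fin volE//.
have -> : ((hT T / (2 * rho * N%:R)) ^+ N)%:E = lebesgue_tuple N (@vec_of_tuple R N @^-1` closed_box a1 a2).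
  rewrite closed_box_measure.
    rewrite (eq_bigr (fun=> hT T / (2 * rho * N%:R))) ?prodr_const ?card_ord// => i _.
    by rewrite !mxE /d; field; rewrite !gt_eqF.
  by move=> i; rewrite !mxE lerD2l ge0_cp ?ltW.
apply: le_measure; rewrite ?inE//; first exact: measurable_closed_box.
by move=> t; exact: sub.
Qed.

End simplex_size.

Section rays.
Context {R : realType}.

Lemma near_pos_aff (u v : R) : 0 < u -> \forall s \near 0^'+, 0 < u + s * v.
Proof.
move=> u0; have v1 : 0 < `|v| + 1 by rewrite ltr_pwDr.
near=> s.
have s0 : 0 < s by near: s; exact: nbhs_right_gt.
have : s < u / (`|v| + 1) by near: s; apply: nbhs_right_lt; rewrite divr_gt0.
rewrite ltr_pdivlMr// => su; have := ler_norm (- v); rewrite normrN; nra.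
Unshelve. all: by end_near. Qed.

Lemma near_ray N (U : set 'rV[R]_N) (x w : 'rV[R]_N) : open U -> U x ->
  \forall s \near 0^'+, U (x + s *: w).
Proof.
move=> oU Ux; have /nbhs_ballP[e /= e0 eU] := open_nbhs_nbhs (conj oU Ux).
have w1 : 0 < `|w| + 1 by rewrite ltr_pwDr.
near=> s; apply: eU.
have s0 : 0 < s by near: s; exact: nbhs_right_gt.
have : s < e / (`|w| + 1) by near: s; apply: nbhs_right_lt; rewrite divr_gt0.
rewrite ltr_pdivlMr// => su; rewrite mx_norm_ball /ball_ /= opprD addrA subrr add0r normrN.
by rewrite normrZ gtr0_norm//; nra.
Unshelve. all: by end_near. Qed.

End rays.

(** * Cells around a face, and cells inside the domain *)

Section mesh_topology.
Context {R : realType} {N : nat} (P : interface_problem R N) (M : mesh R N).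
Hypotheses (N0 : (0 < N)%N) (hO : convex_polytope_domain (Omega P))
  (htri : triangulation P M).
Local Notation simplex := {set 'I_(nv M)}.
Implicit Types (S T F : simplex) (x y : 'rV[R]_N).

Lemma cell_full T : T \in cells M -> full_simplex T.
Proof. by case: htri => + _ _ _ TM => /(_ T TM). Qed.

Lemma sub_osimplex_csimplex S T x : T \in cells M -> S \subset T ->
  osimplex S x -> csimplex T x.
Proof.
move=> TM ST xS; have /(osimplexE (cell_full TM) _ ST)[x1 x2] := xS.
apply/(csimplexE (cell_full TM)) => //; split => i iT; last exact: bc_out (cell_full TM) _ _ iT.
by have [/x1/ltW//|/x2 ->] := boolP (i \in S).
Qed.

(** By conformity [x] lies in the closed simplex on the common vertices. Its coordinates are
    positive on all of [S], so each vertex of [S] is common. *)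
Lemma osimplex_sub_cell S T T' x : T \in cells M -> T' \in cells M ->
  S \subset T -> osimplex S x -> csimplex T' x -> S \subset T'.
Proof.
move=> TM TM' ST xS xT'; have fT := cell_full TM.
have : (csimplex T `&` csimplex T') x by split=> //; exact: sub_osimplex_csimplex xS.
case: htri => _ _ /(_ _ _ TM TM') -> _ /(csimplexE fT _ (subsetIl _ _))[_ x0].
have /(osimplexE fT _ ST)[x1 _] := xS.
apply/fintype.subsetP => i /x1 xi; have := x0 i; case: (boolP (i \in _)) => [|_ /(_ isT) xi0].
  by rewrite inE => /andP[].
by rewrite xi0 ltxx in xi.
Qed.

Lemma cells_disjoint T T' x : T \in cells M -> T' \in cells M ->
  osimplex T x -> csimplex T' x -> T = T'.
Proof.
move=> TM TM' xT xT'; apply/eqP; rewrite eqEcard.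
apply/andP; split; first exact: osimplex_sub_cell TM TM' (subxx _) xT xT'.
by have [-> _] := cell_full TM; have [-> _] := cell_full TM'.
Qed.

Lemma cells_cover x : closure (Omega P) x -> exists2 T, T \in cells M & csimplex T x.
Proof. by case: htri => _ + _ _ => <-. Qed.

Lemma csimplex_closure T x : T \in cells M -> csimplex T x -> closure (Omega P) x.
Proof. by move=> TM xT; case: htri => _ <- _ _; exists T. Qed.

(** The vertices of [T] lie in the closure of [Omega P], so [dot a] is at most [b] there. A
    combination with positive weights on [S] reaches [b] only if every vertex of [S] does. *)
Lemma polytope_osimplex S T x (a : 'rV[R]_N) b : T \in cells M -> S \subset T ->
  (forall z, Omega P z -> dot a z < b) -> osimplex S x ->
  dot a x < b \/ forall i, i \in S -> dot a (vtx i) = b.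
Proof.
move=> TM ST aO xS; have fT := cell_full TM.
have av i : i \in T -> dot a (vtx i) <= b.
  move=> iT; have := csimplex_closure TM (vtx_csimplex fT iT).
  have cl : closed [set z | dot a z <= b].
    by apply: (@preimage_closed _ _ (dot a) [set t | t <= b]) => [z _|];
      [exact: dot_continuous|exact: closed_le].
  have sub : closure (Omega P) `<=` [set z | dot a z <= b].
    rewrite [X in _ `<=` X](closure_id _).1//; apply: closureS => z.
    by move=> /aO/ltW.
  exact: sub.
have /(osimplexE fT _ ST)[x1 x2] := xS.
have [?|xb] := ltP (dot a x) b; [by left|right=> i iS].
apply/eqP; rewrite eq_le av ?(fintype.subsetP ST)//= leNgt; apply/negP => ai.
move: xb; rewrite leNgt => /negP; apply.
rewrite -[x](bc_comb fT) dot_sumr -[ltRHS]mul1r -(bc_sum fT x) mulr_suml.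
rewrite (bigD1 i)//= [ltRHS](bigD1 i)//= ltr_leD//.
  by rewrite dotZr ltr_pM2l// x1.
apply: ler_sum => j _; rewrite dotZr.
have [jT|jT] := boolP (j \in T); last by rewrite bc_out// !mul0r.
rewrite ler_wpM2l ?av//; have [/x1/ltW//|/x2 ->//] := boolP (j \in S).
Qed.

Lemma osimplex_Omega T : T \in cells M -> osimplex T `<=` Omega P.
Proof.
move=> TM x xT; have [[z Oz] _ [m [a [b OE]]]] := hO.
rewrite OE => k /=.
have aO y : Omega P y -> dot (a k) y < b k by rewrite OE; apply.
have [//|H] := polytope_osimplex TM (subxx _) aO xT.
(* If all vertices of a full simplex satisfied the equality, [dot (a k)] would be constant on the
   whole space, which the point [z] of [Omega P] contradicts. *)
have := aO z Oz; rewrite -[z](bc_comb (cell_full TM)) dot_sumr.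
rewrite (eq_bigr (fun i => bc T i z * b k)).
  by rewrite -mulr_suml bc_sum ?mul1r ?ltxx//; exact: cell_full.
move=> i _; rewrite dotZr; have [iT|iT] := boolP (i \in T); first by rewrite H.
by rewrite bc_out ?mul0r//; exact: cell_full.
Qed.

Lemma face_Omega S T x : T \in cells M -> S \subset T -> osimplex S x ->
  Omega P x -> osimplex S `<=` Omega P.
Proof.
move=> TM ST xS Ox y yS; have [_ _ [m [a [b OE]]]] := hO.
rewrite OE => k /=; have aO z : Omega P z -> dot (a k) z < b k by rewrite OE; apply.
have [//|H] := polytope_osimplex TM ST aO yS.
have fT := cell_full TM; have /(osimplexE fT _ ST)[_ x2] := xS.
have := aO x Ox; rewrite -[x](bc_comb fT) dot_sumr.
rewrite (eq_bigr (fun i => bc T i x * b k)).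
  by rewrite -mulr_suml bc_sum ?mul1r ?ltxx//; exact: cell_full.
move=> i _; rewrite dotZr; have [iS|/x2 ->] := boolP (i \in S); first by rewrite H.
by rewrite !mul0r.
Qed.

Lemma Omega_open : open (Omega P).
Proof.
have [_ _ [m [a [b ->]]]] := hO; rewrite openE => x /= xO.
apply: (@filter_forall _ _ (fun i => [set y | dot (a i) y < b i]) (nbhs x) (nbhs_filter x)) => i.
have /(_ (nbhs_filter x)) := cvgr_lt (dot (a i) x) (@dot_continuous R N (a i) x) (b i) (xO i).
by apply: (@filterS _ _ (nbhs_filter x)).
Qed.

Lemma opposite_vertex F T : T \in cells M -> F \in faces M -> F \subset T ->
  exists i, [/\ i \in T, i \notin F & T = (i |: F)%SET].
Proof.
move=> TM; rewrite inE => /andP[/eqP cF _] FT.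
have : #|(T :\: F)%SET| == 1%N.
  by rewrite cardsD (finset.setIidPr FT) cF (cell_full TM).1 subSnn.
move=> /cards1P[i TF]; have : i \in (T :\: F)%SET by rewrite TF inE.
rewrite inE => /andP[iF iT]; exists i; split => //.
apply/eqP; rewrite finset.eqEsubset finset.subUset finset.sub1set iT FT !andbT.
apply/fintype.subsetP => k kT; rewrite !inE; case: (boolP (k \in F)) => kF; first by rewrite orbT.
have : k \in (T :\: F)%SET by rewrite inE kF.
by rewrite TF inE => ->.
Qed.

Lemma card_face F : F \in faces M -> #|F| = N.
Proof. by rewrite inE => /andP[/eqP]. Qed.

Section two_cells.
Variables (F T T' : simplex) (i j : 'I_(nv M)).
Hypotheses (FM : F \in faces M) (TM : T \in cells M) (TM' : T' \in cells M)
  (TT' : T != T') (iF : i \notin F) (jF : j \notin F)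
  (TE : T = (i |: F)%SET) (TE' : T' = (j |: F)%SET).
Let fT := cell_full TM.
Let fT' := cell_full TM'.
Let FT : F \subset T. Proof. by rewrite TE finset.subsetUr. Qed.
Let FT' : F \subset T'. Proof. by rewrite TE' finset.subsetUr. Qed.

(** Otherwise a point near the relative interior of [F], moved slightly towards [vtx j], would lie
    in the closed cell [T] and in the open cell [T']. *)
Lemma opposite_sides : bc T i (vtx j) < 0.
Proof.
rewrite ltNge; apply/negP => b0.
have [p pF] : osimplex F !=set0 by apply: osimplex_nonempty; rewrite card_face.
have /(osimplexE fT _ FT)[p1 p2] := pF; have /(osimplexE fT' _ FT')[q1 q2] := pF.
pose x s := p + s *: (vtx j - p).
suff [s [xT xT']] : exists s, csimplex T (x s) /\ osimplex T' (x s).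
  by move: TT'; rewrite (cells_disjoint TM' TM xT' xT) eqxx.
have H1 : \forall s \near 0^'+, forall k, k \in F -> 0 < bc T k p + s * (bc T k (vtx j) - bc T k p).
  apply: (@filter_forall _ _ (fun k => [set s | k \in F ->
    0 < bc T k p + s * (bc T k (vtx j) - bc T k p)])) => k.
  have [kF|_] := boolP (k \in F); last exact: nearW.
  have := near_pos_aff (bc T k (vtx j) - bc T k p) (p1 k kF).
  by apply: filterS => s sp _.
have : \forall s \near 0^'+, csimplex T (x s) /\ osimplex T' (x s); last by move/filter_ex.
near=> s.
have s0 : 0 < s by near: s; exact: nbhs_right_gt.
have s1 : s < 1 by near: s; exact: nbhs_right_lt.
split.
  apply/(csimplexE fT) => //; split => k kT; last exact: bc_out.
  rewrite /bc /x aff_seg -!/(bc _ _ _).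
  have : k \in (i |: F)%SET by rewrite -TE.
  rewrite in_setU1 => /predU1P[->|kF].
    by rewrite (p2 i iF) subr0 add0r mulr_ge0 ?(ltW s0).
  by apply/ltW; move: {kT} k kF; near: s.
apply/(osimplexE fT') => //; split => k kT; last exact: bc_out.
have jT' : j \in T' by rewrite TE' in_setU1 eqxx.
rewrite /bc /x aff_seg -!/(bc _ _ _) bc_vtx//.
have : k \in (j |: F)%SET by rewrite -TE'.
rewrite in_setU1 => /predU1P[->|kF].
  by rewrite eqxx (q2 j jF) subr0 add0r mulr1.
have -> : k == j = false by apply/negP => /eqP kj; rewrite kj (negPf jF) in kF.
by have := q1 k kF; rewrite /= mulr0n sub0r; nra.
Unshelve. all: by end_near. Qed.

(** Two affine functions vanishing at the vertices of [F] are proportional; the factor is found at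
    [vtx i]. *)
Lemma bc_opposite x : bc T' j x = bc T i x * bc T' j (vtx i).
Proof.
rewrite {1}/bc (aff_bary fT) (bigD1 i)//= big1 ?addr0// => k ki.
have [kT|kT] := boolP (k \in T); last by rewrite bc_out// mul0r.
have : k \in (i |: F)%SET by rewrite -TE.
rewrite in_setU1 (negPf ki) /= => kF.
rewrite -/(bc T' j _) bc_vtx ?(fintype.subsetP FT')//.
have [jk|_] := eqVneq j k; first by rewrite -jk (negPf jF) in kF.
by rewrite mulr0n mulr0.
Qed.

End two_cells.

Lemma sub_face_cells F T : (T \in face_cells F) = (T \in cells M) && (F \subset T).
Proof. by rewrite inE. Qed.

(** Three cells on one face would have opposite vertices pairwise on opposite sides of it; the
    product formula of [bc_opposite] gives the wrong sign at the third vertex. *)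
Lemma face_cells_le2 F T T' T'' : F \in faces M -> T \in face_cells F ->
  T' \in face_cells F -> T'' \in face_cells F -> T != T' -> T != T'' -> T' = T''.
Proof.
move=> FM; rewrite !sub_face_cells => /andP[TM FT] /andP[TM' FT'] /andP[TM'' FT''] n1 n2.
apply/eqP/negPn/negP => n3.
have [i [iT iF TE]] := opposite_vertex TM FM FT.
have [j [jT jF TE']] := opposite_vertex TM' FM FT'.
have [k [kT kF TE'']] := opposite_vertex TM'' FM FT''.
have bik := opposite_sides FM TM TM'' n2 iF kF TE TE''.
have bjk := opposite_sides FM TM' TM'' n3 jF kF TE' TE''.
have bji : bc T' j (vtx i) < 0.
  by apply: (opposite_sides FM TM' TM _ jF iF TE' TE); rewrite eq_sym.
by have := bc_opposite TM TM' jF TE TE' (vtx k); nra.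
Qed.

(** A short step from [x] away from the opposite vertex leaves [T] but not the open set [Omega P],
    hence lands in some cell. There are finitely many closed cells, so for short steps this cell
    also contains [x], and with it the face [F]. *)
Lemma interior_face F T x : T \in cells M -> F \in faces M -> F \subset T ->
  osimplex F x -> Omega P x -> exists2 T', T' \in face_cells F & T' != T.
Proof.
move=> TM FM FT xF Ox; have fT := cell_full TM.
have [i [iT iF TE]] := opposite_vertex TM FM FT.
have /(osimplexE fT _ FT)[x1 x2] := xF.
pose y s := x + s *: (x - vtx i).
have H : \forall s \near 0^'+, forall T', T' \in cells M -> csimplex T' (y s) -> csimplex T' x.
  apply: (@filter_forall _ _ (fun T' => [set s | T' \in cells M -> csimplex T' (y s) -> csimplex T' x])) => T'.
  have [xT'|xT'] := pselect (csimplex T' x); first by apply: nearW => s _ _.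
  have [TM'|_] := boolP (T' \in cells M); last exact: nearW.
  have oC : open (~` csimplex T') := closed_openC (csimplex_closed (cell_full TM')).
  by apply: filterS (near_ray (x - vtx i) oC xT') => s ? _ /=.
suff : \forall s \near (0 : R)^'+, exists2 T', T' \in face_cells F & T' != T.
  by move/filter_ex => [].
near=> s.
have s0 : 0 < s by near: s; exact: nbhs_right_gt.
have Oy : Omega P (y s) by near: s; exact: (near_ray _ Omega_open Ox).
have [T' TM' yT'] := cells_cover (subset_closure Oy).
have xT' : csimplex T' x by move: (T') TM' yT'; near: s.
exists T'; first by rewrite sub_face_cells TM' (osimplex_sub_cell TM TM' FT xF xT').
apply/eqP => TT'; move: yT'; rewrite TT' => /(csimplexE fT _ (subxx _))[/(_ i iT) + _].
rewrite /y -opprB scalerN -scaleNr /bc aff_seg -!/(bc _ _ _) (x2 i iF) bc_vtx// eqxx subr0.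
by rewrite add0r mulr1 leNgt oppr_lt0 s0.
Unshelve. all: by end_near. Qed.

Lemma interior_faceP F x : F \in faces M -> osimplex F x -> Omega P x ->
  F \in interior_faces M.
Proof.
move=> FM xF Ox; have : F \in faces M by []; rewrite inE => /andP[_ /existsP[T /andP[TM FT]]].
have [T' FT' TT'] := interior_face TM FM FT xF Ox.
have TF : T \in face_cells F by rewrite sub_face_cells TM.
rewrite inE FM; apply/cards2P; exists T, T'; split; first by rewrite eq_sym.
apply/setP => T''; apply/idP/idP => [TF''|].
  rewrite in_set2; have [//|TT''] := eqVneq T'' T; apply/eqP; symmetry.
  by apply: (face_cells_le2 FM TF) => //; rewrite eq_sym.
by rewrite in_set2 => /orP[/eqP ->|/eqP ->].
Qed.

Lemma interior_two_cells F : F \in interior_faces M ->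
  [/\ T1 F \in cells M, T2 F \in cells M, F \subset T1 F, F \subset T2 F & T1 F != T2 F].
Proof.
move=> FI; have [E _ _ _] : [/\ face_cells F = [set T1 F; T2 F]%SET, enorm (nF F) = 1,
    forall x y, csimplex F x -> csimplex F y -> dot (nF F) (y - x) = 0 &
    forall x y, osimplex (T1 F) x -> osimplex (T2 F) y -> 0 < dot (nF F) (y - x)].
  by case: htri => _ _ _; apply.
have h1 : T1 F \in face_cells F by rewrite E !inE eqxx.
have h2 : T2 F \in face_cells F by rewrite E !inE eqxx orbT.
move: h1 h2; rewrite !sub_face_cells => /andP[-> ->] /andP[-> ->]; split => //.
apply/eqP => T12; move: FI; rewrite inE E T12 => /andP[_].
by rewrite finset.setUid cards1.
Qed.

(** Near [p] the coordinates of the vertices of [F] stay positive in both cells. The coordinates of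
    the two opposite vertices are negative multiples of each other, so one of them is
    nonnegative. *)
Lemma cross_face F T T' p (e : 'rV[R]_N) : F \in faces M -> T \in face_cells F ->
  T' \in face_cells F -> T != T' -> osimplex F p ->
  \forall s \near 0^'+, csimplex T (p + s *: e) \/ csimplex T' (p + s *: e).
Proof.
move=> FM; rewrite !sub_face_cells => /andP[TM FT] /andP[TM' FT'] TT' pF.
have fT := cell_full TM; have fT' := cell_full TM'.
have [i [iT iF TE]] := opposite_vertex TM FM FT.
have [j [jT jF TE']] := opposite_vertex TM' FM FT'.
have /(osimplexE fT _ FT)[p1 p2] := pF; have /(osimplexE fT' _ FT')[q1 q2] := pF.
have H (S : simplex) : (forall k, k \in F -> 0 < bc S k p) ->
    \forall s \near 0^'+, forall k, k \in F -> 0 < bc S k (p + s *: e).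
  move=> b0; apply: (@filter_forall _ _ (fun k => [set s | k \in F -> 0 < bc S k (p + s *: e)])) => k.
  have [kF|_] := boolP (k \in F); last exact: nearW.
  apply: filterS (near_pos_aff (dot (bary S k).1 e) (b0 k kF)) => s + _.
  by rewrite /bc /aff dotDr dotZr addrAC.
have bij : bc T' j (vtx i) < 0.
  by apply: (opposite_sides FM TM' TM _ jF iF TE' TE); rewrite eq_sym.
near=> s.
have h1 : forall k, k \in F -> 0 < bc T k (p + s *: e) by near: s; exact: H.
have h2 : forall k, k \in F -> 0 < bc T' k (p + s *: e) by near: s; exact: H.
have [bi|bi] := leP 0 (bc T i (p + s *: e)); [left|right].
  apply/(csimplexE fT) => //; split => k kT; last exact: bc_out.
  have : k \in (i |: F)%SET by rewrite -TE.
  by rewrite in_setU1 => /predU1P[->//|/h1/ltW].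
apply/(csimplexE fT') => //; split => k kT; last exact: bc_out.
have : k \in (j |: F)%SET by rewrite -TE'.
rewrite in_setU1 => /predU1P[->|/h2/ltW//].
by rewrite (bc_opposite TM TM' jF TE TE'); nra.
Unshelve. all: by end_near. Qed.

End mesh_topology.

(** * Face integrals *)

Section null_unions.
Context {R : realType} {n : nat}.

Definition vnull (A : set 'rV[R]_n) :=
  vmeas A /\ lebesgue_tuple n (@vec_of_tuple R n @^-1` A) = 0%E.

Lemma vnull0 : vnull set0.
Proof. by rewrite /vnull /vmeas preimage_set0 measure0; split=> //; exact: measurable0. Qed.

Lemma vnullU (A B : set 'rV[R]_n) : vnull A -> vnull B -> vnull (A `|` B).
Proof.
move=> [mA A0] [mB B0]; rewrite /vnull /vmeas preimage_setU.
split; first exact: measurableU.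
by rewrite (measureU0 _ _ B0).
Qed.

Lemma vnull_finite (I : finType) (A : I -> set 'rV[R]_n) : (forall i, vnull (A i)) ->
  vnull [set x | exists i, A i x].
Proof.
move=> A0; have H (r : seq I) : vnull (\big[setU/set0]_(i <- r) A i).
  elim: r => [|i r IH]; first by rewrite big_nil; exact: vnull0.
  by rewrite big_cons; exact: vnullU.
rewrite (_ : [set x | _] = \big[setU/set0]_(i <- index_enum I) A i)//.
rewrite -bigcup_seq; apply/seteqP; split => x [i Ai]; first by exists i => //=; exact: mem_index_enum.
by move=> ?; exists i.
Qed.

Lemma vnull_hyperplane (a : 'rV[R]_n) b : a != 0 -> vnull [set x | dot a x = b].
Proof.
move=> a0; split; last exact: hyperplane_null.
by apply: measurable_vec_closed; exact: closed_hyperplane.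
Qed.

End null_unions.

(** * Parametrization of a face and its Gram determinant *)

Section face_parametrization.
Context {R : realType} {N : nat} (M : mesh R N).
Local Notation simplex := {set 'I_(nv M)}.
Implicit Types (T F : simplex) (x y : 'rV[R]_N).

Definition face_vtx F : seq 'rV[R]_N := [seq vtx i | i <- enum F].
Definition face_map k F (t : 'rV[R]_k) : 'rV[R]_N :=
  (face_vtx F)`_0 + t *m edge_mx (face_vtx F).

Lemma aff_face_map (p : affine) k F (t : 'rV[R]_k) :
  aff p (face_map F t) = aff p (face_vtx F)`_0 +
    \sum_i t 0 i * (aff p (face_vtx F)`_i.+1 - aff p (face_vtx F)`_0).
Proof.
rewrite /face_map /aff mulmx_sum_row dotDr dot_sumr addrAC; congr (_ + _).
apply: eq_bigr => i _; rewrite dotZr; congr (_ * _).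
rewrite opprD addrACA subrr addr0 -dotBr; congr dot.
by apply/rowP => j; rewrite !mxE.
Qed.

Lemma face_map_osimplex k F (t : 'rV[R]_k) : #|F| = k.+1 ->
  (forall i, 0 < t 0 i) -> \sum_i t 0 i < 1 -> osimplex F (face_map F t).
Proof.
move=> cF t0 t1.
(* The weight of the [l]-th listed vertex, the 0-th taking the complement to 1. The value 1 out of
   range is a dummy that keeps [tau] positive everywhere. *)
pose tau (l : nat) : R := if l is l'.+1 then
  (if insub l' is Some i then t 0 i else 1) else 1 - \sum_i t 0 i.
have tau0 l : 0 < tau l.
  by case: l => [|l] /=; [rewrite subr_gt0|case: insubP].
have sE : size (enum F) = k.+1 by rewrite -cardE.
have sumE (V : lmodType R) (f : 'I_(nv M) -> V) :
    \sum_(i in F) tau (index i (enum F)) *: f i = 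
    tau 0 *: f (nth (enum_val (cast_ord (esym cF) ord0)) (enum F) 0) +
    \sum_(l < k) t 0 l *: f (nth (enum_val (cast_ord (esym cF) ord0)) (enum F) l.+1).
  set d := enum_val _.
  rewrite -big_enum/= (big_nth d) sE big_mkord big_ord_recl.
  have ui (l : 'I_k.+1) : index (nth d (enum F) l) (enum F) = l.
    by rewrite index_uniq ?sE ?enum_uniq.
  rewrite (ui ord0); congr (_ + _); apply: eq_bigr => l _.
  rewrite (ui (lift ord0 l)) lift0 /=; case: insubP => [u _ ul|]; last by rewrite ltn_ord.
  by congr (t 0 _ *: _); apply/val_inj.
pose w i := if i \in F then tau (index i (enum F)) else 0.
exists w; split => [i iF|i iF||].
- by rewrite /w iF.
- by rewrite /w (negPf iF).
- rewrite /w -big_mkcond/=; have := sumE R^o (fun=> 1).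
  rewrite (eq_bigr (fun i => tau (index i (enum F)))) => [->|i _]; last exact: mulr1.
  rewrite (eq_bigr (fun l => t 0 l)) => [|l _]; last exact: mulr1.
  by rewrite /GRing.scale/= mulr1 subrK.
- rewrite (eq_bigr (fun i => if i \in F then tau (index i (enum F)) *: vtx i else 0)); last first.
    by move=> i _; rewrite /w; case: ifP => //; rewrite scale0r.
  rewrite -big_mkcond/= sumE /tau /face_map mulmx_sum_row.
  set d := enum_val _.
  have nE l : (l < k.+1)%N -> (face_vtx F)`_l = vtx (nth d (enum F) l).
    by move=> lk; rewrite (nth_map d)// sE.
  rewrite nE// scalerBl scale1r -addrA; congr (_ + _).
  rewrite scaler_suml -sumrN -big_split; apply: eq_bigr => l _ /=.
  by rewrite rowK scalerBr addrC !nE// ltnS ltn_ord.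
Qed.

Lemma face_integralE F (f : 'rV[R]_N -> R) (E := edge_mx (k := N.-1) (face_vtx F)) :
  face_integral F f = Num.sqrt (\det (E *m E^T)) *
    vol_integral (@ref_simplex R N.-1) (fun t => f (face_map F t)).
Proof. by []. Qed.

Lemma det2 (A : 'M[R]_2) : \det A = A 0 0 * A 1 1 - A 0 1 * A 1 0.
Proof.
rewrite (expand_det_row _ 0) !big_ord_recl big_ord0 addr0 /cofactor !det_mx11 !mxE/=.
have e1 : lift 0 0 = 1 :> 'I_2 by apply/val_inj.
have e2 : lift (lift 0 0) 0 = 0 :> 'I_2 by apply/val_inj.
by rewrite /bump/= e2 !e1 addn0 expr0 expr1 mul1r mulN1r mulrN.
Qed.

(** The gradients of the barycentric coordinates of [T] are dual to the edge vectors [u], which are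
    therefore independent. The upper bound is Hadamard's inequality with edges of length at most
    [hT T]. *)
Lemma gram_bounds T F : N = 2%N \/ N = 3%N -> full_simplex T -> F \subset T -> #|F| = N ->
  0 < \det (edge_mx (k := N.-1) (face_vtx F) *m (edge_mx (face_vtx F))^T) <=
    (hT T ^+ N.-1) ^+ 2.
Proof.
move=> hN fT FT cF.
have sE : size (enum F) = N by rewrite -cardE.
have N0 : (0 < N)%N by case: hN => ->.
have [d dF] : exists d, d \in F by apply/card_gt0P; rewrite cF.
pose s l := nth d (enum F) l.
have nE l : (l < N)%N -> (face_vtx F)`_l = vtx (s l) by move=> lN; rewrite (nth_map d)// sE.
have sF l : (l < N)%N -> s l \in T.
  by move=> lN; rewrite (fintype.subsetP FT)// -mem_enum mem_nth// sE.
have sI l m : (l < N)%N -> (m < N)%N -> (s l == s m) = (l == m).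
  by move=> lN mN; rewrite nth_uniq ?sE ?enum_uniq.
pose u l := vtx (s l.+1) - vtx (s 0%N).
have gE (i j : 'I_N.-1) : (edge_mx (face_vtx F) *m (edge_mx (face_vtx F))^T) i j = dot (u i) (u j).
  rewrite mxE; apply: eq_bigr => l _; rewrite !mxE !nE ?mxE//; rewrite -ltn_predRL; exact: ltn_ord.
have g1 l m : (l.+1 < N)%N -> (m.+1 < N)%N ->
    dot (bary T (s l.+1)).1 (u m) = (l == m)%:R.
  move=> lN mN; rewrite -affB -!/(bc _ _ _) !bc_vtx ?sF// !sI//.
  by rewrite eqSS subr0.
have ul l : (l.+1 < N)%N -> 0 < dot (u l) (u l) <= hT T ^+ 2.
  move=> lN; apply/andP; split.
    rewrite lt_neqAle dot_ge0 andbT eq_sym dot_eq0; apply/eqP => ul0.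
    by have := g1 l l lN lN; rewrite ul0 dot0r eqxx => /eqP; rewrite eq_sym oner_eq0.
  rewrite -enorm_sqr ler_sqr ?nnegrE ?enorm_ge0 ?hT_ge0//.
  by apply: csimplex_dist => //; apply: vtx_csimplex => //; exact: sF.
case: hN => NE.
  have k1 : N.-1 = 1%N by rewrite NE.
  have -> : \det (edge_mx (k := N.-1) (face_vtx F) *m (edge_mx (face_vtx F))^T) = dot (u 0%N) (u 0%N).
    move: gE; move: (edge_mx (k := N.-1) _ *m _); rewrite k1 => A AE.
    by rewrite det_mx11 AE.
  by rewrite k1 expr1 ul// NE.
have k2 : N.-1 = 2%N by rewrite NE.
have -> : \det (edge_mx (k := N.-1) (face_vtx F) *m (edge_mx (face_vtx F))^T) =
    dot (u 0%N) (u 0%N) * dot (u 1%N) (u 1%N) - dot (u 0%N) (u 1%N) ^+ 2.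
  move: gE; move: (edge_mx (k := N.-1) _ *m _); rewrite k2 => A AE.
  by rewrite det2 !AE /= (dotC (u 1%N) (u 0%N)) expr2.
have /andP[u00 u01] : 0 < dot (u 0%N) (u 0%N) <= hT T ^+ 2 by apply: ul; rewrite NE.
have /andP[u10 u11] : 0 < dot (u 1%N) (u 1%N) <= hT T ^+ 2 by apply: ul; rewrite NE.
rewrite k2; apply/andP; split.
  (* An unnormalized Gram-Schmidt vector: its squared length is the Gram determinant times
     [dot (u 1%N) (u 1%N)]. *)
  pose w := dot (u 1%N) (u 1%N) *: u 0%N - dot (u 0%N) (u 1%N) *: u 1%N.
  have w0 : 0 < dot w w.
    rewrite lt_neqAle dot_ge0 andbT eq_sym dot_eq0; apply/eqP => w0.
    have : dot (bary T (s 1%N)).1 w = dot (u 1%N) (u 1%N).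
      by rewrite /w dotBr !dotZr !g1 ?NE// mulr1 mulr0 subr0.
    by rewrite w0 dot0r => H; rewrite -H ltxx in u10.
  have wE : dot w w = dot (u 1%N) (u 1%N) * (dot (u 0%N) (u 0%N) * dot (u 1%N) (u 1%N) - dot (u 0%N) (u 1%N) ^+ 2).
    rewrite /w; move: (u 0%N) (u 1%N) => a b.
    by rewrite dotBl !dotBr !dotZl !dotZr (dotC b a); ring.
  by move: w0; rewrite wE pmulr_rgt0.
rewrite -exprM (exprM _ 2 2) expr2 (le_trans (y := dot (u 0%N) (u 0%N) * dot (u 1%N) (u 1%N)))//.
  by rewrite gerBl sqr_ge0.
by rewrite ler_pM// ltW.
Qed.

End face_parametrization.

(** * Face means of affine functions and of their positive parts *)

Section face_means.
Context {R : realType} {N : nat} (M : mesh R N).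
Local Notation simplex := {set 'I_(nv M)}.
Hypothesis hN : N = 2%N \/ N = 3%N.
Implicit Types (T F : simplex) (x y : 'rV[R]_N) (f : 'rV[R]_N -> R).
Local Notation ref := (@ref_simplex R N.-1).

Definition ref_mean F f : R :=
  vol_integral ref (fun t => f (face_map F t)) / vol ref.

Let dimE : N.-1.+1 = N. Proof. by case: hN => ->. Qed.
Let hk : N.-1 = 1%N \/ N.-1 = 2%N. Proof. by case: hN => ->; [left|right]. Qed.
Let v0 : 0 < vol ref. Proof. exact: vol_ref_simplex_gt0. Qed.
Let mref := @vmeas_ref_simplex R N.-1.
Let bref := @ebounded_ref_simplex R N.-1.

Lemma face_mean_refE T F f : full_simplex T -> F \subset T -> #|F| = N ->
  face_mean F f = ref_mean F f.
Proof.
move=> fT FT cF; rewrite /face_mean !face_integralE.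
have /andP[d0 _] := gram_bounds hN fT FT cF.
rewrite (_ : vol_integral _ (fun=> cst 1 _) = vol ref); last first.
  by rewrite -[RHS]mul1r -vol_integral_cst.
by rewrite /ref_mean; field; rewrite !gt_eqF// sqrtr_gt0.
Qed.

Lemma ref_mean_ae F f g Z : vnull Z ->
  (forall t, ref t -> ~ Z t -> f (face_map F t) = g (face_map F t)) ->
  ref_mean F f = ref_mean F g.
Proof.
move=> [mZ Z0] fg; rewrite /ref_mean (vol_integral_null _ _ mZ Z0) [in RHS](vol_integral_null _ _ mZ Z0).
by congr (_ / _); apply: eq_vol_integral => t [rt Zt]; exact: fg.
Qed.

Lemma aff_face_ridge (p : affine) psi F t : psi (aff p (face_map F t)) =
  ridge psi (aff p (face_vtx F)`_0) (\row_(i < N.-1) aff p (face_vtx F)`_i.+1) t.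
Proof.
rewrite aff_face_map /ridge; congr (psi (_ + _)).
by apply: eq_bigr => i _; rewrite mxE.
Qed.

Lemma ref_mean_aff (p : affine) F : #|F| = N ->
  ref_mean F (aff p) = (\sum_(i in F) aff p (vtx i)) / N%:R.
Proof.
move=> cF; rewrite /ref_mean.
rewrite (@eq_vol_integral _ _ _ _ (ridge id (aff p (face_vtx F)`_0) (\row_(i < N.-1) aff p (face_vtx F)`_i.+1))).
  rewrite -[vol_integral _ _]/(ridge_integral _ _ _) ridge_mean_id// dimE; congr (_ / _).
  have [d dF] : exists d, d \in F by apply/card_gt0P; rewrite cF; case: hN => ->.
  have sE : size (enum F) = N.-1.+1 by rewrite dimE -cardE.
  rewrite -[in RHS]big_enum/= [in RHS](big_nth d) sE big_mkord big_ord_recl /face_vtx (nth_map d) ?sE//.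
  congr (_ + _); apply: eq_bigr => i _; rewrite mxE (nth_map d) ?lift0//.
  by rewrite sE ltnS.
by move=> t _; rewrite -aff_face_ridge.
Qed.

Lemma ref_mean_ridge c (p : affine) F : #|F| = N ->
  ref_mean F (fun x => pos_part c (aff p x)) =
  ridge_mean c N.-1 [seq aff p (vtx i) | i <- enum F].
Proof.
move=> cF; rewrite /ref_mean /ridge_mean.
have [d dF] : exists d, d \in F by apply/card_gt0P; rewrite cF; case: hN => ->.
have sE : size (enum F) = N.-1.+1 by rewrite dimE -cardE.
congr (_ / _); apply: eq_vol_integral => t _; rewrite aff_face_ridge.
rewrite /face_vtx !(nth_map d) ?sE//; congr ridge; apply/rowP => i.
by rewrite !mxE !(nth_map d)// sE ltnS.
Qed.

Lemma ref_meanD c (p q : affine) al F : #|F| = N ->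
  ref_mean F (fun x => aff p x + al * pos_part c (aff q x)) =
  ref_mean F (aff p) + al * ref_mean F (fun x => pos_part c (aff q x)).
Proof.
move=> cF; rewrite /ref_mean mulrA -mulrDl; congr (_ / _).
have cid : continuous (id : R -> R) by move=> x; exact: cvg_id.
have m1 : mbounded ref (fun t => aff p (face_map F t)).
  have := mbounded_ridge (aff p (face_vtx F)`_0) (\row_(i < N.-1) aff p (face_vtx F)`_i.+1) cid.
  by congr mbounded; apply/funext => t; rewrite -aff_face_ridge.
have m2 : mbounded ref (fun t => pos_part c (aff q (face_map F t))).
  have := mbounded_ridge (aff q (face_vtx F)`_0) (\row_(i < N.-1) aff q (face_vtx F)`_i.+1) (@continuous_pos_part R c).
  by congr mbounded; apply/funext => t; rewrite -aff_face_ridge.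
by rewrite vol_integralD// ?vol_integralZ//; exact: mboundedZ.
Qed.

Lemma enum_setD1 T i : enum (T :\ i)%SET = rem i (enum T).
Proof.
rewrite rem_filter ?enum_uniq// /enum_mem -filter_predI; apply: eq_filter => j.
by rewrite /= !inE.
Qed.

Lemma slope_faces c (p : affine) T : #|T| = N.+1 ->
  exists G kap, 0 <= G <= N%:R^-1 /\ forall i, i \in T ->
    ref_mean (T :\ i)%SET (fun x => pos_part c (aff p x)) = kap - aff p (vtx i) * G.
Proof.
move=> cT.
have cF i : i \in T -> #|(T :\ i)%SET| = N.
  by move=> iT; have := cardsD1 i T; rewrite iT cT add1n => -[].
have sT : size (enum T) = N.+1 by rewrite -cardE.
have uT := enum_uniq (mem T).
have mT i : (i \in T) = (i \in enum T) by rewrite mem_enum.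
suff : exists G kap, 0 <= G <= N%:R^-1 /\ forall i, i \in enum T ->
    ridge_mean c N.-1 [seq aff p (vtx l) | l <- rem i (enum T)] = kap - aff p (vtx i) * G.
  move=> [G [kap [hG H]]]; exists G, kap; split => // i iT.
  by rewrite ref_mean_ridge ?cF// enum_setD1 H// -mT.
move: (enum T) sT uT {mT} => e se ue; case: hN => NE.
  have k1 : N.-1 = 1%N by rewrite NE.
  have NR : N%:R = 2 :> R by rewrite NE.
  rewrite k1 NR; move: se ue; rewrite [in X in _ = X -> _]NE.
  case: e => [|i0 [|i1 [|i2 [|]]]]//= _; rewrite !inE !negb_or -!andbA.
  move=> /and4P[n01 n02 n12 _].
  have [G [hG H1 H2]] := ridge_slope2 c (aff p (vtx i0)) (aff p (vtx i1)) (aff p (vtx i2)).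
  (* The intercept is fixed by the face opposite to [i0]; the differences in [ridge_slope2] then
     give the other faces. *)
  exists G, (ridge_mean c 1 [:: aff p (vtx i1); aff p (vtx i2)] + aff p (vtx i0) * G).
  split=> // i; rewrite !inE => /or3P[] /eqP ->.
  - by rewrite eqxx addrK.
  - by rewrite (negPf n01) eqxx/=; move: H1; lra.
  - by rewrite (negPf n02) (negPf n12) eqxx/=; move: H2; lra.
have k2 : N.-1 = 2%N by rewrite NE.
have NR : N%:R = 3 :> R by rewrite NE.
rewrite k2 NR; move: se ue; rewrite [in X in _ = X -> _]NE.
case: e => [|i0 [|i1 [|i2 [|i3 [|]]]]]//= _; rewrite !inE !negb_or -!andbA.
move=> /and5P[n01 n02 n03 n12 /and3P[n13 n23 _]].
have [G [hG H1 H2 H3]] := ridge_slope3 c (aff p (vtx i0)) (aff p (vtx i1)) (aff p (vtx i2)) (aff p (vtx i3)).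
exists G, (ridge_mean c 2 [:: aff p (vtx i1); aff p (vtx i2); aff p (vtx i3)] + aff p (vtx i0) * G).
split=> // i; rewrite !inE => /or4P[] /eqP ->.
- by rewrite eqxx addrK.
- by rewrite (negPf n01) eqxx/=; move: H1; lra.
- by rewrite (negPf n02) (negPf n12) eqxx/=; move: H2; lra.
- by rewrite (negPf n03) (negPf n13) (negPf n23) eqxx/=; move: H3; lra.
Qed.

End face_means.

(** * The local immersed spaces *)

Section ife_local.
Context {R : realType} {N : nat} (P : interface_problem R N) (M : mesh R N).
Context (D : discrete_interface M) (K : constants R).
Local Notation simplex := {set 'I_(nv M)}.
Implicit Types (T F : simplex) (x y g : 'rV[R]_N) (s : bool).
Hypotheses (hN : N = 2%N \/ N = 3%N) (hO : convex_polytope_domain (Omega P))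
  (htri : triangulation P M) (hok : discrete_interface_ok P D K)
  (hmin : 0 < coef_min K)
  (hin : forall T, T \in Gcells P M -> csimplex T `<=` Omega P).
Let N0 : (0 < N)%N. Proof. by case: hN => ->. Qed.
Let dimE : N.-1.+1 = N. Proof. by case: hN => ->. Qed.

Lemma Gcells_cells T : T \in Gcells P M -> T \in cells M.
Proof. by rewrite inE => /andP[]. Qed.

(** Inside the open cell the two sides fill the two open half-spaces, and [Omega P] is the disjoint
    union of the sides and [Gammah]; this leaves exactly the hyperplane for [Gammah]. *)
Lemma Gcell_hyperplane T : T \in Gcells P M ->
  [/\ enorm (nh D T) = 1,
      exists2 x, osimplex T x & dot (nh D T) x = ch D T,
      forall x, osimplex T x -> Omegah D true x -> ch D T < dot (nh D T) x,
      forall x, osimplex T x -> Omegah D false x -> dot (nh D T) x < ch D T &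
      forall x, osimplex T x -> (Gammah D x <-> dot (nh D T) x = ch D T)].
Proof.
move=> TG; have TM := Gcells_cells TG.
case: hok => -[oh OE [d1 d2 d3] GE _] [_ /(_ T TG)[n1 [z [Gz zT]] Ht Hf] _] _ _.
have ht x : osimplex T x -> Omegah D true x -> ch D T < dot (nh D T) x.
  by move=> xT xh; have : (Omegah D true `&` osimplex T) x by []; rewrite Ht => -[].
have hf x : osimplex T x -> Omegah D false x -> dot (nh D T) x < ch D T.
  by move=> xT xh; have : (Omegah D false `&` osimplex T) x by []; rewrite Hf => -[].
have hG x : osimplex T x -> (Gammah D x <-> dot (nh D T) x = ch D T).
  move=> xT; split => [Gx|xE].
    case: (ltgtP (dot (nh D T) x) (ch D T)) => // lt.
      have : (Omegah D false `&` osimplex T) x by rewrite Hf.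
      by move=> [xh _]; have : (Omegah D false `&` Gammah D) x by []; rewrite d3.
    have : (Omegah D true `&` osimplex T) x by rewrite Ht.
    by move=> [xh _]; have : (Omegah D true `&` Gammah D) x by []; rewrite d2.
  have : Omega P x by exact: (osimplex_Omega hO htri TM).
  rewrite OE => -[[/(ht _ xT)|/(hf _ xT)]|//]; by rewrite xE ltxx.
split=> //; exists z => //; exact/hG.
Qed.

(** On an interface cell the two conditions across [hyperplane D T] say that a
    function of [local_space] with gradient [g] on the negative side has gradient
    [g + (kap T * dot g n) *: n] on the positive side, with [n = nh D T]. *)
Definition kap T : R :=
  if T \in Gcells P M then betaT D T false / betaT D T true - 1 else 0.

(** The maximum with 1 makes the same bounds hold on uncut cells, where [kap] is 0. *)
Definition contrast : R := Num.max 1 (coef_max K / coef_min K).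

Definition ext T s g : 'rV[R]_N :=
  if s then g + (kap T * dot g (nh D T)) *: nh D T else g.

Lemma contrast_ge1 : 1 <= contrast.
Proof. by rewrite le_max lexx. Qed.

Lemma contrast_gt0 : 0 < contrast.
Proof. exact: lt_le_trans ltr01 contrast_ge1. Qed.

Lemma kap_bounds T : contrast^-1 <= 1 + kap T <= contrast.
Proof.
rewrite /kap; case: ifPn => [TG|_]; last first.
  by rewrite addr0 contrast_ge1 invf_le1 ?contrast_ge1// contrast_gt0.
case: hok => _ _ _ H; have [/andP[a1 a2] _] := H T true TG.
have [/andP[b1 b2] _] := H T false TG.
have a0 : 0 < betaT D T true := lt_le_trans hmin a1.
have b0 : 0 < betaT D T false := lt_le_trans hmin b1.
have c1 : coef_max K / coef_min K <= contrast by rewrite le_max lexx orbT.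
rewrite addrC subrK; apply/andP; split; last first.
  apply: le_trans c1; rewrite ler_pM ?invr_ge0 ?(ltW b0) ?(ltW a0)//.
  by rewrite lef_pV2 ?posrE.
rewrite -[leRHS]invrK lef_pV2 ?posrE ?contrast_gt0 ?invr_gt0 ?divr_gt0// invf_div.
apply: le_trans c1; rewrite ler_pM ?invr_ge0 ?(ltW b0) ?(ltW a0)//.
by rewrite lef_pV2 ?posrE.
Qed.

Lemma extD T s g g' : ext T s (g + g') = ext T s g + ext T s g'.
Proof.
rewrite /ext; case: s => //; rewrite dotDl mulrDr scalerDl; exact: addrACA.
Qed.

Lemma extZ T s a g : ext T s (a *: g) = a *: ext T s g.
Proof.
by rewrite /ext; case: s => //; rewrite dotZl scalerDr scalerA mulrCA.
Qed.

(** On the positive side [ext] keeps the part of [g] tangential to the hyperplane and multiplies the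
    normal part by [1 + kap T]. *)
Lemma ext_bounds T s g :
  (contrast^-1) ^+ 2 * dot g g <= dot (ext T s g) (ext T s g) <= contrast ^+ 2 * dot g g.
Proof.
have /andP[k1 k2] := kap_bounds T.
have c0 := contrast_gt0; have c1 := contrast_ge1.
have ci0 : 0 < contrast^-1 by rewrite invr_gt0.
have ci1 : contrast^-1 <= 1 by rewrite invf_le1.
have gg := dot_ge0 g.
have triv : contrast^-1 ^+ 2 * dot g g <= dot g g <= contrast ^+ 2 * dot g g.
  by rewrite ler_piMl ?exprn_ile1 ?(ltW ci0)//= ler_peMl// exprn_ege1.
rewrite /ext; case: s => //.
have [TG|TG] := boolP (T \in Gcells P M); last first.
  by rewrite /kap (negPf TG) mul0r scale0r addr0.
have [n1 _ _ _ _] := Gcell_hyperplane TG.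
have nn : dot (nh D T) (nh D T) = 1 by rewrite -enorm_sqr n1 expr1n.
have dd := dot_sqr_le g (nh D T); rewrite nn mulr1 in dd.
rewrite dotDl !dotDr !dotZl !dotZr nn (dotC (nh D T) g) mulr1.
move: (kap T) (dot g (nh D T)) (dot g g) contrast (contrast^-1) k1 k2 c0 c1 ci0 ci1 gg dd.
move=> k d G c ci k1 k2 c0 c1 ci0 ci1 gg dd {triv}.
have -> : G + k * d * d + (k * d * d + k * d * (k * d)) = (G - d ^+ 2) + (1 + k) ^+ 2 * d ^+ 2.
  by ring.
have s1 : ci ^+ 2 <= (1 + k) ^+ 2 by rewrite ler_sqr ?nnegrE//; lra.
have s2 : (1 + k) ^+ 2 <= c ^+ 2 by rewrite ler_sqr ?nnegrE//; lra.
have s3 : ci ^+ 2 <= 1 by rewrite exprn_ile1// ltW.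
have s4 : 1 <= c ^+ 2 by rewrite exprn_ege1.
have d2 := sqr_ge0 d.
move: (ci ^+ 2) (c ^+ 2) ((1 + k) ^+ 2) (d ^+ 2) s1 s2 s3 s4 d2 dd => a b e f *.
by apply/andP; split; nra.
Qed.

(** The two pieces agree on the hyperplane around a point of the open cell, so the jump [G] of the
    gradient vanishes in tangential directions; the flux condition then determines its normal
    component. *)
Lemma local_spaceE T p : T \in cells M -> local_space P D T p ->
  (forall s, (p s).1 = ext T s (p false).1) /\
  forall x, aff (p true) x = aff (p false) x +
    kap T * dot (p false).1 (nh D T) * (dot (nh D T) x - ch D T).
Proof.
move=> TM; rewrite /local_space /ext /kap; case: ifPn => TG; last first.
  move=> pE; split => [s|x]; last by rewrite !mul0r addr0 pE.
  by case: s; rewrite // mul0r scale0r addr0 pE.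
move=> [p1 p2]; have [n1 [z zT zc] _ _ hG] := Gcell_hyperplane TG.
set n := nh D T in n1 zc hG p2 *; set c := ch D T in zc hG *.
have nn : dot n n = 1 by rewrite -enorm_sqr n1 expr1n.
pose G := (p true).1 - (p false).1.
have affG x y : aff (p true) x - aff (p false) x = aff (p true) y - aff (p false) y + dot G (x - y).
  by rewrite /G dotBl -!affB; ring.
have eqG x : osimplex T x -> dot n x = c -> aff (p true) x = aff (p false) x.
  by move=> xT xc; apply: p1; split => //; exact/hG.
have tang xi : dot n xi = 0 -> dot G xi = 0.
  move=> nxi; have oT := osimplex_open (cell_full htri TM).
  have : \forall s \near (0 : R)^'+, dot G xi = 0.
    near=> s.
    have s0 : 0 < s by near: s; exact: nbhs_right_gt.
    have sT : osimplex T (z + s *: xi) by near: s; exact: near_ray.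
    have := affG (z + s *: xi) z.
    rewrite (eqG _ sT); last by rewrite dotDr dotZr nxi mulr0 addr0.
    rewrite (eqG _ zT zc) !subrr add0r addrC addKr dotZr => /eqP.
    by rewrite eq_sym mulf_eq0 gt_eqF//= => /eqP.
  by move/filter_ex => [].
have GE : G = dot G n *: n.
  apply/eqP; rewrite -subr_eq0 -dot_eq0.
  have xn : dot n (G - dot G n *: n) = 0 by rewrite dotBr dotZr nn mulr1 (dotC n G) subrr.
  by rewrite {1}dotBl dotZl (tang _ xn) xn mulr0 subrr.
case: hok => _ _ _ H; have [/andP[a1 _] _] := H T true TG.
have a0 : betaT D T true != 0 by rewrite gt_eqF// (lt_le_trans hmin a1).
have GnE : dot G n = (betaT D T false / betaT D T true - 1) * dot (p false).1 n.
  rewrite /G dotBl; apply: (mulfI a0); rewrite mulrBr p2.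
  by field.
have pE : (p true).1 = (p false).1 + dot G n *: n by rewrite -GE /G addrC subrK.
split=> [[]//|x]; first by rewrite -GnE.
rewrite -GnE; have := affG x z; rewrite (eqG _ zT zc) subrr add0r {1}GE dotZl dotBr zc => <-.
by rewrite addrC subrK.
Unshelve. all: by end_near. Qed.

Lemma ext_local_space T g : T \in cells M ->
  local_space P D T (fun s => (ext T s g, if s then - (kap T * dot g (nh D T) * ch D T) else 0)).
Proof.
move=> TM; rewrite /local_space /immersed /ext /kap.
case: (boolP (T \in Gcells P M)) => TG; last first.
  by rewrite /= !mul0r scale0r addr0 oppr0.
have [n1 _ _ _ hG] := Gcell_hyperplane TG.
have nn : dot (nh D T) (nh D T) = 1 by rewrite -enorm_sqr n1 expr1n.
split => [x [Gx xT]|].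
  by rewrite /aff/= dotDl dotZl (hG x xT).1// addr0 addrK.
case: hok => _ _ _ H; have [/andP[a1 _] _] := H T true TG.
have a0 : betaT D T true != 0 by rewrite gt_eqF// (lt_le_trans hmin a1).
by rewrite /= dotDl dotZl nn mulr1; field.
Qed.

Lemma Gcell_closed T x : T \in Gcells P M -> closure (Gammah D `&` osimplex T) x ->
  csimplex T x /\ dot (nh D T) x = ch D T.
Proof.
move=> TG; have fT := cell_full htri (Gcells_cells TG).
have [_ _ _ _ hG] := Gcell_hyperplane TG.
have cl : closed (csimplex T `&` [set y | dot (nh D T) y = ch D T]).
  by apply: closedI; [exact: csimplex_closed|exact: closed_hyperplane].
move=> cx; suff : (csimplex T `&` [set y | dot (nh D T) y = ch D T]) x by [].
rewrite ((closure_id _).1 cl); move: x cx; apply: closureS => y [Gy yT].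
by split; [exact: osimplex_csimplex|exact/hG].
Qed.

(** The hyperplane describes the sides in the open cell only. From [x] a segment towards an interior
    point of [T] enters the cell at once, while openness of the sides keeps it on the side of [x].
    The last hypothesis keeps [x] off [Gammah], and [hin] puts it in [Omega P], so [x] is on one of
    the sides. *)
Lemma side_face T F x : T \in Gcells P M -> F \in faces M -> F \subset T ->
  osimplex F x ->
  (forall T', T' \in Gcells P M -> F \subset T' -> dot (nh D T') x <> ch D T') ->
  if side D x then ch D T <= dot (nh D T) x else dot (nh D T) x <= ch D T.
Proof.
move=> TG FM FT xF xZ; have TM := Gcells_cells TG; have fT := cell_full htri TM.
have [n1 _ ht hf hG] := Gcell_hyperplane TG.
have xT : csimplex T x := sub_osimplex_csimplex htri TM FT xF.
case: (hok) => -[oh OE _ _ _] [GE _ _] _ _.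
have [b bT] := osimplex_nonempty (card_cell_gt0 fT).
have near_cell (U : set 'rV[R]_N) : open U -> U x ->
    \forall s \near (0 : R)^'+, U (x + s *: (b - x)) /\ osimplex T (x + s *: (b - x)).
  move=> oU Ux; near=> s.
  have s0 : 0 < s by near: s; exact: nbhs_right_gt.
  have s1 : s < 1 by near: s; exact: nbhs_right_lt.
  split; first by near: s; exact: near_ray.
  have -> : x + s *: (b - x) = b + (1 - s) *: (x - b).
    by apply/rowP => j; rewrite !mxE; ring.
  by apply: (osimplex_seg fT (subxx _) bT xT); rewrite subr_ge0 ltW//= ltrBlDr ltrDl.
rewrite /side; case: asboolP => xh; rewrite leNgt; apply/negP => xc.
  have oc : open [set y | dot (nh D T) y < ch D T].
    by apply: (@open_comp _ _ (dot (nh D T)) [set t | t < ch D T]) => [y _|];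
      [exact: dot_continuous|exact: open_lt].
  have /filter_ex[s [[xh' xc'] xT']] := near_cell _ (openI (oh true) oc) (conj xh xc).
  by have := ht _ xT' xh'; rewrite ltNge (ltW xc').
have oc : open [set y | ch D T < dot (nh D T) y].
  by apply: (@open_comp _ _ (dot (nh D T)) [set t | ch D T < t]) => [y _|];
    [exact: dot_continuous|exact: open_gt].
have : Omega P x by apply: (hin TG).
rewrite OE => -[[//|xf]|].
  have /filter_ex[s [[xf' xc'] xT']] := near_cell _ (openI (oh false) oc) (conj xf xc).
  by have := hf _ xT' xf'; rewrite ltNge (ltW xc').
rewrite GE => -[T' TG' /(Gcell_closed TG')[xT' xE]].
exact: (xZ T' TG' (osimplex_sub_cell htri TM (Gcells_cells TG') FT xF xT') xE).
Unshelve. all: by end_near. Qed.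

(** In the parameters this is an affine equation. If its linear part vanishes the set is empty: a
    hyperplane containing [F] and a point of the open cell [T] would contain the opposite vertex,
    hence everything, against the unit normal. *)
Lemma interface_trace_null T F : T \in Gcells P M -> F \in faces M -> F \subset T ->
  vnull [set t : 'rV[R]_N.-1 | dot (nh D T) (face_map F t) = ch D T].
Proof.
move=> TG FM FT; have TM := Gcells_cells TG; have fT := cell_full htri TM.
have [n1 [z zT zc] _ _ _] := Gcell_hyperplane TG.
pose p : affine := (nh D T, 0 : R).
have pE y : dot (nh D T) y = aff p y by rewrite /aff addr0.
pose b : 'rV[R]_N.-1 := \row_i (aff p (face_vtx F)`_i.+1 - aff p (face_vtx F)`_0).
have mapE t : dot (nh D T) (face_map F t) = aff p (face_vtx F)`_0 + dot b t.
  rewrite pE aff_face_map; congr (_ + _); apply: eq_bigr => i _.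
  by rewrite /b mxE mulrC.
have [b0|b0] := eqVneq b 0; last first.
  rewrite (_ : [set t | _] = [set t | dot b t = ch D T - aff p (face_vtx F)`_0]).
    exact: vnull_hyperplane.
  apply/seteqP; split => t /=; rewrite mapE => H; first by rewrite -H addrC addKr.
  by rewrite H addrC subrK.
rewrite (_ : [set t | _] = set0); first exact: vnull0.
apply/seteqP; split => // t /=; rewrite mapE b0 dot0l addr0 => s0c.
have cF : #|F| = N.-1.+1 by rewrite dimE (card_face FM).
have [i [iT iF TE]] := opposite_vertex htri TM FM FT.
have vF k : k \in F -> aff p (vtx k) = ch D T.
  move=> kF; have [d dF] : exists d, d \in F by exists k.
  have sE : size (enum F) = N.-1.+1 by rewrite -cardE.
  have kE : (index k (enum F) < N.-1.+1)%N by rewrite -sE index_mem mem_enum.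
  have : (face_vtx F)`_(index k (enum F)) = vtx k.
    by rewrite (nth_map k) ?sE// nth_index// mem_enum.
  case: (index k _) kE => [|l] lk <-; first exact: s0c.
  have /rowP/(_ (Ordinal (lk : (l < N.-1)%N))) := b0; rewrite !mxE => /eqP.
  by rewrite subr_eq0 => /eqP ->.
have viE : aff p (vtx i) = ch D T.
  move: zc; rewrite pE (aff_bary fT) => zc.
  have zi : 0 < bc T i z.
    by have /(osimplexE fT _ (subxx _))[z1 _] := zT; exact: z1.
  apply: (mulfI (lt0r_neq0 zi)); apply/eqP; rewrite -subr_eq0 -mulrBr; apply/eqP.
  have : \sum_j bc T j z * (aff p (vtx j) - ch D T) = 0.
    under eq_bigr do rewrite mulrBr.
    by rewrite sumrB zc -mulr_suml (bc_sum fT) mul1r subrr.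
  rewrite (bigD1 i)//= big1 ?addr0// => j ji.
  have [jT|jT] := boolP (j \in T); last by rewrite bc_out// mul0r.
  have : j \in (i |: F)%SET by rewrite -TE.
  by rewrite in_setU1 (negPf ji)/= => /vF ->; rewrite subrr mulr0.
have all_c y : dot (nh D T) y = ch D T.
  rewrite pE (aff_bary fT) (eq_bigr (fun j => bc T j y * ch D T)).
    by rewrite -mulr_suml (bc_sum fT) mul1r.
  move=> j _; have [jT|jT] := boolP (j \in T); last by rewrite bc_out// !mul0r.
  have : j \in (i |: F)%SET by rewrite -TE.
  by rewrite in_setU1 => /predU1P[->|/vF ->]; rewrite ?viE.
have c0 := all_c 0; have := all_c (nh D T).
by rewrite -c0 dot0r -enorm_sqr n1 expr1n => /eqP; rewrite oner_eq0.
Qed.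

(** Off this null set of parameters, the sign used by [side] on the face [F] is
    the sign of the affine equation of the hyperplane of each interface cell
    containing [F] (see [side_face]); the traces are then continuous
    piecewise affine. *)
Definition bad_params F : set 'rV[R]_N.-1 :=
  [set t : 'rV[R]_N.-1 | exists i, t 0 i = 0] `|`
  [set t : 'rV[R]_N.-1 | \sum_i t 0 i = 1] `|`
  [set t : 'rV[R]_N.-1 | exists T', [/\ T' \in Gcells P M, F \subset T' &
     dot (nh D T') (face_map F t) = ch D T']].

Lemma bad_params_null F : F \in faces M -> vnull (bad_params F).
Proof.
move=> FM; apply: vnullU; first apply: vnullU.
- apply: (@vnull_finite _ _ _ (fun i => [set t : 'rV[R]_N.-1 | t 0 i = 0])) => i.
  rewrite (_ : [set t | _] = [set t | dot (delta_mx 0 i) t = 0]).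
    apply: vnull_hyperplane; apply/eqP => /matrixP/(_ 0 i).
    by rewrite !mxE !eqxx => /eqP; rewrite oner_eq0.
  by apply/seteqP; split => t /=; rewrite dotC dot_delta.
- rewrite (_ : [set t | _] = [set t | dot (const_mx 1) t = 1]).
    apply: vnull_hyperplane; apply/eqP => /matrixP.
    have i0 : (0 < N.-1)%N by case: hN => ->.
    by move=> /(_ 0 (Ordinal i0)); rewrite !mxE => /eqP; rewrite oner_eq0.
  have dE (t : 'rV[R]_N.-1) : dot (const_mx 1) t = \sum_i t 0 i.
    by apply: eq_bigr => i _; rewrite mxE mul1r.
  by apply/seteqP; split => t /=; rewrite dE.
- apply: (@vnull_finite _ _ _ (fun T' => [set t : 'rV[R]_N.-1 |
    [/\ T' \in Gcells P M, F \subset T' & dot (nh D T') (face_map F t) = ch D T']])) => T'.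
  have [/andP[TG FT]|nT] := boolP ((T' \in Gcells P M) && (F \subset T')); last first.
    rewrite (_ : [set t | _] = set0); first exact: vnull0.
    by apply/seteqP; split => // t [TG FT _]; rewrite TG FT in nT.
  rewrite (_ : [set t | _] = [set t | dot (nh D T') (face_map F t) = ch D T']).
    exact: interface_trace_null.
  by apply/seteqP; split => t /= => [[]|].
Qed.

Lemma good_param F t : F \in faces M -> ref_simplex t -> ~ bad_params F t ->
  osimplex F (face_map F t) /\
  forall T', T' \in Gcells P M -> F \subset T' -> dot (nh D T') (face_map F t) <> ch D T'.
Proof.
move=> FM [t0 t1] nb; split; last first.
  by move=> T' TG FT xE; apply: nb; right; exists T'.
apply: face_map_osimplex; first by rewrite dimE (card_face FM).
  by move=> i; rewrite lt_neqAle t0 andbT eq_sym; apply/eqP => ti; apply: nb; left; left; exists i.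
by rewrite lt_neqAle t1 andbT; apply/eqP => ti; apply: nb; left; right.
Qed.

(** The correction of the positive piece is proportional to the height over the hyperplane, which
    has the sign prescribed by [side] off the bad parameters; the positive part therefore selects
    the right piece. *)
Lemma ref_mean_value T F p : T \in cells M -> F \in faces M -> F \subset T ->
  local_space P D T p ->
  ref_mean F (fun x => aff (p (side D x)) x) =
  ref_mean F (fun x => aff (p false) x + kap T * dot (p false).1 (nh D T) *
    pos_part (ch D T) (aff (nh D T, 0) x)).
Proof.
move=> TM FM FT pT; have [_ pE] := local_spaceE TM pT.
apply: (ref_mean_ae (bad_params_null FM)) => t rt nb.
have [xF xZ] := good_param FM rt nb; set x := face_map F t in xF xZ *.
have [TG|TG] := boolP (T \in Gcells P M); last first.
  rewrite /kap (negPf TG) !mul0r addr0; move: pT; rewrite /local_space (negPf TG) => pT.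
  by case: (side D x); rewrite ?pT.
have qE : aff (nh D T, 0) x = dot (nh D T) x by rewrite /aff addr0.
have := side_face TG FM FT xF xZ; rewrite /pos_part qE.
case: (side D x) => xc; first by rewrite pE max_l// subr_ge0.
by rewrite max_r ?mulr0 ?addr0// subr_le0.
Qed.

(** The factor 4 is 2 from [gradient_le] times 2 from a difference of two face means; the rest is
    the cost of inverting the rank one perturbation. *)
Definition stab : R := 4 * N%:R * (1 + contrast * contrast).

Lemma local_stability rho T p m : T \in cells M -> hT T <= rho * rT T ->
  local_space P D T p ->
  (forall F, F \in faces M -> F \subset T ->
     `|face_mean F (fun x => aff (p (side D x)) x)| <= m) ->
  enorm (p false).1 * hT T <= rho * stab * m.
Proof.
move=> TM hr pT hm; have fT := cell_full htri TM; have [cT _] := fT.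
have [rho0 _] := inscribed_ball fT N0 hr.
set g := (p false).1; set n := nh D T; set al := kap T * dot g n.
pose q : affine := (n, 0 : R).
have [G [kp [/andP[G0 G1] slope]]] := slope_faces hN (ch D T) q cT.
have NR : 0 < N%:R :> R by rewrite ltr0n.
have faceT i : i \in T -> (T :\ i)%SET \in faces M /\ #|(T :\ i)%SET| = N.
  move=> iT; have cF : #|(T :\ i)%SET| = N by have := cardsD1 i T; rewrite iT cT add1n => -[].
  by split=> //; rewrite inE cF eqxx; apply/existsP; exists T; rewrite TM subD1set.
pose S := \sum_(l in T) aff (p false) (vtx l).
have meanE i : i \in T -> `|(S - aff (p false) (vtx i)) / N%:R + al * (kp - aff q (vtx i) * G)| <= m.
  move=> iT; have [FM cF] := faceT i iT; have FT : (T :\ i)%SET \subset T by rewrite subD1set.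
  have := hm _ FM FT; rewrite (face_mean_refE hN _ fT FT cF) (ref_mean_value TM FM FT pT).
  rewrite ref_meanD// ref_mean_aff// slope// -/al.
  by rewrite /S (big_setD1 i iT)/= [X in (X - _) / _]addrC addrK.
(* Up to a constant, the mean over the face opposite to [i] is [- dot gh (vtx i)]. Differences of
   face means thus control [gh], and [g] has to be recovered from it. *)
pose gh := N%:R^-1 *: g + (al * G) *: n.
have ghv i j : i \in T -> j \in T -> dot gh (vtx i - vtx j) <= 2 * m.
  move=> iT jT.
  have -> : dot gh (vtx i - vtx j) =
    ((S - aff (p false) (vtx j)) / N%:R + al * (kp - aff q (vtx j) * G)) -
    ((S - aff (p false) (vtx i)) / N%:R + al * (kp - aff q (vtx i) * G)).
    rewrite /gh dotDl !dotZl -[dot g _](affB (p false)).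
    rewrite (_ : dot n (vtx i - vtx j) = aff q (vtx i) - aff q (vtx j)); last by rewrite affB.
    by field; rewrite gt_eqF.
  have := meanE i iT; have := meanE j jT; rewrite !ler_norml => /andP[_ h1] /andP[h2 _].
  by lra.
have gh_le := gradient_le fT N0 hr ghv.
have c0 := contrast_gt0; have c1 := contrast_ge1.
have /andP[k1 k2] := kap_bounds T.
suff gA : enorm g <= N%:R * (1 + contrast * contrast) * enorm gh.
  apply: (@le_trans _ _ (N%:R * (1 + contrast * contrast) * (enorm gh * hT T))).
    by rewrite mulrA ler_wpM2r// hT_ge0.
  have NC : 0 <= N%:R * (1 + contrast * contrast).
    by rewrite mulr_ge0 ?(ltW NR)// addr_ge0// mulr_ge0// ltW.
  apply: (le_trans (ler_wpM2l NC gh_le)); rewrite /stab.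
  by rewrite le_eqVlt; apply/orP; left; apply/eqP; ring.
have gE : g = N%:R *: gh - (N%:R * (al * G)) *: n.
  by rewrite /gh scalerDr !scalerA mulfV ?gt_eqF// scale1r addrK.
have [TG|TG] := boolP (T \in Gcells P M); last first.
  have al0 : al = 0 by rewrite /al /kap (negPf TG) mul0r.
  rewrite gE al0 mul0r mulr0 scale0r subr0 enormZ ger0_norm ?(ltW NR)//.
  rewrite ler_wpM2r ?enorm_ge0// ler_peMr ?(ltW NR)//.
  by rewrite lerDl mulr_ge0 ?ltW.
have [n1 _ _ _ _] := Gcell_hyperplane TG; rewrite -/n in n1.
have nn : dot n n = 1 by rewrite -enorm_sqr n1 expr1n.
have ghn : dot gh n = dot g n * (N%:R^-1 + kap T * G).
  by rewrite /gh dotDl !dotZl nn /al; ring.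
have Ni : 0 < N%:R^-1 :> R by rewrite invr_gt0.
(* The estimate uniform in the cut. For [kap T >= 0] the left summand suffices; for [kap T < 0] the
   bound [G <= N%:R^-1] reduces it to [1 + kap T >= contrast^-1]. *)
have kG : N%:R^-1 * contrast^-1 <= N%:R^-1 + kap T * G.
  have ci0 : 0 < contrast^-1 by rewrite invr_gt0.
  have ci1 : contrast^-1 <= 1 by rewrite invf_le1.
  move: (kap T) (contrast^-1) (N%:R^-1) k1 ci0 ci1 Ni G1 => k ci ni k1' ci0 ci1 ni0 G1'.
  have [k0|k0] := leP 0 k.
    have : ni * ci <= ni by rewrite ler_piMr// ltW.
    by have := mulr_ge0 k0 G0; lra.
  have : ni * ci <= ni * (1 + k) by rewrite ler_wpM2l// ltW.
  have : k * ni <= k * G by rewrite ler_wnM2l// ltW.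
  by lra.
have gn : `|dot g n| * (N%:R^-1 * contrast^-1) <= enorm gh.
  have kG0 : 0 <= N%:R^-1 + kap T * G.
    by apply: le_trans kG; rewrite mulr_ge0 ?(ltW Ni)// invr_ge0 ltW.
  apply: (@le_trans _ _ `|dot gh n|).
    by rewrite ghn normrM (ger0_norm kG0) ler_wpM2l.
  by apply: (le_trans (dot_le _ _)); rewrite n1 mulr1.
have gn' : `|dot g n| <= N%:R * contrast * enorm gh.
  have := ler_wpM2l (mulr_ge0 (ltW NR) (ltW c0)) gn.
  rewrite (_ : N%:R * contrast * (`|dot g n| * (N%:R^-1 * contrast^-1)) = `|dot g n|)//.
  by field; rewrite !gt_eqF.
have alG : `|N%:R * (al * G)| <= contrast * `|dot g n|.
  rewrite /al (_ : N%:R * (kap T * dot g n * G) = kap T * (N%:R * G) * dot g n); last by ring.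
  rewrite normrM ler_wpM2r// normrM.
  have kC : `|kap T| <= contrast.
    have ci0 : 0 < contrast^-1 by rewrite invr_gt0.
    by rewrite ler_norml; apply/andP; split; lra.
  have NG : `|N%:R * G| <= 1.
    rewrite ger0_norm ?mulr_ge0 ?(ltW NR)//.
    by have := ler_wpM2l (ltW NR) G1; rewrite mulfV// gt_eqF.
  by rewrite -[leRHS]mulr1 ler_pM.
rewrite gE (le_trans (enormD _ _))// enormN !enormZ n1 mulr1 ger0_norm ?(ltW NR)//.
have : contrast * `|dot g n| <= contrast * (N%:R * contrast * enorm gh) by rewrite ler_wpM2l// ltW.
by move: alG; set a := `|_|; set b := contrast * `|_|; lra.
Qed.

Lemma ref_mean_close F f c d Z : vnull Z ->
  mbounded (@ref_simplex R N.-1) (fun t => f (face_map F t)) ->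
  (forall t : 'rV[R]_N.-1, ref_simplex t -> ~ Z t -> `|f (face_map F t) - c| <= d) ->
  `|ref_mean F f - c| <= d.
Proof.
move=> [mZ Z0] bf fc.
have hk : N.-1 = 1%N \/ N.-1 = 2%N by case: hN => ->; [left|right].
have v0 := vol_ref_simplex_gt0 (R := R) hk.
have mr := @vmeas_ref_simplex R N.-1; have br := @ebounded_ref_simplex R N.-1.
have mD := vmeasD mr mZ; have bD : ebounded (@ref_simplex R N.-1 `\` Z).
  by case: br => B BM; exists B => x [/BM].
have bf' := mboundedS mr (@subDsetl _ _ Z) bf.
have vE : vol (@ref_simplex R N.-1 `\` Z) = vol (@ref_simplex R N.-1).
  by rewrite -[LHS]mul1r -vol_integral_cst// -(vol_integral_null _ _ mZ Z0) vol_integral_cst// mul1r.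
rewrite /ref_mean (vol_integral_null _ _ mZ Z0) ler_distl ler_pdivlMr// ler_pdivrMr// -vE.
by apply/andP; split; [apply: vol_integral_ge|apply: vol_integral_le] => // t [rt Zt];
  have := fc t rt Zt; rewrite ler_distl => /andP[].
Qed.

Lemma interface_height T x : T \in Gcells P M -> csimplex T x ->
  `|dot (nh D T) x - ch D T| <= hT T.
Proof.
move=> TG xT; have fT := cell_full htri (Gcells_cells TG).
have [n1 [z zT <-] _ _ _] := Gcell_hyperplane TG.
rewrite -dotBr (le_trans (dot_le _ _))// n1 mul1r.
by apply: (csimplex_dist fT) => //; exact: osimplex_csimplex.
Qed.

Lemma side_correction T g x : csimplex T x -> 0 <= hT T ->
  `|kap T * dot g (nh D T) * (dot (nh D T) x - ch D T)| <= contrast * (enorm g * hT T).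
Proof.
move=> xT h0; have c1 := contrast_ge1.
have [TG|TG] := boolP (T \in Gcells P M); last first.
  rewrite /kap (negPf TG) !mul0r normr0 mulr_ge0 ?mulr_ge0 ?enorm_ge0//.
  exact: le_trans ler01 c1.
have [n1 _ _ _ _] := Gcell_hyperplane TG.
have kC : `|kap T| <= contrast.
  have /andP[k1 k2] := kap_bounds T.
  have ci0 : 0 < contrast^-1 by rewrite invr_gt0 contrast_gt0.
  by rewrite ler_norml; apply/andP; split; lra.
rewrite -mulrA normrM ler_pM// normrM ler_pM//; last exact: interface_height.
by have := dot_le g (nh D T); rewrite n1 mulr1.
Qed.

Lemma mean_close T F p y : T \in cells M -> F \in faces M -> F \subset T ->
  local_space P D T p -> csimplex T y ->
  `|face_mean F (fun x => aff (p (side D x)) x) - aff (p false) y| <=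
    (1 + contrast) * (enorm (p false).1 * hT T).
Proof.
move=> TM FM FT pT yT; have fT := cell_full htri TM.
rewrite (face_mean_refE hN _ fT FT (card_face FM)) (ref_mean_value TM FM FT pT).
have h0 := hT_ge0 fT.
apply: (ref_mean_close (bad_params_null FM)).
  have m1 (r : affine) psi : continuous psi ->
      mbounded (@ref_simplex R N.-1) (fun t => psi (aff r (face_map F t))).
    move=> cpsi.
    have := mbounded_ridge (aff r (face_vtx F)`_0) (\row_(i < N.-1) aff r (face_vtx F)`_i.+1) cpsi.
    by congr mbounded; apply/funext => t; rewrite -aff_face_ridge.
  apply: mboundedD; first by apply: (@m1 _ id) => x; exact: cvg_id.
  by apply: mboundedZ; apply: m1; exact: continuous_pos_part.
move=> t rt nb; have [xF xZ] := good_param FM rt nb; set x := face_map F t in xF xZ *.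
have xT : csimplex T x := sub_osimplex_csimplex htri TM FT xF.
rewrite addrAC affB mulrDl mul1r (le_trans (ler_normD _ _))// lerD//.
  by rewrite (le_trans (dot_le _ _))// ler_wpM2l ?enorm_ge0// (csimplex_dist fT).
apply: le_trans (side_correction (p false).1 xT h0).
rewrite /pos_part (_ : aff (nh D T, 0) x = dot (nh D T) x); last by rewrite /aff addr0.
rewrite normrM [leRHS]normrM ler_wpM2l//.
by have [_|_] := leP (dot (nh D T) x - ch D T) 0; rewrite ?normr0.
Qed.

(** The constant collects [m] for a face mean, [1 + contrast] gradients for the distance of the
    negative piece from that mean, and [contrast] more for passing to the positive piece;
    [local_stability] bounds the gradient. *)
Lemma value_bound rho T p m : T \in cells M -> hT T <= rho * rT T ->
  local_space P D T p ->
  (forall F, F \in faces M -> F \subset T ->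
     `|face_mean F (fun x => aff (p (side D x)) x)| <= m) ->
  forall s y, csimplex T y -> `|aff (p s) y| <= (1 + (1 + 2 * contrast) * (rho * stab)) * m.
Proof.
move=> TM hr pT hm s y yT; have fT := cell_full htri TM; have [cT _] := fT.
have gm := local_stability TM hr pT hm.
have [F [FM FT]] : exists F, F \in faces M /\ F \subset T.
  have /card_gt0P[i iT] : (0 < #|T|)%N by rewrite cT.
  have cF : #|(T :\ i)%SET| = N by have := cardsD1 i T; rewrite iT cT add1n => -[].
  exists (T :\ i)%SET; rewrite subD1set; split => //.
  by rewrite inE cF eqxx; apply/existsP; exists T; rewrite TM subD1set.
have h0 := hT_ge0 fT; have c0 := contrast_gt0.
have H0 : `|aff (p false) y| <= m + (1 + contrast) * (rho * stab * m).
  have /ler_normlP[? ?] := mean_close TM FM FT pT yT.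
  have /ler_normlP[? ?] := hm F FM FT.
  have : (1 + contrast) * (enorm (p false).1 * hT T) <= (1 + contrast) * (rho * stab * m).
    by rewrite ler_wpM2l// addr_ge0// ltW.
  by move=> ?; rewrite ler_norml; apply/andP; split; lra.
have H1 : `|aff (p s) y| <= `|aff (p false) y| + contrast * (rho * stab * m).
  case: s; last by rewrite lerDl mulr_ge0 ?(ltW c0)// (le_trans _ gm)// mulr_ge0// enorm_ge0.
  have [_ ->] := local_spaceE TM pT; rewrite (le_trans (ler_normD _ _))// lerD2l.
  apply: (le_trans (side_correction _ yT h0)).
  by rewrite ler_wpM2l ?(ltW c0).
rewrite (_ : (1 + _) * m = m + (1 + contrast) * (rho * stab * m) + contrast * (rho * stab * m)); last by ring.
by apply: (le_trans H1); rewrite lerD2r.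
Qed.

End ife_local.

(** * A discrete Poincare inequality *)

Section ray_walk.
Context {R : realType} {N : nat} (P : interface_problem R N) (M : mesh R N).
Local Notation simplex := {set 'I_(nv M)}.
Implicit Types (S T F : simplex) (x y : 'rV[R]_N).
Hypotheses (N0 : (0 < N)%N) (hO : convex_polytope_domain (Omega P))
  (htri : triangulation P M).
Variable Dm : R.
Hypothesis HD : forall x, closure (Omega P) x -> enorm x <= Dm.

Let i0 : 'I_N := Ordinal N0.
Let e1 : 'rV[R]_N := delta_mx 0 i0.

Definition ray_cells x : {set simplex} :=
  [set T in cells M | `[< exists s : R, 0 <= s /\ csimplex T (x + s *: e1) >]].

(** The ray from [x] in the direction [e1] avoids all faces of codimension at
    least 2, hence leaves a cell only through the relative interior of a face. *)
Definition generic x := forall S T (s : R), T \in cells M -> S \subset T ->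
  (0 < #|S| < N)%N -> ~ osimplex S (x + s *: e1).

Lemma skeleton_hyperplane S : (0 < #|S| < N)%N ->
  exists ab : 'rV[R]_N * R, [/\ ab.1 != 0, dot ab.1 e1 = 0 &
    forall x, osimplex S x -> dot ab.1 x = ab.2].
Proof.
case/andP => /card_gt0P[i iS] SN.
(* The slot of [i], whose edge vector would be zero, is given to [e1]. Fewer than [N] vectors have a
   common nonzero normal. *)
pose u (k : 'I_#|S|) : 'rV[R]_N := if enum_val k == i then e1 else vtx (enum_val k) - vtx i.
pose Q : 'M[R]_(N, #|S|) := \matrix_(r, k) u k 0 r.
have kQ : kermx Q != 0.
  by rewrite -mxrank_eq0 mxrank_ker subn_eq0 -ltnNge (leq_ltn_trans (rank_leq_col Q)).
pose a : 'rV[R]_N := nz_row (kermx Q).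
have aQ : a *m Q = 0 by apply/sub_kermxP; exact: nz_row_sub.
have au k : dot a (u k) = 0.
  by have /rowP/(_ k) := aQ; rewrite !mxE => <-; apply: eq_bigr => r _; rewrite mxE.
exists (a, dot a (vtx i)); split => /=.
- by rewrite nz_row_eq0.
- by have := au (enum_rank_in iS i); rewrite /u enum_rankK_in// eqxx.
move=> x [w [_ w2 w3 ->]]; rewrite dot_sumr -[RHS]mul1r -w3 mulr_suml.
apply: eq_bigr => j _; rewrite dotZr.
have [jS|/w2 ->] := boolP (j \in S); last by rewrite !mul0r.
have [->//|ji] := eqVneq j i.
have := au (enum_rank_in iS j); rewrite /u enum_rankK_in// (negPf ji) dotBr => /eqP.
by rewrite subr_eq0 => /eqP ->.
Qed.

(** A line parallel to [e1] that meets a low dimensional face lies in a hyperplane parallel to [e1]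
    through it. Finitely many hyperplanes cannot fill a set of positive volume. *)
Lemma generic_point T : T \in cells M -> 0 < vol (osimplex T) ->
  exists x, osimplex T x /\ generic x.
Proof.
move=> TM vT; have fT := cell_full htri TM.
have /choice[ab abP] : forall S, exists ab : 'rV[R]_N * R, ab.1 != 0 /\
    ((0 < #|S| < N)%N -> dot ab.1 e1 = 0 /\ forall x, osimplex S x -> dot ab.1 x = ab.2).
  move=> S; have [/skeleton_hyperplane[ab [? ? ?]]|_] := boolP (0 < #|S| < N)%N.
    by exists ab.
  exists (e1, 0); split=> //; apply/eqP => /matrixP/(_ 0 i0).
  by rewrite !mxE !eqxx => /eqP; rewrite oner_eq0.
have [mZ Z0] : vnull [set x | exists S, dot (ab S).1 x = (ab S).2].
  apply: (@vnull_finite _ _ _ (fun S => [set x | dot (ab S).1 x = (ab S).2])) => S.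
  by apply: vnull_hyperplane; have [] := abP S.
apply: contrapT => H; move: vT; rewrite -[vol _]mul1r -vol_integral_cst; last first.
  by apply: measurable_vec_open; exact: osimplex_open.
rewrite (vol_integral_null _ _ mZ Z0) (_ : _ `\` _ = set0).
  rewrite vol_integral_cst; last by rewrite /vmeas preimage_set0; exact: measurable0.
  by rewrite /vol preimage_set0 measure0 mulr0 ltxx.
apply/seteqP; split => // x [xT nx]; apply: H; exists x; split=> // S T' s _ _ hS xS.
apply: nx; exists S; have [_ /(_ hS)[ae aE]] := abP S.
by have := aE _ xS; rewrite dotDr dotZr ae mulr0 addr0.
Qed.

(** Reachability in this graph replaces an ordered list of the crossings of the ray. *)
Definition adjacent x : rel simplex := fun T T' =>
  [&& T \in ray_cells x, T' \in ray_cells x &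
      [exists F in interior_faces M, (F \subset T) && (F \subset T')]].

Lemma adjacent_ray x T T' : T \in ray_cells x -> connect (adjacent x) T T' ->
  T' \in ray_cells x.
Proof.
move=> Tx /connectP[p + ->]; elim: p T Tx => [|A p IH] T Tx //= /andP[TA pA].
by apply: IH pA; case/and3P: TA.
Qed.

(** Suppose all faces of reachable cells are interior. The last parameter at which the ray is in a
    reachable cell is attained, by finiteness and closedness. There the point is in an open cell or,
    by genericity, in the relative interior of an interior face; either way the ray goes on in a
    reachable cell. *)
Lemma walk_to_boundary x T : generic x -> T \in cells M -> csimplex T x ->
  exists T' F, [/\ connect (adjacent x) T T', F \in faces M, F \subset T' &
    F \notin interior_faces M].
Proof.
move=> gx TM xT; apply: contrapT => H.
have Fint T' F : connect (adjacent x) T T' -> F \in faces M -> F \subset T' ->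
    F \in interior_faces M.
  by move=> cT FM FT; apply: contrapT => /negP nF; apply: H; exists T', F.
have Tx : T \in ray_cells x.
  by rewrite inE TM; apply/asboolP; exists 0; rewrite lexx scale0r addr0.
have cM T' : connect (adjacent x) T T' -> T' \in cells M.
  by move=> /(adjacent_ray Tx); rewrite inE => /andP[].
pose U : set R := [set s | 0 <= s /\ exists T', connect (adjacent x) T T' /\ csimplex T' (x + s *: e1)].
have U0 : U 0 by split => //; exists T; rewrite connect0 scale0r addr0.
have bU : has_ubound U.
  exists (Dm - x 0 i0) => s [s0 [T' [cT xT']]]; rewrite lerBrDl.
  apply: (le_trans _ (HD (csimplex_closure htri (cM _ cT) xT'))).
  apply: le_trans (coord_le_enorm _ i0); rewrite !mxE !eqxx mulr1; exact: ler_norm.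
set s1 := sup U.
have s10 : 0 <= s1 by exact: ub_le_sup.
have [_ [T' [cT xT']]] : U s1.
  apply: contrapT => nU.
  have clU : closure U s1 by apply: closure_sup => //; exists 0.
  have : \forall s \near s1, forall A, ~ (connect (adjacent x) T A /\ csimplex A (x + s *: e1)).
    apply: (@filter_forall _ _ (fun A => [set s | ~ (connect (adjacent x) T A /\ csimplex A (x + s *: e1))]) (nbhs s1) (nbhs_filter s1)) => A.
    have [cA|ncA] := pselect (connect (adjacent x) T A); last first.
      by apply: (@nearW _ _ _ (nbhs_filter s1)) => s /= [].
    have oA : open (~` csimplex A) := closed_openC (csimplex_closed (cell_full htri (cM _ cA))).
    have cf : continuous (fun s : R => x + s *: e1).
      move=> s; apply: cvgD; first exact: cvg_cst.
      by apply: cvgZr_tmp; exact: cvg_id.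
    have nA : (~` csimplex A) (x + s1 *: e1) by move=> xA; apply: nU; split=> //; exists A.
    have := cf s1 _ (open_nbhs_nbhs (conj oA nA)).
    by apply: (@filterS _ _ (nbhs_filter s1)) => s /= nxA [].
  by move=> /clU[s [[_ [A HA]] nA]]; exact: (nA A HA).
have ub s : U s -> s <= s1 by exact: ub_le_sup.
have TM' := cM _ cT; have fT' := cell_full htri TM'.
set p := x + s1 *: e1 in xT'.
(* The face of [T'] having [p] in its relative interior. *)
pose S := [set i in T' | 0 < bc T' i p]%SET.
have ST : S \subset T' by apply/fintype.subsetP => i; rewrite inE => /andP[].
have /(csimplexE fT' _ (subxx _))[p1 p2] := xT'.
have pS : osimplex S p.
  apply/(osimplexE fT') => //; split => i; rewrite inE; first by case/andP.
  rewrite negb_and; case: (boolP (i \in T')) => [iT|iT] /= pi; last exact: p2.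
  by apply/eqP; rewrite eq_le p1// andbT leNgt.
have S0 : (0 < #|S|)%N.
  rewrite lt0n; apply/negP => /eqP/cards0_eq SE; have := bc_sum fT' p.
  move: pS => /(osimplexE fT' _ ST)[_ pS]; rewrite big1 => [/eqP|i _].
    by rewrite eq_sym oner_eq0.
  by apply: pS; rewrite SE inE.
have SN : (N <= #|S|)%N.
  rewrite leqNgt; apply/negP => SN; apply: (gx S T' s1 TM' ST _ pS).
  by rewrite S0 SN.
have shift (s : R) : p + s *: e1 = x + (s1 + s) *: e1 by rewrite /p -addrA -scalerDl.
have stop (s : R) A : connect (adjacent x) T A -> 0 < s -> ~ csimplex A (p + s *: e1).
  move=> cA s0 xA; have : U (s1 + s).
    by split; [rewrite addr_ge0// ltW|exists A; rewrite -shift].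
  by move/ub; rewrite gerDl leNgt s0.
have := SN; rewrite leq_eqVlt => /orP[/eqP SE|SE]; last first.
  have ET : S = T'.
    by apply/eqP; rewrite eqEcard ST; have [-> _] := fT'.
  rewrite ET in pS.
  have /filter_ex[s [s0 sT]] : \forall s \near (0 : R)^'+, 0 < s /\ osimplex T' (p + s *: e1).
    near=> s; split; first by near: s; exact: nbhs_right_gt.
    by near: s; exact: (near_ray _ (osimplex_open fT') pS).
  exact: (stop s T' cT s0 (osimplex_csimplex sT)).
have FM : S \in faces M.
  by rewrite inE -SE eqxx; apply/existsP; exists T'; rewrite TM'.
have FI := Fint _ _ cT FM ST.
have [h1 h2 h3 h4 h5] := interior_two_cells htri FI.
have TF : T' \in face_cells S by rewrite sub_face_cells TM'.
have [T'' TF'' n12] : exists2 T'', T'' \in face_cells S & T' != T''.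
  have [->|n1] := eqVneq T' (T1 S); first by exists (T2 S); rewrite ?sub_face_cells ?h2.
  by exists (T1 S); rewrite ?sub_face_cells ?h1.
have [TM'' ST''] : T'' \in cells M /\ S \subset T''.
  by move: TF''; rewrite sub_face_cells => /andP[].
have cT'' : connect (adjacent x) T T''.
  apply: (connect_trans cT); apply: connect1.
  rewrite /adjacent (adjacent_ray Tx cT) inE TM''/=; apply/andP; split.
    apply/asboolP; exists s1; split => //.
    exact: (sub_osimplex_csimplex htri TM'' ST'').
  by apply/existsP; exists S; rewrite FI ST.
have cr := cross_face N0 htri e1 FM TF TF'' n12 pS.
have /filter_ex[s [s0 [sT|sT]]] : \forall s \near (0 : R)^'+, 0 < s /\
    (csimplex T' (p + s *: e1) \/ csimplex T'' (p + s *: e1)).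
  near=> s; split; first by near: s; exact: nbhs_right_gt.
  by near: s.
- exact: stop cT s0 sT.
- exact: stop cT'' s0 sT.
Unshelve. all: by end_near. Qed.

Section face_function.
Variables (m B : simplex -> R).
Hypotheses (B0 : forall T, 0 <= B T)
  (mB : forall T F F', T \in cells M -> F \in faces M -> F' \in faces M ->
    F \subset T -> F' \subset T -> `|m F - m F'| <= B T)
  (m0 : forall F, F \in faces M -> F \notin interior_faces M -> m F = 0).

Lemma path_variation x T p F F' : T \in ray_cells x -> path (adjacent x) T p ->
  F \in faces M -> F' \in faces M -> F \subset T -> F' \subset last T p ->
  `|m F - m F'| <= \sum_(A <- T :: p) B A.
Proof.
elim: p T F => [|A p IH] T F Tx /=.
  move=> _ FM FM' FT FT'; rewrite big_seq1; apply: mB => //.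
  by move: Tx; rewrite inE => /andP[].
move=> /andP[/and3P[_ Ax /existsP[E /and3P[EI ET EA]]] pA] FM FM' FT FT'.
have EM : E \in faces M by move: EI; rewrite inE => /andP[].
rewrite big_cons -(subrKA (m E)) (le_trans (ler_normD _ _))// lerD//.
  by apply: mB => //; move: Tx; rewrite inE => /andP[].
exact: IH.
Qed.

Lemma ray_variation x T F : generic x -> T \in cells M -> csimplex T x ->
  F \in faces M -> F \subset T -> `|m F| <= \sum_(A in ray_cells x) B A.
Proof.
move=> gx TM xT FM FT.
have Tx : T \in ray_cells x.
  by rewrite inE TM; apply/asboolP; exists 0; rewrite lexx scale0r addr0.
have [T' [F' [/connectP[p0 p0P lE] FM' FT' nF']]] := walk_to_boundary gx TM xT.
(* On a path without repetitions the sum over the path is a sum over a subset of the ray cells. *)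
move: lE FT'; case: (shortenP p0P) => p pP up _ -> FT'.
have := path_variation Tx pP FM FM' FT FT'; rewrite (m0 FM' nF') subr0 => /le_trans; apply.
rewrite big_uniq//= big_mkcond [leRHS]big_mkcond; apply: ler_sum => A _.
case: (boolP (A \in T :: p)) => [Ap|_]; last by case: ifP.
suff -> : A \in ray_cells x by [].
move: Ap; rewrite inE => /predU1P[-> //|Ap].
have /splitPr Hs := Ap; apply: (adjacent_ray Tx); apply/connectP.
by move: pP; case: Hs => p1 p2; rewrite cat_path /= => /and3P[p1P eA _];
  exists (rcons p1 A); rewrite ?rcons_path ?p1P// last_rcons.
Qed.

Lemma card_cell_faces T : T \in cells M ->
  (#|[set F in faces M | F \subset T]| <= N.+1)%N.
Proof.
move=> TM; have [cT _] := cell_full htri TM.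
rewrite -cT; apply: leq_trans (leq_imset_card (fun i => (T :\ i)%SET) T).
apply: subset_leq_card; apply/fintype.subsetP => F; rewrite inE => /andP[FM FT].
have [i [iT iF TE]] := opposite_vertex htri TM FM FT.
apply/imsetP; exists i => //; rewrite TE; apply/setP => k; rewrite !inE.
by have [->|] := eqVneq k i; rewrite ?(negPf iF).
Qed.

Lemma sqr_sum_le (X : {set simplex}) :
  (\sum_(A in X) B A) ^+ 2 <= #|X|%:R * \sum_(A in X) B A ^+ 2.
Proof.
pose n : R := #|X|%:R; set s := \sum_(A in X) B A.
have H : 0 <= \sum_(A in X) (n * B A - s) ^+ 2 by apply: sumr_ge0 => A _; exact: sqr_ge0.
have E : \sum_(A in X) (n * B A - s) ^+ 2 = n * (n * (\sum_(A in X) B A ^+ 2) - s ^+ 2).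
  rewrite (eq_bigr (fun A => n ^+ 2 * B A ^+ 2 + - (2 * n * s) * B A + s ^+ 2)); last first.
    by move=> A _; ring.
  rewrite !big_split /= sumr_const -[X in _ + X]mulr_natl -!mulr_sumr -/s -/n; ring.
rewrite E in H; have [X0|X0] := posnP #|X|.
  have -> : s = 0 by rewrite /s big1// => A; rewrite (cards0_eq X0) inE.
  by rewrite X0 mul0r expr0n.
by move: H; rewrite pmulr_rge0 ?ltr0n// subr_ge0.
Qed.

(** One factor [kk] is Cauchy-Schwarz over the cells of a ray, the other counts, after exchanging
    the sums, the rays through a given cell; [N.+1] bounds the number of faces treated by the ray of
    one cell. *)
Lemma poincare_count (x : simplex -> 'rV[R]_N) (kk : R) :
  0 <= kk -> (forall T, T \in cells M -> osimplex T (x T) /\ generic (x T)) ->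
  (forall T, T \in cells M -> #|ray_cells (x T)|%:R <= kk) ->
  (forall A, A \in cells M -> #|[set T in cells M | A \in ray_cells (x T)]|%:R <= kk) ->
  \sum_(F in faces M) m F ^+ 2 <= N.+1%:R * kk ^+ 2 * \sum_(T in cells M) B T ^+ 2.
Proof.
move=> kk0 xP k1 k2.
have step T F : T \in cells M -> F \in faces M -> F \subset T ->
    m F ^+ 2 <= kk * \sum_(A in ray_cells (x T)) B A ^+ 2.
  move=> TM FM FT; have [xT gx] := xP T TM.
  have mF := ray_variation gx TM (osimplex_csimplex xT) FM FT.
  have S0 : 0 <= \sum_(A in ray_cells (x T)) B A by apply: sumr_ge0.
  apply: (@le_trans _ _ ((\sum_(A in ray_cells (x T)) B A) ^+ 2)).
    by rewrite -[leLHS]real_normK ?num_real// ler_sqr ?nnegrE.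
  apply: (le_trans (sqr_sum_le _)); rewrite ler_wpM2r ?k1//.
  by apply: sumr_ge0 => A _; exact: sqr_ge0.
apply: (@le_trans _ _ (\sum_(F in faces M) \sum_(T in cells M | F \subset T) m F ^+ 2)).
  apply: ler_sum => F FM; have := FM; rewrite inE => /andP[_ /existsP[T TF]].
  by rewrite (bigD1 T)//= lerDl sumr_ge0// => A _; exact: sqr_ge0.
rewrite (exchange_big_dep [in cells M])/=; last by move=> F T _ /andP[].
apply: (@le_trans _ _ (\sum_(T in cells M) N.+1%:R * (kk * \sum_(A in ray_cells (x T)) B A ^+ 2))).
  apply: ler_sum => T TM.
  have k0 : 0 <= kk * \sum_(A in ray_cells (x T)) B A ^+ 2.
    apply: mulr_ge0; first exact: le_trans (k1 T TM).
    by apply: sumr_ge0 => A _; exact: sqr_ge0.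
  apply: (@le_trans _ _ (\sum_(F in faces M | F \subset T) (kk * \sum_(A in ray_cells (x T)) B A ^+ 2))).
    rewrite [leLHS](eq_bigl (fun F => (F \in faces M) && (F \subset T))).
      by apply: ler_sum => F /andP[FM FT]; exact: step.
    by move=> F; rewrite TM.
  rewrite sumr_const -[leLHS]mulr_natl ler_wpM2r// ler_nat.
  by apply: leq_trans (card_cell_faces TM); rewrite cardsE.
rewrite -mulr_sumr -mulr_sumr expr2 -!mulrA ler_wpM2l// ler_wpM2l//.
rewrite (exchange_big_dep [in cells M])/=; last by move=> T A _; rewrite inE => /andP[].
rewrite mulr_sumr; apply: ler_sum => A AM.
rewrite (eq_bigl [in [set T in cells M | A \in ray_cells (x T)]]); last by move=> T; rewrite inE.
by rewrite sumr_const -[leLHS]mulr_natl ler_wpM2r ?sqr_ge0// k2.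
Qed.

End face_function.

Section poincare.
Variables (rho h q : R).
Hypotheses (hrho : forall T, T \in cells M -> hT T <= rho * rT T)
  (hle : forall T, T \in cells M -> hT T <= h)
  (hge : forall T, T \in cells M -> h <= q * hT T).

Lemma vmeas_osimplex T : T \in cells M -> vmeas (osimplex T).
Proof.
by move=> TM; apply: measurable_vec_open; exact: osimplex_open (cell_full htri TM).
Qed.

Lemma ebounded_osimplex T : ebounded (@osimplex R N M T).
Proof. by have [b bT] := csimplex_bounded (M := M) T; exists b => x /osimplex_csimplex/bT. Qed.

Lemma sum_vol_le (X : {set simplex}) (a b : 'rV[R]_N) : X \subset cells M ->
  (forall i, a 0 i <= b 0 i) ->
  (forall T, T \in X -> osimplex T `<=` closed_box a b) ->
  \sum_(T in X) vol (osimplex T) <= \prod_i (b 0 i - a 0 i).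
Proof.
move=> /fintype.subsetP XM ab Xab; set K := closed_box a b.
have mK : vmeas K by exact: measurable_closed_box.
have bK : ebounded K.
  exists (\sum_i (`|a 0 i| + `|b 0 i|)%R *+ N) => x xK.
  have s0 : 0 <= \sum_i (`|a 0 i| + `|b 0 i|) by apply: sumr_ge0 => i _; rewrite addr_ge0.
  rewrite sumrMnl -mulr_natl; apply: enorm_le_sup => // i.
  rewrite (bigD1 i)//= (@le_trans _ _ (`|a 0 i| + `|b 0 i|))//; last first.
    by rewrite lerDl sumr_ge0// => j _; rewrite addr_ge0.
  have /andP[h1 h2] := xK i; rewrite ler_norml.
  have := ler_norm (b 0 i); have := ler_norm (- a 0 i); rewrite normrN.
  by have := normr_ge0 (a 0 i); have := normr_ge0 (b 0 i); lra.
have -> : \prod_i (b 0 i - a 0 i) = 1 * vol K.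
  by rewrite mul1r /vol (closed_box_measure ab).
have m1 T : T \in X -> mbounded K (fun x => \1_(osimplex T) x * 1).
  move=> TX; apply: (@mbounded_indic _ _ _ _ (cst 1)) => //; first exact: vmeas_osimplex (XM T TX).
  exact: mbounded_cst.
rewrite (eq_bigr (fun T => vol_integral K (fun x => \1_(osimplex T) x * 1))); last first.
  move=> T TX; rewrite (vol_integral_indic (cst 1)); last exact: Xab.
  by rewrite vol_integral_cst ?mul1r//; exact: vmeas_osimplex (XM T TX).
rewrite -vol_integral_sum//; apply: vol_integral_le => //; first exact: mbounded_sum.
move=> x _.
have [[T TX xT]|nT] := pselect (exists2 T, T \in X & osimplex T x).
  rewrite (bigD1 T)//= big1 => [|T' /andP[TX' TT']].
    by rewrite addr0 mulr1 indicE; case: (_ \in _).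
  rewrite indicE memNset ?mul0r// => xT'; move/negP: TT'; apply; apply/eqP.
  exact: (cells_disjoint htri (XM _ TX') (XM _ TX) xT' (osimplex_csimplex xT)).
rewrite big1// => T TX; rewrite indicE memNset ?mul0r// => xT; apply: nT.
by exists T.
Qed.

(** The volume [2 * Dm * (4 * h) ^+ N.-1] of a tube divided by the least volume
    [(h / (2 * q * rho * N%:R)) ^+ N] of a cell, with the factor [h^-1] taken out. *)
Definition poincare_constant : R := 2 * Dm * 4 ^+ N.-1 * (2 * q * rho * N%:R) ^+ N.

Lemma card_tube_le T0 (X : {set simplex}) (y : 'rV[R]_N) : T0 \in cells M ->
  0 < h -> X \subset cells M ->
  (forall T x i, T \in X -> osimplex T x -> i != i0 -> `|x 0 i - y 0 i| <= 2 * h) ->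
  #|X|%:R <= poincare_constant / h.
Proof.
move=> T0M h0 XM Xy; have fT0 := cell_full htri T0M.
have [rho0 _] := inscribed_ball fT0 N0 (hrho T0M).
have q0 : 0 < q.
  have := lt_le_trans h0 (hge T0M); have := hT_gt0 fT0 N0; nra.
have D0 : 0 <= Dm.
  have [b bT] := osimplex_nonempty (card_cell_gt0 fT0).
  exact: le_trans (enorm_ge0 _) (HD (csimplex_closure htri T0M (osimplex_csimplex bT))).
have NR : 0 < N%:R :> R by rewrite ltr0n.
pose a : 'rV[R]_N := \row_i (if i == i0 then - Dm else y 0 i - 2 * h).
pose b : 'rV[R]_N := \row_i (if i == i0 then Dm else y 0 i + 2 * h).
have ab i : a 0 i <= b 0 i by rewrite !mxE; case: ifP => _; lra.
have box T : T \in X -> osimplex T `<=` closed_box a b.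
  move=> TX x xT i; rewrite !mxE; have [->|ii] := eqVneq i i0.
    rewrite -ler_norml (le_trans (coord_le_enorm _ _))//; apply: HD.
    exact: (csimplex_closure htri (fintype.subsetP XM _ TX) (osimplex_csimplex xT)).
  by rewrite -ler_distl (Xy T).
have prodE : \prod_i (b 0 i - a 0 i) = 2 * Dm * (4 * h) ^+ N.-1.
  rewrite (bigD1 i0)//= !mxE eqxx opprK; congr (_ * _); first by ring.
  rewrite (eq_bigr (fun=> 4 * h)) => [|i ii]; last by rewrite !mxE (negPf ii); ring.
  rewrite prodr_const cardC1 card_ord//.
have := sum_vol_le XM ab box; rewrite prodE => sv.
pose w := 2 * q * rho * N%:R; have w0 : 0 < w by rewrite !mulr_gt0.
have vT T : T \in X -> (h / w) ^+ N <= vol (osimplex T).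
  move=> TX; have TM := fintype.subsetP XM _ TX; have fT := cell_full htri TM.
  apply: le_trans (vol_osimplex_ge fT N0 (hrho TM)).
  apply: lerXn2r; rewrite ?nnegrE ?divr_ge0 ?mulr_ge0 ?(ltW h0) ?(ltW q0) ?(ltW rho0) ?hT_ge0//.
  rewrite ler_pdivrMr// /w.
  rewrite (_ : hT T / (2 * rho * N%:R) * (2 * q * rho * N%:R) = q * hT T) ?hge//.
  by field; rewrite !gt_eqF.
have : #|X|%:R * (h / w) ^+ N <= 2 * Dm * (4 * h) ^+ N.-1.
  apply: le_trans sv; rewrite mulr_natl -sumr_const; apply: ler_sum => T; exact: vT.
have hE : h ^+ N = h * h ^+ N.-1 by rewrite -exprS prednK.
have -> : 2 * Dm * (4 * h) ^+ N.-1 = poincare_constant / h * (h / w) ^+ N.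
  rewrite /poincare_constant -/w !expr_div_n exprMn hE.
  by field; rewrite !gt_eqF// exprn_gt0.
by rewrite ler_pM2r// exprn_gt0// divr_gt0.
Qed.

Lemma poincare (m B : simplex -> R) : 0 < h ->
  (forall T, 0 <= B T) ->
  (forall T F F', T \in cells M -> F \in faces M -> F' \in faces M ->
    F \subset T -> F' \subset T -> `|m F - m F'| <= B T) ->
  (forall F, F \in faces M -> F \notin interior_faces M -> m F = 0) ->
  \sum_(F in faces M) m F ^+ 2 <=
    N.+1%:R * (poincare_constant / h) ^+ 2 * \sum_(T in cells M) B T ^+ 2.
Proof.
move=> h0 B0 mB m0.
have [[T0 T0M]|nT] := pselect (exists T, T \in cells M); last first.
  rewrite !big1 ?mulr0// => [T TM|F]; first by case: nT; exists T.
  by rewrite inE => /andP[_ /existsP[T /andP[TM _]]]; case: nT; exists T.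
have dist T x y i : T \in cells M -> csimplex T x -> csimplex T y -> `|x 0 i - y 0 i| <= h.
  move=> TM xT yT; apply: le_trans (hle TM).
  apply: le_trans (csimplex_dist (cell_full htri TM) xT yT).
  by apply: le_trans (coord_le_enorm _ i); rewrite !mxE.
have rayc x T : T \in ray_cells x -> exists z, csimplex T z /\ forall i, i != i0 -> z 0 i = x 0 i.
  rewrite inE => /andP[_ /asboolP[s [_ sT]]]; exists (x + s *: e1); split => // i ii.
  by rewrite !mxE (negPf ii) andbF mulr0 addr0.
have /choice[x xP] : forall T, exists x, T \in cells M -> osimplex T x /\ generic x.
  move=> T; have [TM|] := boolP (T \in cells M); last by exists 0.
  have fT := cell_full htri TM; have [|x xx] := generic_point TM; last by exists x.
  have [rho0 _] := inscribed_ball fT N0 (hrho TM).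
  apply: lt_le_trans (vol_osimplex_ge fT N0 (hrho TM)).
  by rewrite exprn_gt0// divr_gt0 ?hT_gt0// !mulr_gt0// ltr0n.
apply: (poincare_count B0 mB m0 (x := x)) => //.
(* Nonnegativity of the bound is its instance for the empty family. *)
- apply: le_trans (ler0n _ _) (@card_tube_le T0 finset.set0 0 T0M h0 _ _).
    by rewrite finset.sub0set.
  by move=> T y i; rewrite inE.
- move=> T TM; apply: (card_tube_le T0M h0 (y := x T)).
    by apply/fintype.subsetP => A; rewrite inE => /andP[].
  move=> A w i Ax wA ii; have [z [zA zx]] := rayc _ _ Ax.
  have AM : A \in cells M by move: Ax; rewrite inE => /andP[].
  by rewrite -zx// (le_trans (dist _ _ _ _ AM (osimplex_csimplex wA) zA))//; lra.
(* The cells whose ray meets [A] lie within [2 * h] of [y] transversally: one [h] from a point of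
   the cell to the starting point of its ray, one across [A]. *)
- move=> A AM; have [y yA] := osimplex_nonempty (card_cell_gt0 (cell_full htri AM)).
  apply: (card_tube_le T0M h0 (y := y)).
    by apply/fintype.subsetP => T; rewrite inE => /andP[].
  move=> T w i; rewrite inE => /andP[TM Ax] wT ii; have [z [zA zx]] := rayc _ _ Ax.
  have [xT _] := xP T TM.
  rewrite -(subrKA (x T 0 i)) (le_trans (ler_normD _ _))// mulrDl mul1r lerD//.
    by apply: (dist _ _ _ _ TM); exact: osimplex_csimplex.
  by rewrite -zx//; apply: (dist _ _ _ _ AM) => //; exact: osimplex_csimplex.
Qed.

End poincare.
End ray_walk.

(** * The weighted energy *)

Section energy.
Context {R : realType} {N : nat} (P : interface_problem R N) (M : mesh R N).
Context (D : discrete_interface M) (K : constants R).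
Local Notation simplex := {set 'I_(nv M)}.
Implicit Types (T F : simplex) (x y g : 'rV[R]_N) (s : bool).
Hypotheses (hN : N = 2%N \/ N = 3%N) (hP : well_posed P)
  (htri : triangulation P M) (hok : discrete_interface_ok P D K).
Variables b0 b1 : R.
Hypotheses (b00 : 0 < b0)
  (hb : forall s x, closure (Omegas_ext P s) x -> b0 <= betaE P s x <= b1).
Let N0 : (0 < N)%N. Proof. by case: hN => ->. Qed.
Let hO : convex_polytope_domain (Omega P). Proof. by case: hP. Qed.

Lemma Omega_ebounded : ebounded (Omega P).
Proof.
have [_ [B [_ HB]] _] := hO; exists (N%:R * (B + 1)) => x Ox.
apply: (le_trans (enorm_le_norm _)); rewrite ler_wpM2l//.
by apply: (HB (B + 1)) => //; rewrite ltrDl.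
Qed.

Lemma Omega_vmeas : vmeas (Omega P).
Proof. by apply: measurable_vec_open; exact: (Omega_open hO). Qed.

Lemma side_vmeas : vmeas (Omegah D true).
Proof. by case: hok => -[oh _ _ _ _] _ _ _; apply: measurable_vec_open; exact: oh. Qed.

Lemma mbounded_side A (f : bool -> 'rV[R]_N -> R) : vmeas A ->
  (forall s, mbounded A (f s)) -> mbounded A (fun x => f (side D x) x).
Proof.
move=> mA bf.
have b1' := mboundedS mA (@subIsetl _ A (Omegah D true)) (bf true).
have b2' := mboundedS mA (@subDsetl _ A (Omegah D true)) (bf false).
have := mbounded_if mA side_vmeas b1' b2'; congr mbounded; apply/funext => x.
by rewrite /side; case: asboolP.
Qed.

(** Points of [Gammah] get the sign [false] from [side]; as boundary points of [Omegah D false] they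
    are in the closure where [betaE P false] is controlled. *)
Lemma Omegah_closure x : Omega P x -> closure (Omegas_ext P (side D x)) x.
Proof.
case: hok => -[oh OE _ GE sub] _ _ _; rewrite /side.
case: asboolP => xh Ox; first exact: (subset_closure (sub true x xh)).
apply: (closureS (sub false)); move: Ox; rewrite OE => -[[//|xf]|].
  exact: subset_closure.
by rewrite GE => -[].
Qed.

Lemma betaBK_bounds x : Omega P x -> b0 <= betaBK P D x <= b1.
Proof. by move=> /Omegah_closure; exact: hb. Qed.

Lemma betaBK_mbounded : mbounded (Omega P) (betaBK P D).
Proof.
have cE s : {within closure (Omegas_ext P s), continuous (betaE P s)}.
  by case: hP => _ _ _ _ /(_ s)[_ _ [_ + _] _ _].
have fM s x : closure (Omegas_ext P s) x -> `|betaE P s x| <= b1.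
  move=> /hb/andP[h1 h2]; rewrite ger0_norm//; exact: le_trans (ltW b00) h1.
have H := mbounded_if Omega_vmeas side_vmeas
  (f := betaE P true) (g := betaE P false).
have -> : betaBK P D = fun x => if `[< Omegah D true x >] then betaE P true x else betaE P false x.
  by apply/funext => x; rewrite /betaBK /side; case: asboolP.
apply: H.
  have sub : Omega P `&` Omegah D true `<=` closure (Omegas_ext P true).
    by move=> x [Ox xh]; have := Omegah_closure Ox; rewrite /side asboolT.
  apply: (mbounded_within _ sub (cE true)) => [|x /sub]; last exact: fM.
  exact: vmeasI Omega_vmeas side_vmeas.
have sub : Omega P `\` Omegah D true `<=` closure (Omegas_ext P false).
  by move=> x [Ox xh]; have := Omegah_closure Ox; rewrite /side asboolF.
apply: (mbounded_within _ sub (cE false)) => [|x /sub]; last exact: fM.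
exact: vmeasD Omega_vmeas side_vmeas.
Qed.

Definition energy_density (q r : bool -> 'rV[R]_N) x : R :=
  betaBK P D x * dot (q (side D x)) (r (side D x)).

Definition energy T (q r : bool -> 'rV[R]_N) : R :=
  vol_integral (osimplex T) (energy_density q r).

Lemma energy_density_mbounded q r : mbounded (Omega P) (energy_density q r).
Proof.
apply: mboundedM; first exact: betaBK_mbounded.
apply: (mbounded_side (f := fun s x => dot (q s) (r s))); first exact: Omega_vmeas.
by move=> s; exact: mbounded_cst.
Qed.

Section cell_energy.
Variables (T : simplex) (TM : T \in cells M).
Let mT := vmeas_osimplex htri TM.
Let bT := ebounded_osimplex (M := M) T.

Lemma cell_density_mbounded q r : mbounded (osimplex T) (energy_density q r).
Proof.
apply: mboundedS (energy_density_mbounded q r); first exact: Omega_vmeas.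
exact: (osimplex_Omega hO htri TM).
Qed.

Lemma energyC q r : energy T q r = energy T r q.
Proof. by apply: eq_vol_integral => x _; rewrite /energy_density dotC. Qed.

Lemma energy_suml (I : Type) (js : seq I) (c : I -> R) (q : I -> bool -> 'rV[R]_N) r :
  energy T (fun s => \sum_(i <- js) c i *: q i s) r = \sum_(i <- js) c i * energy T (q i) r.
Proof.
transitivity (vol_integral (osimplex T) (fun x => \sum_(i <- js) c i * energy_density (q i) r x)).
  apply: eq_vol_integral => x _; rewrite /energy_density dot_suml mulr_sumr.
  by apply: eq_bigr => i _; rewrite dotZl mulrCA.
rewrite vol_integral_sum//; last by move=> i _; apply/mboundedZ/cell_density_mbounded.
by apply: eq_bigr => i _; rewrite vol_integralZ//; exact: cell_density_mbounded.
Qed.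

Lemma energyZl c q r : energy T (fun s => c *: q s) r = c * energy T q r.
Proof.
have := energy_suml [:: tt] (fun=> c) (fun=> q) r; rewrite big_seq1 => <-.
by congr energy; apply/funext => s; rewrite big_seq1.
Qed.

Lemma energyDl q q' r : energy T (fun s => q s + q' s) r = energy T q r + energy T q' r.
Proof.
have := energy_suml [:: true; false] (fun=> 1) (fun b => if b then q else q') r.
rewrite !big_cons !big_nil !mul1r !addr0 => <-; congr energy; apply/funext => s.
by rewrite !big_cons !big_nil !scale1r addr0.
Qed.

Lemma energy_ge0 q : 0 <= energy T q q.
Proof.
apply: vol_integral_ge0 => x /(osimplex_Omega hO htri TM)/betaBK_bounds/andP[h _].
by rewrite mulr_ge0 ?dot_ge0// (le_trans (ltW b00)).
Qed.

(** The weights 8 and 1/8 are dictated by the factor 8 of [form_s] and by the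
    fact that a cell belongs to at most [N.+1 <= 4] patches. *)
Lemma energy_young q r :
  `|2 * energy T q r| <= 8 * energy T q q + 8^-1 * energy T r r.
Proof.
have H (e : R) : 0 <= 8 * energy T q q + e * (2 * energy T q r) + e ^+ 2 / 8 * energy T r r.
  have := energy_ge0 (fun s => 8 *: q s + e *: r s).
  rewrite energyDl !energyZl !(energyC _ (fun s => 8 *: q s + _)) !energyDl !energyZl.
  by rewrite (energyC r q) expr2; lra.
have := H 1; have := H (-1); rewrite sqrrN expr1n ler_norml => h1 h2.
by apply/andP; split; lra.
Qed.

Lemma energy_lower q a : 0 <= a -> (forall s, a <= dot (q s) (q s)) ->
  b0 * a * vol (osimplex T) <= energy T q q.
Proof.
move=> a0 aq; apply: vol_integral_ge => //; first exact: cell_density_mbounded.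
move=> x /(osimplex_Omega hO htri TM)/betaBK_bounds/andP[h _].
by rewrite ler_pM// ltW.
Qed.

Lemma energy_upper q a : (forall s, dot (q s) (q s) <= a) ->
  energy T q q <= b1 * a * vol (osimplex T).
Proof.
move=> aq; apply: vol_integral_le => //; first exact: cell_density_mbounded.
move=> x /(osimplex_Omega hO htri TM)/betaBK_bounds/andP[h1 h2].
by rewrite ler_pM ?dot_ge0// (le_trans (ltW b00)).
Qed.

End cell_energy.

Lemma on_Omega_cell q T x : T \in cells M -> osimplex T x ->
  on_Omega D q x = q T (side D x).
Proof.
move=> TM xT; rewrite /on_Omega (bigD1 T)//= big1 => [|T' /andP[TM' TT']].
  by rewrite addr0 indicE mem_set// scale1r.
rewrite indicE memNset ?scale0r// => xT'; move/negP: TT'; apply; apply/eqP.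
exact: (cells_disjoint htri TM' TM xT' (osimplex_csimplex xT)).
Qed.

(** [on_Omega] is zero off the open cells, so the integrand is pointwise a sum over disjoint cells
    and the skeleton contributes nothing. *)
Lemma vol_integral_cells (X : {set simplex}) B (q r : bfield M) :
  X \subset cells M -> vmeas B -> B `<=` Omega P ->
  (forall T, T \in X -> osimplex T `<=` B) ->
  (forall T x, T \in cells M -> B x -> osimplex T x -> T \in X) ->
  vol_integral B (fun x => betaBK P D x * dot (on_Omega D q x) (on_Omega D r x)) =
  \sum_(T in X) energy T (q T) (r T).
Proof.
move=> /fintype.subsetP XM mB BO XB BX.
have bB : ebounded B by have [b bO] := Omega_ebounded; exists b => x /BO/bO.
transitivity (vol_integral B (fun x => \sum_(T in X) \1_(osimplex T) x * energy_density (q T) (r T) x)).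
  apply: eq_vol_integral => x Bx.
  have [[T TM xT]|nT] := pselect (exists2 T, T \in cells M & osimplex T x).
    have TX := BX _ _ TM Bx xT.
    rewrite !(on_Omega_cell _ TM xT) (bigD1 T)//= big1 => [|T' /andP[TX' TT']].
      by rewrite addr0 indicE mem_set// mul1r.
    rewrite indicE memNset ?mul0r// => xT'; move/negP: TT'; apply; apply/eqP.
    exact: (cells_disjoint htri (XM _ TX') TM xT' (osimplex_csimplex xT)).
  have -> : on_Omega D q x = 0.
    rewrite /on_Omega big1// => T TM; rewrite indicE memNset ?scale0r// => xT.
    by apply: nT; exists T.
  rewrite dot0l mulr0 big1// => T TX; rewrite indicE memNset ?mul0r// => xT.
  by apply: nT; exists T => //; exact: XM.
rewrite vol_integral_sum//.
  by apply: eq_bigr => T TX; rewrite vol_integral_indic//; exact: XB.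
move=> T TX; apply: mbounded_indic => //; first exact: (vmeas_osimplex htri (XM _ TX)).
apply: mboundedS (energy_density_mbounded _ _); first exact: Omega_vmeas.
by move=> x [/BO].
Qed.

Lemma form_aE z v : form_a P D z v =
  \sum_(T in cells M) energy T (gradh z T) (gradh v T).
Proof.
apply: vol_integral_cells => //; first exact: Omega_vmeas.
by move=> T TM; exact: (osimplex_Omega hO htri TM).
Qed.

Lemma patch_integralE F (q r : bfield M) : F \in interior_faces M ->
  vol_integral (Defs.patch F) (fun x => betaBK P D x * dot (on_Omega D q x) (on_Omega D r x)) =
  energy (T1 F) (q (T1 F)) (r (T1 F)) + energy (T2 F) (q (T2 F)) (r (T2 F)).
Proof.
move=> FI; have [h1 h2 _ _ n12] := interior_two_cells htri FI.
rewrite (@vol_integral_cells [set T1 F; T2 F]%SET).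
- by rewrite big_setU1 ?inE//= big_set1.
- by apply/fintype.subsetP => T; rewrite !inE => /orP[]/eqP ->.
- by apply: measurableU; [exact: (vmeas_osimplex htri h1)|exact: (vmeas_osimplex htri h2)].
- by move=> x [] /(osimplex_Omega hO htri); apply.
- by move=> T; rewrite !inE => /orP[]/eqP -> x; [left|right].
- move=> T x TM [] xT' xT; rewrite !inE.
    by rewrite (cells_disjoint htri TM h1 xT (osimplex_csimplex xT')) eqxx.
  by rewrite (cells_disjoint htri TM h2 xT (osimplex_csimplex xT')) eqxx orbT.
Qed.

End energy.

(** * Liftings and the quadratic form *)

Section face_functions.
Context {R : realType} {N : nat} (P : interface_problem R N) (M : mesh R N).
Context (D : discrete_interface M) (K : constants R).
Local Notation simplex := {set 'I_(nv M)}.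
Implicit Types (T F : simplex) (x y : 'rV[R]_N) (s : bool) (f g : 'rV[R]_N -> R).
Hypotheses (hN : N = 2%N \/ N = 3%N) (hP : well_posed P)
  (htri : triangulation P M) (hok : discrete_interface_ok P D K)
  (hmin : 0 < coef_min K)
  (hin : forall T, T \in Gcells P M -> csimplex T `<=` Omega P).
Variables b0 b1 : R.
Hypotheses (b00 : 0 < b0)
  (hb : forall s x, closure (Omegas_ext P s) x -> b0 <= betaE P s x <= b1).
Let N0 : (0 < N)%N. Proof. by case: hN => ->. Qed.
Let hO : convex_polytope_domain (Omega P). Proof. by case: hP. Qed.

(** Only here are traces evaluated: the image stays in the open face, where the values of [betaBK]
    are controlled if it is an interface face. *)
Definition params F : set 'rV[R]_N.-1 := ref_simplex `\` bad_params P D F.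

Definition face_mbounded F (f : 'rV[R]_N -> R) :=
  mbounded (params F) (fun t => f (face_map F t)).

Lemma params_ebounded F : ebounded (params F).
Proof. by have [B BM] := @ebounded_ref_simplex R N.-1; exists B => x [/BM]. Qed.

Lemma Gface_faces F : F \in Gfaces P M -> F \in faces M.
Proof. by rewrite inE => /andP[]. Qed.

Lemma Gface_Omega F : F \in Gfaces P M -> osimplex F `<=` Omega P.
Proof.
rewrite inE => /andP[FM /asboolP[x [xF xG]]].
have : F \in faces M by []; rewrite inE => /andP[_ /existsP[T /andP[TM FT]]].
apply: (face_Omega hO htri TM FT xF).
by case: hP => _ [_ -> _ _] _ _ _; right.
Qed.

Lemma Gface_interior F : F \in Gfaces P M -> F \in interior_faces M.
Proof.
move=> FG; have [x xF] : osimplex (M := M) F !=set0.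
  by apply: osimplex_nonempty; rewrite (card_face (Gface_faces FG)).
exact: (interior_faceP N0 hO htri (Gface_faces FG) xF (Gface_Omega FG xF)).
Qed.

Section face.
Variables (F : simplex) (FM : F \in faces M).
Let nullF := bad_params_null hN hO htri hok FM.
Let mF : vmeas (params F).
Proof. by apply: vmeasD; [exact: vmeas_ref_simplex|case: nullF]. Qed.
Let bF := params_ebounded F.

Lemma params_osimplex t : params F t -> osimplex F (face_map F t).
Proof. by move=> [rt nb]; have [] := good_param hN FM rt nb. Qed.

Lemma mbounded_face (A : set 'rV[R]_N) f : vmeas A -> mbounded A f ->
  (forall t, params F t -> A (face_map F t)) -> face_mbounded F f.
Proof.
move=> mA [mf [B fB]] FA; split; last by exists B => t /FA/fB.
pose G (t : N.-1.-tuple (measurableTypeR R)) : N.-tuple (measurableTypeR R) :=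
  [tuple face_map F (vec_of_tuple t) 0 i : measurableTypeR R | i < N].
have GE t : vec_of_tuple (G t) = face_map F (vec_of_tuple t).
  by apply/rowP => i; rewrite mxE tnth_mktuple.
have mG : measurable_fun [set: _] G.
  apply/measurable_fun_tnthP => i.
  rewrite (_ : _ \o _ = fun t : N.-1.-tuple (measurableTypeR R) => (face_vtx F)`_0 0 i +
      \sum_j vec_of_tuple t 0 j * (edge_mx (k := N.-1) (face_vtx F)) j i); last first.
    by apply/funext => t; rewrite /= tnth_mktuple /face_map !mxE.
  apply: measurable_funD => //; apply: measurable_sum => j.
  by apply: measurable_funM => //; exact: measurable_coord.
have := @measurable_comp _ _ _ _ _ _ (@vec_of_tuple R N @^-1` A) (f \o @vec_of_tuple R N)
   (@vec_of_tuple R N.-1 @^-1` params F) G mA _ mf (measurable_funTS mG).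
rewrite (_ : (f \o _) \o _ = (fun t => f (face_map F t)) \o @vec_of_tuple R N.-1).
  by apply; move=> _ [t Ft <-] /=; rewrite GE; exact: FA.
by apply/funext => t /=; rewrite GE.
Qed.

Lemma face_mboundedB f g : face_mbounded F f -> face_mbounded F g ->
  face_mbounded F (fun x => f x - g x).
Proof. exact: mboundedB. Qed.

Lemma face_mboundedM f g : face_mbounded F f -> face_mbounded F g ->
  face_mbounded F (fun x => f x * g x).
Proof. exact: mboundedM. Qed.

Lemma face_integral_params f : face_integral F f =
  Num.sqrt (\det (edge_mx (k := N.-1) (face_vtx F) *m (edge_mx (face_vtx F))^T)) *
  vol_integral (params F) (fun t => f (face_map F t)).
Proof.
by rewrite face_integralE; case: nullF => mZ Z0; rewrite (vol_integral_null _ _ mZ Z0).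
Qed.

Lemma face_integral_sum (I : Type) (js : seq I) (c : I -> R) (f : I -> 'rV[R]_N -> R) :
  (forall i, face_mbounded F (f i)) ->
  face_integral F (fun x => \sum_(i <- js) c i * f i x) =
  \sum_(i <- js) c i * face_integral F (f i).
Proof.
move=> bf; rewrite face_integral_params vol_integral_sum//; last first.
  by move=> i _; exact/mboundedZ/bf.
rewrite mulr_sumr; apply: eq_bigr => i _; rewrite vol_integralZ//; last exact: bf.
by rewrite face_integral_params mulrCA.
Qed.

Lemma face_integralD f g : face_mbounded F f -> face_mbounded F g ->
  face_integral F (fun x => f x + g x) = face_integral F f + face_integral F g.
Proof.
move=> bf bg; rewrite !face_integral_params vol_integralD//; exact: mulrDr.
Qed.

Lemma face_mean_sum (I : Type) (js : seq I) (c : I -> R) (f : I -> 'rV[R]_N -> R) :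
  (forall i, face_mbounded F (f i)) ->
  face_mean F (fun x => \sum_(i <- js) c i * f i x) = \sum_(i <- js) c i * face_mean F (f i).
Proof.
move=> bf; rewrite /face_mean face_integral_sum// mulr_suml.
by apply: eq_bigr => i _; rewrite mulrA.
Qed.

Lemma face_integral_le T f c : T \in cells M -> F \subset T -> 0 <= c ->
  face_mbounded F f -> (forall t, params F t -> `|f (face_map F t)| <= c) ->
  `|face_integral F f| <= hT T ^+ N.-1 * c.
Proof.
move=> TM FT c0 bf fc; have fT := cell_full htri TM.
have /andP[d0 d1] := gram_bounds hN fT FT (card_face FM).
have hp : 0 <= hT T ^+ N.-1 by rewrite exprn_ge0// hT_ge0.
rewrite face_integral_params normrM ger0_norm ?sqrtr_ge0// ler_pM ?sqrtr_ge0//.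
  by rewrite -[leRHS]ger0_norm// -sqrtr_sqr ler_wsqrtr.
have hk : N.-1 = 1%N \/ N.-1 = 2%N by case: hN => ->; [left|right].
have v1 : vol (params F) <= 1.
  apply: (@le_trans _ _ (vol (@ref_simplex R N.-1))).
    by apply: le_vol => //; [exact: vmeas_ref_simplex|exact: ebounded_ref_simplex|move=> t []].
  case: hk => ->; rewrite ?vol_ref_simplex1// vol_ref_simplex2; lra.
have v0 := vol_ge0 (params F).
have h1 : vol_integral (params F) (fun t => f (face_map F t)) <= c * vol (params F).
  by apply: vol_integral_le => // t Ft; exact: le_trans (ler_norm _) (fc t Ft).
have h2 : - c * vol (params F) <= vol_integral (params F) (fun t => f (face_map F t)).
  by apply: vol_integral_ge => // t Ft; have := fc t Ft; rewrite ler_norml => /andP[].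
by rewrite ler_norml; apply/andP; split; nra.
Qed.

Lemma value_face_mbounded T (p : bool -> affine) : T \in cells M -> F \subset T ->
  face_mbounded F (fun x => aff (p (side D x)) x).
Proof.
move=> TM FT; have fT := cell_full htri TM.
have mT : vmeas (csimplex T) by apply: measurable_vec_closed; exact: csimplex_closed fT.
apply: (mbounded_face mT); last first.
  by move=> t /params_osimplex; exact: (sub_osimplex_csimplex htri TM FT).
apply: (mbounded_side hok (f := fun s => aff (p s)) mT) => s.
by apply: mboundedD; [exact/mbounded_dot/csimplex_bounded|exact: mbounded_cst].
Qed.

End face.

Lemma jump_face_mbounded F v : F \in interior_faces M -> face_mbounded F (jump D v F).
Proof.
move=> FI; have FM : F \in faces M by move: FI; rewrite inE => /andP[].
have [h1 h2 s1 s2 _] := interior_two_cells htri FI.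
by apply: face_mboundedB; [exact: (value_face_mbounded FM _ h1 s1)|exact: (value_face_mbounded FM _ h2 s2)].
Qed.

Lemma flux_face_mbounded F q : F \in Gfaces P M -> face_mbounded F (flux_average P D q F).
Proof.
move=> FG; have FM := Gface_faces FG.
apply: (mbounded_face (Omega_vmeas hP)); last first.
  by move=> t /(params_osimplex FM); exact: Gface_Omega.
have bt T : mbounded (Omega P) (fun x => betaBK P D x * dot (q T (side D x)) (nF F)).
  apply: mboundedM; first exact: (betaBK_mbounded hP hok b00 hb).
  apply: (mbounded_side hok (f := fun s x => dot (q T s) (nF F)) (Omega_vmeas hP)) => s.
  exact: mbounded_cst.
rewrite /flux_average; under [X in mbounded _ X]eq_fun do rewrite mulrC.
by apply: mboundedZ; apply: mboundedD; exact: bt.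
Qed.

End face_functions.

(** * Patch energies and existence of liftings *)

Section liftings.
Context {R : realType} {N : nat} (P : interface_problem R N) (M : mesh R N).
Context (D : discrete_interface M) (K : constants R).
Local Notation simplex := {set 'I_(nv M)}.
Implicit Types (T F : simplex) (s : bool) (q r : bfield M) (f : 'rV[R]_N -> R).
Hypotheses (hN : N = 2%N \/ N = 3%N) (hP : well_posed P)
  (htri : triangulation P M) (hok : discrete_interface_ok P D K)
  (hmin : 0 < coef_min K)
  (hin : forall T, T \in Gcells P M -> csimplex T `<=` Omega P).
Variables (rho b0 b1 : R).
Hypotheses (hrho : forall T, T \in cells M -> hT T <= rho * rT T) (b00 : 0 < b0)
  (hb : forall s x, closure (Omegas_ext P s) x -> b0 <= betaE P s x <= b1).
Let N0 : (0 < N)%N. Proof. by case: hN => ->. Qed.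
Let hO : convex_polytope_domain (Omega P). Proof. by case: hP. Qed.
Local Notation energy := (energy P D).
Local Notation ext := (ext P D).

Lemma vol_cell_gt0 T : T \in cells M -> 0 < vol (osimplex T).
Proof.
move=> TM; have fT := cell_full htri TM; have [rho0 _] := inscribed_ball fT N0 (hrho TM).
apply: lt_le_trans (vol_osimplex_ge fT N0 (hrho TM)).
by rewrite exprn_gt0// divr_gt0 ?hT_gt0// !mulr_gt0// ltr0n.
Qed.

Lemma ext_sum T s (I : Type) (js : seq I) (c : I -> R) (g : I -> 'rV[R]_N) :
  ext T s (\sum_(i <- js) c i *: g i) = \sum_(i <- js) c i *: ext T s (g i).
Proof.
elim: js => [|i js IH]; last by rewrite !big_cons extD extZ IH.
by rewrite !big_nil -[X in ext T s X](scale0r 0) extZ scale0r.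
Qed.

Lemma ext_energy_lower T (g : 'rV[R]_N) : T \in cells M ->
  b0 * ((contrast K)^-1 ^+ 2 * dot g g) * vol (osimplex T) <=
    energy T (ext T ^~ g) (ext T ^~ g).
Proof.
move=> TM; apply: (energy_lower hP htri hok b00 hb TM).
  by rewrite mulr_ge0 ?sqr_ge0 ?dot_ge0.
by move=> s; have /andP[] := ext_bounds hO htri hok hmin T s g.
Qed.

Lemma ext_energy_upper T (g : 'rV[R]_N) : T \in cells M ->
  energy T (ext T ^~ g) (ext T ^~ g) <=
    b1 * (contrast K ^+ 2 * dot g g) * vol (osimplex T).
Proof.
move=> TM; apply: (energy_upper hP htri hok b00 hb TM).
by move=> s; have /andP[] := ext_bounds hO htri hok hmin T s g.
Qed.

Definition patch_energy F q r : R :=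
  energy (T1 F) (q (T1 F)) (r (T1 F)) + energy (T2 F) (q (T2 F)) (r (T2 F)).

Section interior_face_patch.
Variables (F : simplex) (FI : F \in interior_faces M).
Let cellsF := interior_two_cells htri FI.
Let TM1 : T1 F \in cells M. Proof. by case: cellsF. Qed.
Let TM2 : T2 F \in cells M. Proof. by case: cellsF. Qed.
Let n12 : T1 F != T2 F. Proof. by case: cellsF. Qed.

Lemma patch_energyC q r : patch_energy F q r = patch_energy F r q.
Proof. by rewrite /patch_energy energyC [X in _ + X]energyC. Qed.

Lemma patch_energy_suml (I : Type) (js : seq I) (c : I -> R) (q : I -> bfield M) r :
  patch_energy F (fun T s => \sum_(i <- js) c i *: q i T s) r =
  \sum_(i <- js) c i * patch_energy F (q i) r.
Proof.
rewrite /patch_energy !(energy_suml hP htri hok b00 hb)// -big_split.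
by apply: eq_bigr => i _; rewrite mulrDr.
Qed.

Lemma patch_energy_sumr (I : Type) (js : seq I) (c : I -> R) (q : I -> bfield M) r :
  patch_energy F r (fun T s => \sum_(i <- js) c i *: q i T s) =
  \sum_(i <- js) c i * patch_energy F r (q i).
Proof.
by rewrite patch_energyC patch_energy_suml; apply: eq_bigr => i _; rewrite patch_energyC.
Qed.

Lemma eq_patch_energy q q' r r' :
  (forall s, q (T1 F) s = q' (T1 F) s) -> (forall s, q (T2 F) s = q' (T2 F) s) ->
  (forall s, r (T1 F) s = r' (T1 F) s) -> (forall s, r (T2 F) s = r' (T2 F) s) ->
  patch_energy F q r = patch_energy F q' r'.
Proof. by move=> /funext q1 /funext q2 /funext r1 /funext r2; rewrite /patch_energy q1 q2 r1 r2. Qed.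

(** Linear coordinates on [QF F]: the upper and lower halves of [x] are the negative-side gradients
    on the two cells, and [ext] supplies the positive side. *)
Definition qfield (x : 'cV[R]_(N + N)) : bfield M := fun T s =>
  if T == T1 F then ext T s (usubmx x)^T
  else if T == T2 F then ext T s (dsubmx x)^T else 0.

Lemma qfield1 x s : qfield x (T1 F) s = ext (T1 F) s (usubmx x)^T.
Proof. by rewrite /qfield eqxx. Qed.

Lemma qfield2 x s : qfield x (T2 F) s = ext (T2 F) s (dsubmx x)^T.
Proof. by rewrite /qfield eqxx eq_sym (negPf n12). Qed.

Lemma qfield_sum x : qfield x =
  fun T s => \sum_i x i 0 *: qfield (delta_mx i 0) T s.
Proof.
apply/funext => T; apply/funext => s; rewrite /qfield.
have dE (k : 'I_(N + N)) : x k 0 = \sum_i x i 0 * (delta_mx i 0 : 'cV[R]_(N + N)) k 0.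
  rewrite (bigD1 k)//= mxE !eqxx mulr1 big1 ?addr0// => i ik.
  by rewrite mxE eq_sym (negPf ik) mulr0.
case: ifP => _.
  rewrite -ext_sum; congr ext; apply/rowP => k; rewrite !mxE dE summxE.
  by apply: eq_bigr => i _; rewrite !mxE.
case: ifP => _; last by rewrite big1// => i _; rewrite scaler0.
rewrite -ext_sum; congr ext; apply/rowP => k; rewrite !mxE dE summxE.
by apply: eq_bigr => i _; rewrite !mxE.
Qed.

Lemma qfield_QF x : QF P D F (qfield x).
Proof.
split => [||T s n1 n2].
- exists (fun s => (ext (T1 F) s (usubmx x)^T, if s then - (kap P D (T1 F) * dot (usubmx x)^T (nh D (T1 F)) * ch D (T1 F)) else 0)).
  split; last by move=> s; rewrite qfield1.
  exact: (ext_local_space hO htri hok hmin _ TM1).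
- exists (fun s => (ext (T2 F) s (dsubmx x)^T, if s then - (kap P D (T2 F) * dot (dsubmx x)^T (nh D (T2 F)) * ch D (T2 F)) else 0)).
  split; last by move=> s; rewrite qfield2.
  exact: (ext_local_space hO htri hok hmin _ TM2).
- by rewrite /qfield (negPf n1) (negPf n2).
Qed.

Lemma QF_qfield q : QF P D F q -> exists x, q = qfield x.
Proof.
move=> [[p1 [l1 e1]] [p2 [l2 e2]] q0].
exists (col_mx (p1 false).1^T (p2 false).1^T); apply/funext => T; apply/funext => s.
rewrite /qfield col_mxKu col_mxKd !trmxK.
have [->|n1] := eqVneq T (T1 F).
  by rewrite e1; have [E _] := local_spaceE hO htri hok hmin TM1 l1; exact: E.
have [->|n2] := eqVneq T (T2 F); last exact: q0.
by rewrite e2; have [E _] := local_spaceE hO htri hok hmin TM2 l2; exact: E.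
Qed.

Lemma qfield_energy_lower (v : R) x : v <= vol (osimplex (T1 F)) -> v <= vol (osimplex (T2 F)) ->
  b0 * (contrast K)^-1 ^+ 2 * v *
    (dot (usubmx x)^T (usubmx x)^T + dot (dsubmx x)^T (dsubmx x)^T) <=
  patch_energy F (qfield x) (qfield x).
Proof.
move=> v1 v2; have -> : patch_energy F (qfield x) (qfield x) =
    energy (T1 F) (ext (T1 F) ^~ (usubmx x)^T) (ext (T1 F) ^~ (usubmx x)^T) +
    energy (T2 F) (ext (T2 F) ^~ (dsubmx x)^T) (ext (T2 F) ^~ (dsubmx x)^T).
  by rewrite /patch_energy (funext (qfield1 x)) (funext (qfield2 x)).
have c0 : 0 <= b0 * (contrast K)^-1 ^+ 2 by rewrite mulr_ge0 ?sqr_ge0 ?ltW.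
rewrite mulrDr lerD//.
  apply: le_trans (ext_energy_lower _ TM1).
  move: (_ ^+ 2) (dot _ _) (dot_ge0 (usubmx x)^T) c0 => k d d0 c0.
  by rewrite (_ : b0 * (k * d) * _ = b0 * k * (vol (osimplex (T1 F)) * d)) -?(mulrA _ v) ?ler_wpM2l ?ler_wpM2r//; ring.
apply: le_trans (ext_energy_lower _ TM2).
move: (_ ^+ 2) (dot _ _) (dot_ge0 (dsubmx x)^T) c0 => k d d0 c0.
by rewrite (_ : b0 * (k * d) * _ = b0 * k * (vol (osimplex (T2 F)) * d)) -?(mulrA _ v) ?ler_wpM2l ?ler_wpM2r//; ring.
Qed.

Lemma patch_energy_young q r : `|2 * patch_energy F q r| <=
  8 * patch_energy F q q + 8^-1 * patch_energy F r r.
Proof.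
have H1 := energy_young hP htri hok b00 hb TM1 (q (T1 F)) (r (T1 F)).
have H2 := energy_young hP htri hok b00 hb TM2 (q (T2 F)) (r (T2 F)).
rewrite /patch_energy !mulrDr (le_trans (ler_normD _ _))//.
by rewrite [leRHS]addrACA lerD.
Qed.

Lemma is_liftingP f r : is_lifting P D F f r <-> QF P D F r /\ forall q, QF P D F q ->
  patch_energy F r q = face_integral F (fun x => flux_average P D q F x * f x).
Proof.
split=> -[rQ H]; split=> // q /H; rewrite (patch_integralE hP htri hok b00 hb r q FI)//.
Qed.

End interior_face_patch.

Section lifting_of.
Variables (F : simplex) (FG : F \in Gfaces P M).
Let FI := Gface_interior hN hP htri FG.
Let FM := Gface_faces FG.
Let cellsF := interior_two_cells htri FI.
Let TM1 : T1 F \in cells M. Proof. by case: cellsF. Qed.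
Let TM2 : T2 F \in cells M. Proof. by case: cellsF. Qed.

Lemma flux_moment_mbounded f q : face_mbounded P D F f ->
  face_mbounded P D F (fun x => flux_average P D q F x * f x).
Proof.
by move=> bf; apply: face_mboundedM => //; exact: (flux_face_mbounded hN hP htri hok b00 hb _ FG).
Qed.

Lemma flux_moment_sum f (I : Type) (js : seq I) (c : I -> R) (q : I -> bfield M) :
  face_mbounded P D F f ->
  face_integral F (fun x => flux_average P D (fun T s => \sum_(i <- js) c i *: q i T s) F x * f x) =
  \sum_(i <- js) c i * face_integral F (fun x => flux_average P D (q i) F x * f x).
Proof.
move=> bf; rewrite -(face_integral_sum hN hP htri hok FM); last first.
  by move=> i; exact: flux_moment_mbounded.
congr face_integral; apply/funext => x; rewrite /flux_average !dot_suml !mulr_sumr -big_split.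
rewrite mulr_suml mulr_suml; apply: eq_bigr => i _ /=; rewrite !dotZl.
move: (betaBK _ _ _) (dot _ _) (dot _ _) (c i) (f x) => a b d e g; ring.
Qed.

Lemma lifting_exists f : face_mbounded P D F f -> exists r, is_lifting P D F f r.
Proof.
(* The Gram matrix of the patch energy in the coordinates of [qfield]. It is positive definite
   because both cells have positive volume, so the lifting solves a linear system. *)
move=> bf; pose A : 'M[R]_(N + N) :=
  \matrix_(i, j) patch_energy F (qfield F (delta_mx i 0)) (qfield F (delta_mx j 0)).
have qA x y : qform A x y = patch_energy F (qfield F x) (qfield F y).
  rewrite qform_sum [in RHS](qfield_sum F x) (patch_energy_suml FI); apply: eq_bigr => i _.
  rewrite [in RHS](qfield_sum F y) (patch_energy_sumr FI) mulr_sumr.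
  by apply: eq_bigr => j _; rewrite mxE mulrA.
have Au : A \in unitmx.
  apply: posdef_unitmx => x x0; rewrite qA.
  pose v := Num.min (vol (osimplex (T1 F))) (vol (osimplex (T2 F))).
  have v0 : 0 < v by rewrite lt_min !vol_cell_gt0.
  apply: (@lt_le_trans _ _ (b0 * (contrast K)^-1 ^+ 2 * v *
    (dot (usubmx x)^T (usubmx x)^T + dot (dsubmx x)^T (dsubmx x)^T))).
    rewrite !mulr_gt0 ?exprn_gt0 ?invr_gt0 ?contrast_gt0//.
    rewrite lt_neqAle addr_ge0 ?dot_ge0// andbT eq_sym; apply/eqP => d0.
    have := dot_ge0 (usubmx x)^T; have := dot_ge0 (dsubmx x)^T => h1 h2.
    have /eqP : dot (usubmx x)^T (usubmx x)^T = 0 by lra.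
    have /eqP : dot (dsubmx x)^T (dsubmx x)^T = 0 by lra.
    rewrite !dot_eq0 => /eqP d1 /eqP u1; move/eqP: x0; apply.
    rewrite -[x]vsubmxK -[usubmx x]trmxK -[dsubmx x]trmxK u1 d1 !trmx0.
    exact: col_mx0.
  by apply: qfield_energy_lower => //; rewrite ge_min lexx ?orbT.
have sA : A^T = A by apply/matrixP => i j; rewrite !mxE patch_energyC.
pose b : 'cV[R]_(N + N) := \col_j face_integral F (fun x => flux_average P D (qfield F (delta_mx j 0)) F x * f x).
pose y := invmx A *m b.
exists (qfield F y); apply/(is_liftingP FI); split; first exact: (qfield_QF FI).
move=> q /(QF_qfield FI)[z ->]; rewrite -qA qformC// /qform -mulmxA mulKVmx//.
rewrite (qfield_sum F z) flux_moment_sum// mxE; apply: eq_bigr => i _.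
by rewrite !mxE.
Qed.

Lemma lifting_spec f : face_mbounded P D F f -> is_lifting P D F f (lifting P D F f).
Proof. by move=> /lifting_exists[r rP]; exact: (@xgetPex _ _ [set r | is_lifting P D F f r]) (ex_intro _ r rP). Qed.

End lifting_of.

End liftings.

(** * The stiffness matrix as a quadratic form *)

Section quadratic_form.
Context {R : realType} {N : nat} (P : interface_problem R N) (M : mesh R N).
Context (D : discrete_interface M) (K : constants R).
Local Notation simplex := {set 'I_(nv M)}.
Local Notation nI := #|interior_faces M|.
Implicit Types (T F : simplex) (s : bool) (q r : bfield M) (f : 'rV[R]_N -> R) (x : 'cV[R]_nI).
Hypotheses (hN : N = 2%N \/ N = 3%N) (hP : well_posed P)
  (htri : triangulation P M) (hok : discrete_interface_ok P D K)
  (hmin : 0 < coef_min K).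
Variables (rho b0 b1 : R).
Hypotheses (hrho : forall T, T \in cells M -> hT T <= rho * rT T) (b00 : 0 < b0)
  (hb : forall s y, closure (Omegas_ext P s) y -> b0 <= betaE P s y <= b1).
Variable phi : 'I_nI -> broken M.
Hypothesis hphi : nodal_basis P D phi.
Let N0 : (0 < N)%N. Proof. by case: hN => ->. Qed.
Let hO : convex_polytope_domain (Omega P). Proof. by case: hP. Qed.
Local Notation energy := (energy P D).
Local Notation patch_energy := (patch_energy P D).

Lemma interior_faces_faces F : F \in interior_faces M -> F \in faces M.
Proof. by rewrite inE => /andP[]. Qed.

Definition comb x : broken M := fun T s =>
  (\sum_i x i 0 *: (phi i T s).1, \sum_i x i 0 * (phi i T s).2).

Lemma comb_aff x T s y : aff (comb x T s) y = \sum_i x i 0 * aff (phi i T s) y.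
Proof.
rewrite /aff dot_suml -big_split; apply: eq_bigr => i _ /=.
by rewrite dotZl mulrDr.
Qed.

Lemma comb_jump x F : jump D (comb x) F = fun y => \sum_i x i 0 * jump D (phi i) F y.
Proof.
apply/funext => y; rewrite /jump /value !comb_aff -sumrB.
by apply: eq_bigr => i _; rewrite mulrBr.
Qed.

Lemma basis_local i T : T \in cells M -> local_space P D T (phi i T).
Proof. by have [[[+ _] _] _] := hphi i; apply. Qed.

Lemma comb_local x T : T \in cells M -> local_space P D T (comb x T).
Proof.
move=> TM; have := fun i => basis_local i TM; rewrite /local_space.
case: (boolP (T \in Gcells P M)) => _ H; last first.
  by rewrite /comb; congr pair; apply: eq_bigr => i _; rewrite H.
split=> [y yT|].
  by rewrite !comb_aff; apply: eq_bigr => i _; have [E _] := H i; rewrite (E y yT).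
rewrite /= !dot_suml !mulr_sumr; apply: eq_bigr => i _.
by rewrite !dotZl mulrCA [RHS]mulrCA; have [_ ->] := H i.
Qed.

(** The vector [x] seen as a function on all faces, with value 0 off the interior ones: the face
    function to which the Poincare inequality is applied. *)
Definition coef x F : R := \sum_i x i 0 * (F == enum_val i)%:R.

Lemma comb_mean x T F : T \in cells M -> F \in faces M -> F \subset T ->
  face_mean F (fun y => aff (comb x T (side D y)) y) = coef x F.
Proof.
move=> TM FM FT; under eq_fun do rewrite comb_aff.
rewrite (face_mean_sum hN hP htri hok FM); last first.
  by move=> i; exact: (value_face_mbounded hN htri hok FM (phi i T) TM FT).
apply: eq_bigr => i _; congr (_ * _).
by have [_ ->//] := hphi i; rewrite sub_face_cells TM.
Qed.

Lemma coef_enum_val x i : coef x (enum_val i) = x i 0.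
Proof.
rewrite /coef (bigD1 i)//= eqxx mulr1 big1 ?addr0// => j ji.
by rewrite (inj_eq enum_val_inj) eq_sym (negPf ji) mulr0.
Qed.

Lemma coef_out x F : F \notin interior_faces M -> coef x F = 0.
Proof.
move=> nF; rewrite /coef big1// => i _; case: eqP => [E|_]; last by rewrite mulr0.
by move: nF; rewrite E enum_valP.
Qed.

Lemma sum_coef_sqr x : \sum_(F in faces M) coef x F ^+ 2 = dot x^T x^T.
Proof.
rewrite (bigID [in interior_faces M])/= [X in _ + X]big1 ?addr0 => [|F /andP[_ nF]]; last first.
  by rewrite coef_out ?expr0n.
rewrite (eq_bigl [in interior_faces M]) => [|F]; last first.
  by rewrite andb_idl// => /interior_faces_faces.
rewrite big_enum_val; apply: eq_bigr => i _.
by rewrite coef_enum_val !mxE expr2.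
Qed.

Definition basis_lift i F : bfield M := lifting P D F (jump D (phi i) F).

Lemma basis_lift_spec i F : F \in Gfaces P M -> is_lifting P D F (jump D (phi i) F) (basis_lift i F).
Proof.
move=> FG; apply: (lifting_spec hN hP htri hok hmin hrho b00 hb FG).
exact: (jump_face_mbounded hN htri hok _ (Gface_interior hN hP htri FG)).
Qed.

(** The defining property of liftings turns the consistency term [form_b] into
    volume integrals. *)
Lemma gradient_moment F v f r : F \in Gfaces P M ->
  (forall T, T \in cells M -> local_space P D T (v T)) -> is_lifting P D F f r ->
  face_integral F (fun y => flux_average P D (gradh v) F y * f y) =
  patch_energy F r (gradh v).
Proof.
move=> FG vl /(is_liftingP hP htri hok b00 hb (Gface_interior hN hP htri FG))[_ H].
have [h1 h2 _ _ n12] := interior_two_cells htri (Gface_interior hN hP htri FG).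
pose q : bfield M := fun T s => if (T == T1 F) || (T == T2 F) then gradh v T s else 0.
have q1 s : q (T1 F) s = gradh v (T1 F) s by rewrite /q eqxx.
have q2 s : q (T2 F) s = gradh v (T2 F) s by rewrite /q eqxx orbT.
have QFq : QF P D F q.
  split=> [||T s n1 n2]; last by rewrite /q (negPf n1) (negPf n2).
    by exists (v (T1 F)); split; [exact: vl|exact: q1].
  by exists (v (T2 F)); split; [exact: vl|exact: q2].
transitivity (patch_energy F r q); last exact: eq_patch_energy.
rewrite H//; congr face_integral; apply/funext => y.
by rewrite /flux_average q1 q2.
Qed.

Lemma form_A_basis i j : form_A P D (phi i) (phi j) =
  \sum_(T in cells M) energy T (gradh (phi i) T) (gradh (phi j) T) -
  \sum_(F in Gfaces P M) (patch_energy F (basis_lift j F) (gradh (phi i)) +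
                          patch_energy F (basis_lift i F) (gradh (phi j))) +
  8 * \sum_(F in Gfaces P M) patch_energy F (basis_lift i F) (basis_lift j F).
Proof.
rewrite /form_A (form_aE hP htri hok b00 hb); congr (_ + _ + _).
  rewrite /form_b; congr (- _); apply: eq_bigr => F FG.
  have FM := Gface_faces FG; have FI := Gface_interior hN hP htri FG.
  have bj k := jump_face_mbounded hN htri hok (phi k) FI.
  have bf k l := flux_moment_mbounded hN hP htri hok b00 hb FG (gradh (phi k)) (bj l).
  rewrite (face_integralD hN hP htri hok FM (bf _ _) (bf _ _)).
  rewrite (gradient_moment FG (basis_local i) (basis_lift_spec j FG)).
  by rewrite (gradient_moment FG (basis_local j) (basis_lift_spec i FG)).
rewrite /form_s; congr (_ * _); apply: eq_bigr => F FG.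
exact: (patch_integralE hP htri hok b00 hb _ _ (Gface_interior hN hP htri FG)).
Qed.

Lemma stiffness_sym : (stiffness P D phi)^T = stiffness P D phi.
Proof.
pose a i j := \sum_(T in cells M) energy T (gradh (phi i) T) (gradh (phi j) T).
pose b i j := \sum_(F in Gfaces P M) (patch_energy F (basis_lift j F) (gradh (phi i)) +
                                      patch_energy F (basis_lift i F) (gradh (phi j))).
pose c i j := \sum_(F in Gfaces P M) patch_energy F (basis_lift i F) (basis_lift j F).
have aC i j : a i j = a j i by apply: eq_bigr => T _; exact: energyC.
have bC i j : b i j = b j i by apply: eq_bigr => F _; exact: addrC.
have cC i j : c i j = c j i by apply: eq_bigr => F _; exact: patch_energyC.
have E i j : form_A P D (phi i) (phi j) = a i j - b i j + 8 * c i j := form_A_basis i j.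
move: a b c aC bC cC E => a b c aC bC cC E.
by apply/matrixP => i j; rewrite mxE [LHS]mxE [RHS]mxE !E aC bC cC.
Qed.

(** Combining the chosen liftings of the basis jumps lets the form expand bilinearly, without appeal
    to uniqueness of liftings. *)
Definition comb_lift x F : bfield M := fun T s => \sum_i x i 0 *: basis_lift i F T s.

Let dsum x (f : 'I_nI -> 'I_nI -> R) : R := \sum_i \sum_j x i 0 * x j 0 * f i j.

Let dsumD x (f g : 'I_nI -> 'I_nI -> R) : dsum x (fun i j => f i j + g i j) = dsum x f + dsum x g.
Proof.
rewrite /dsum -big_split; apply: eq_bigr => i _; rewrite -big_split.
by apply: eq_bigr => j _; exact: mulrDr.
Qed.

Let dsumZ x c (f : 'I_nI -> 'I_nI -> R) : dsum x (fun i j => c * f i j) = c * dsum x f.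
Proof.
rewrite /dsum mulr_sumr; apply: eq_bigr => i _; rewrite mulr_sumr.
by apply: eq_bigr => j _; exact: mulrCA.
Qed.

Let dsum_sum x (J : finType) (Q : pred J) (f : J -> 'I_nI -> 'I_nI -> R) :
  dsum x (fun i j => \sum_(t | Q t) f t i j) = \sum_(t | Q t) dsum x (f t).
Proof.
rewrite /dsum [RHS]exchange_big; apply: eq_bigr => i _; rewrite [RHS]exchange_big.
by apply: eq_bigr => j _; rewrite mulr_sumr.
Qed.

Lemma quadratic_form x : qform (stiffness P D phi) x x =
  \sum_(T in cells M) energy T (gradh (comb x) T) (gradh (comb x) T) -
  2 * \sum_(F in Gfaces P M) patch_energy F (comb_lift x F) (gradh (comb x)) +
  8 * \sum_(F in Gfaces P M) patch_energy F (comb_lift x F) (comb_lift x F).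
Proof.
have -> : qform (stiffness P D phi) x x = dsum x (fun i j =>
    \sum_(T in cells M) energy T (gradh (phi i) T) (gradh (phi j) T) +
    (- 1) * (\sum_(F in Gfaces P M) (patch_energy F (basis_lift j F) (gradh (phi i)) +
                          patch_energy F (basis_lift i F) (gradh (phi j)))) +
    8 * \sum_(F in Gfaces P M) patch_energy F (basis_lift i F) (basis_lift j F)).
  rewrite qform_sum; apply: eq_bigr => i _; apply: eq_bigr => j _.
  by rewrite [X in _ * X]mxE form_A_basis mulN1r.
have Ea : dsum x (fun i j => \sum_(T in cells M) energy T (gradh (phi i) T) (gradh (phi j) T)) =
    \sum_(T in cells M) energy T (gradh (comb x) T) (gradh (comb x) T).
  rewrite dsum_sum; apply: eq_bigr => T TM.
  rewrite [RHS](energy_suml hP htri hok b00 hb TM); apply: eq_bigr => i _.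
  rewrite energyC (energy_suml hP htri hok b00 hb TM) mulr_sumr; apply: eq_bigr => j _.
  by rewrite energyC mulrA.
have Eb : dsum x (fun i j => \sum_(F in Gfaces P M) (patch_energy F (basis_lift j F) (gradh (phi i)) +
                          patch_energy F (basis_lift i F) (gradh (phi j)))) =
    2 * \sum_(F in Gfaces P M) patch_energy F (comb_lift x F) (gradh (comb x)).
  rewrite dsum_sum mulr_sumr; apply: eq_bigr => F FG.
  have FI := Gface_interior hN hP htri FG.
  have E : dsum x (fun i j => patch_energy F (basis_lift i F) (gradh (phi j))) =
      patch_energy F (comb_lift x F) (gradh (comb x)).
    rewrite [RHS](patch_energy_suml hP htri hok b00 hb FI); apply: eq_bigr => i _.
    rewrite (patch_energy_sumr hP htri hok b00 hb FI) mulr_sumr; apply: eq_bigr => j _.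
    by rewrite mulrA.
  have E' : dsum x (fun i j => patch_energy F (basis_lift j F) (gradh (phi i))) =
      patch_energy F (comb_lift x F) (gradh (comb x)).
    rewrite -E /dsum exchange_big; apply: eq_bigr => i _; apply: eq_bigr => j _.
    by rewrite (mulrC (x j 0)).
  by rewrite dsumD E E' mulr2n mulrDl mul1r.
have Ec : dsum x (fun i j => \sum_(F in Gfaces P M) patch_energy F (basis_lift i F) (basis_lift j F)) =
    \sum_(F in Gfaces P M) patch_energy F (comb_lift x F) (comb_lift x F).
  rewrite dsum_sum; apply: eq_bigr => F FG; have FI := Gface_interior hN hP htri FG.
  rewrite [RHS](patch_energy_suml hP htri hok b00 hb FI); apply: eq_bigr => i _.
  rewrite (patch_energy_sumr hP htri hok b00 hb FI) mulr_sumr; apply: eq_bigr => j _.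
  by rewrite mulrA.
by rewrite !dsumD !dsumZ Ea Eb Ec mulN1r.
Qed.

Lemma comb_liftP x F : F \in Gfaces P M ->
  (exists y, comb_lift x F = qfield P D F y) /\
  patch_energy F (comb_lift x F) (comb_lift x F) =
  face_integral F (fun y => flux_average P D (comb_lift x F) F y * jump D (comb x) F y).
Proof.
move=> FG; have FI := Gface_interior hN hP htri FG; have FM := Gface_faces FG.
have S i := (is_liftingP hP htri hok b00 hb FI _ _).1 (basis_lift_spec i FG).
have /choice[y yP] : forall i, exists y, basis_lift i F = qfield P D F y.
  by move=> i; have [/(QF_qfield hP htri hok hmin FI)] := S i.
have E : comb_lift x F = qfield P D F (\sum_i x i 0 *: y i).
  apply/funext => T; apply/funext => s; rewrite /comb_lift.
  under eq_bigr do rewrite yP.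
  rewrite /qfield; case: ifP => _.
    rewrite -ext_sum; congr ext; apply/rowP => k; rewrite !mxE !summxE.
    by apply: eq_bigr => i _; rewrite !mxE.
  case: ifP => _; last by rewrite big1// => i _; rewrite scaler0.
  rewrite -ext_sum; congr ext; apply/rowP => k; rewrite !mxE !summxE.
  by apply: eq_bigr => i _; rewrite !mxE.
split; first by exists (\sum_i x i 0 *: y i).
have Qr : QF P D F (comb_lift x F) by rewrite E; exact: (qfield_QF hP htri hok hmin FI).
rewrite {1}/comb_lift (patch_energy_suml hP htri hok b00 hb FI) comb_jump.
rewrite (_ : (fun y => _ * _) = fun y =>
    \sum_i x i 0 * (flux_average P D (comb_lift x F) F y * jump D (phi i) F y)); last first.
  by apply/funext => z; rewrite mulr_sumr; apply: eq_bigr => i _; rewrite mulrCA.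
rewrite (face_integral_sum hN hP htri hok FM); last first.
  move=> i; apply: (flux_moment_mbounded hN hP htri hok b00 hb FG).
  exact: (jump_face_mbounded hN htri hok _ FI).
by apply: eq_bigr => i _; have [_ ->] := S i.
Qed.

End quadratic_form.

(** * Bounds of the quadratic form *)

Section spectral_bounds.
Context {R : realType} {N : nat} (P : interface_problem R N) (M : mesh R N).
Context (D : discrete_interface M) (K : constants R).
Local Notation simplex := {set 'I_(nv M)}.
Local Notation nI := #|interior_faces M|.
Implicit Types (T F : simplex) (s : bool) (x : 'cV[R]_nI).
Hypotheses (hN : N = 2%N \/ N = 3%N) (hP : well_posed P)
  (htri : triangulation P M) (hok : discrete_interface_ok P D K)
  (hmin : 0 < coef_min K)
  (hin : forall T, T \in Gcells P M -> csimplex T `<=` Omega P).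
Variables (rho b0 b1 h q Dm : R).
Hypotheses (hrho : forall T, T \in cells M -> hT T <= rho * rT T) (b00 : 0 < b0)
  (hb : forall s y, closure (Omegas_ext P s) y -> b0 <= betaE P s y <= b1)
  (HD : forall y, closure (Omega P) y -> enorm y <= Dm)
  (h0 : 0 < h)
  (hle : forall T, T \in cells M -> hT T <= h)
  (hge : forall T, T \in cells M -> h <= q * hT T).
Variable phi : 'I_nI -> broken M.
Hypothesis hphi : nodal_basis P D phi.
Let N0 : (0 < N)%N. Proof. by case: hN => ->. Qed.
Let hO : convex_polytope_domain (Omega P). Proof. by case: hP. Qed.
Local Notation energy := (energy P D).
Local Notation patch_energy := (patch_energy P D).
Local Notation comb := (comb phi).
Local Notation comb_lift := (comb_lift P D phi).

Let c := contrast K.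
(** Every cell contains a cube of side [h / w]. *)
Let w := 2 * q * rho * N%:R.
Let stb := @stab R N K.
Let V := 1 + (1 + 2 * c) * (rho * stb).
Let Cp := @poincare_constant R N Dm rho q.

Definition face_sum x T : R := \sum_(F in faces M | F \subset T) coef x F ^+ 2.
Definition base_grad x T : 'rV[R]_N := (comb x T false).1.

Let c0 : 0 < c := contrast_gt0 K.
Let NR : 0 < N%:R :> R. Proof. by rewrite ltr0n. Qed.

Let stb0 : 0 < stb.
Proof. by rewrite /stb /stab mulr_gt0 ?mulr_gt0// addr_gt0 ?mulr_gt0. Qed.

Lemma shape_constants_gt0 T : T \in cells M -> 0 < rho /\ 0 < q.
Proof.
move=> TM; have fT := cell_full htri TM; have [rho0 _] := inscribed_ball fT N0 (hrho TM).
by split=> //; have := hT_gt0 fT N0; have := lt_le_trans h0 (hge TM); nra.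
Qed.

Lemma vol_cell_ge T : T \in cells M -> (h / w) ^+ N <= vol (osimplex T).
Proof.
move=> TM; have fT := cell_full htri TM; have [rho0 q0] := shape_constants_gt0 TM.
apply: le_trans (vol_osimplex_ge fT N0 (hrho TM)).
have w0 : 0 < w by rewrite !mulr_gt0.
apply: lerXn2r; rewrite ?nnegrE ?divr_ge0 ?mulr_ge0 ?(ltW h0) ?(ltW q0) ?(ltW rho0) ?hT_ge0//.
rewrite ler_pdivrMr// /w.
rewrite (_ : hT T / (2 * rho * N%:R) * (2 * q * rho * N%:R) = q * hT T) ?hge//.
by field; rewrite !gt_eqF.
Qed.

Lemma vol_cell_le T : T \in cells M -> vol (osimplex T) <= (2 * h) ^+ N.
Proof.
move=> TM; have fT := cell_full htri TM; apply: (le_trans (vol_osimplex_le fT)).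
by apply: lerXn2r; rewrite ?nnegrE ?mulr_ge0 ?(ltW h0) ?hT_ge0// ler_wpM2l// hle.
Qed.

Lemma gradh_comb x T : T \in cells M -> gradh (comb x) T = ext P D T ^~ (base_grad x T).
Proof.
move=> TM; apply/funext => s.
by have [E _] := local_spaceE hO htri hok hmin TM (comb_local hphi x TM); exact: E.
Qed.

Lemma face_sum_ge0 x T : 0 <= face_sum x T.
Proof. by apply: sumr_ge0 => F _; exact: sqr_ge0. Qed.

Lemma coef_le_face_sum x T F : F \in faces M -> F \subset T ->
  `|coef x F| <= Num.sqrt (face_sum x T).
Proof.
move=> FM FT; rewrite -sqrtr_sqr ler_wsqrtr// /face_sum (bigD1 F) ?FM//= lerDl.
by apply: sumr_ge0 => E _; exact: sqr_ge0.
Qed.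

Lemma comb_means_le x T F : T \in cells M -> F \in faces M -> F \subset T ->
  `|face_mean F (fun y => aff (comb x T (side D y)) y)| <= Num.sqrt (face_sum x T).
Proof.
by move=> TM FM FT; rewrite (comb_mean hN hP htri hok hphi)//; exact: coef_le_face_sum.
Qed.

Lemma base_grad_le x T : T \in cells M ->
  dot (base_grad x T) (base_grad x T) * h ^+ 2 <= (q * (rho * stb)) ^+ 2 * face_sum x T.
Proof.
move=> TM; have [rho0 q0] := shape_constants_gt0 TM.
have H := local_stability hN hO htri hok hmin hin TM (hrho TM) (comb_local hphi x TM)
  (fun F FM FT => comb_means_le x TM FM FT).
have S0 := face_sum_ge0 x T.
have H2 : enorm (base_grad x T) * h <= q * (rho * stb) * Num.sqrt (face_sum x T).
  apply: (@le_trans _ _ (enorm (base_grad x T) * (q * hT T))).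
    by rewrite ler_wpM2l ?enorm_ge0// hge.
  by rewrite mulrCA -[leRHS]mulrA ler_wpM2l ?(ltW q0).
rewrite -enorm_sqr -(sqr_sqrtr S0) -!exprMn.
have k0 : 0 <= q * (rho * stb) by rewrite ltW// mulr_gt0// mulr_gt0.
by apply: lerXn2r => //; rewrite nnegrE mulr_ge0 ?enorm_ge0 ?sqrtr_ge0// ltW.
Qed.

Lemma comb_value_le x T s y : T \in cells M -> csimplex T y ->
  `|aff (comb x T s) y| <= V * Num.sqrt (face_sum x T).
Proof.
move=> TM yT; apply: (value_bound hN hO htri hok hmin hin TM (hrho TM) (comb_local hphi x TM)) => //.
by move=> F FM FT; exact: comb_means_le.
Qed.

Definition total_energy x : R := \sum_(T in cells M) energy T (gradh (comb x) T) (gradh (comb x) T).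

Lemma total_energy_ge x :
  b0 * c^-1 ^+ 2 * (h / w) ^+ N * \sum_(T in cells M) dot (base_grad x T) (base_grad x T) <=
  total_energy x.
Proof.
rewrite mulr_sumr; apply: ler_sum => T TM; rewrite (gradh_comb x TM).
apply: le_trans (ext_energy_lower hP htri hok hmin b00 hb (base_grad x T) TM).
have := vol_cell_ge TM; have := dot_ge0 (base_grad x T).
have k0 : 0 <= b0 * c^-1 ^+ 2 by rewrite mulr_ge0 ?sqr_ge0 ?ltW.
rewrite -/c; move: (c^-1 ^+ 2) (dot _ _) ((h / w) ^+ N) (vol _) k0 => k d v v' k0 d0 vv.
rewrite (_ : b0 * (k * d) * v' = b0 * k * (v' * d)); last by ring.
by rewrite -mulrA ler_wpM2l// ler_wpM2r.
Qed.

Lemma total_energy_le x :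
  total_energy x * h ^+ 2 <=
  b1 * c ^+ 2 * (2 * h) ^+ N * (q * (rho * stb)) ^+ 2 * \sum_(T in cells M) face_sum x T.
Proof.
rewrite mulr_suml mulr_sumr; apply: ler_sum => T TM; rewrite (gradh_comb x TM).
have H := ext_energy_upper hP htri hok hmin b00 hb (base_grad x T) TM.
have vT := vol_cell_le TM; have d0 := dot_ge0 (base_grad x T).
have v0 : 0 <= (2 * h) ^+ N by rewrite exprn_ge0// mulr_ge0// ltW.
have bb : 0 <= b1.
  have [y yT] := osimplex_nonempty (card_cell_gt0 (cell_full htri TM)).
  have /andP[h1 h2] := betaBK_bounds hok hb (osimplex_Omega hO htri TM yT).
  by rewrite (le_trans _ (le_trans h1 h2))// ltW.
have g2 := base_grad_le x TM.
apply: (@le_trans _ _ (b1 * c ^+ 2 * (2 * h) ^+ N * (dot (base_grad x T) (base_grad x T) * h ^+ 2))); last first.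
  by rewrite -[leRHS]mulrA ler_wpM2l// mulr_ge0// mulr_ge0// sqr_ge0.
rewrite mulrA ler_wpM2r ?sqr_ge0//; apply: (le_trans H); rewrite -/c.
move: (c ^+ 2) (sqr_ge0 c) (dot _ _) d0 (vol _) ((2 * h) ^+ N) vT v0 => k k0 d d0 v' v vv v0.
rewrite (_ : b1 * (k * d) * v' = b1 * k * d * v'); last by ring.
rewrite (_ : b1 * k * v * d = b1 * k * d * v); last by ring.
by apply: ler_wpM2l => //; rewrite !mulr_ge0.
Qed.

Lemma sum_face_sum x : \sum_(T in cells M) face_sum x T <= 2 * dot x^T x^T.
Proof.
rewrite -sum_coef_sqr mulr_sumr (exchange_big_dep [in faces M])/=; last first.
  by move=> T F _ /andP[].
apply: ler_sum => F FM.
have [FI|nF] := boolP (F \in interior_faces M); last first.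
  by rewrite coef_out// expr0n mulr0 big1.
rewrite (eq_bigl [in face_cells F]); last by move=> T; rewrite sub_face_cells FM.
by rewrite sumr_const -[leLHS]mulr_natl; move: FI; rewrite inE => /andP[_ /eqP ->].
Qed.

Lemma patch_sum_le (f : simplex -> R) : (forall T, T \in cells M -> 0 <= f T) ->
  \sum_(F in Gfaces P M) (f (T1 F) + f (T2 F)) <= N.+1%:R * \sum_(T in cells M) f T.
Proof.
move=> f0; apply: (@le_trans _ _ (\sum_(F in Gfaces P M) \sum_(T in cells M | F \subset T) f T)).
  apply: ler_sum => F FG; have FI := Gface_interior hN hP htri FG.
  have [h1 h2 s1 s2 n12] := interior_two_cells htri FI.
  rewrite (bigD1 (T1 F)) ?h1//= (bigD1 (T2 F)) ?h2 ?s2 1?eq_sym//= addrA lerDl.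
  by apply: sumr_ge0 => T /andP[/andP[/andP[TM _] _] _]; exact: f0.
rewrite (exchange_big_dep [in cells M])/=; last by move=> F T _ /andP[].
rewrite mulr_sumr; apply: ler_sum => T TM.
rewrite (eq_bigl [in [set F in Gfaces P M | F \subset T]]); last first.
  by move=> F; rewrite inE TM.
rewrite sumr_const -[leLHS]mulr_natl ler_wpM2r ?f0// ler_nat.
apply: leq_trans (card_cell_faces htri TM); apply: subset_leq_card.
by apply/fintype.subsetP => F; rewrite !inE => /andP[/andP[-> _] ->].
Qed.

Lemma norm_le_gradients x : dot x^T x^T <=
  N.+1%:R * (Cp * (2 * (1 + c))) ^+ 2 *
    \sum_(T in cells M) dot (base_grad x T) (base_grad x T).
Proof.
(* Two face means of a cell are compared through the value at a common point, each at the cost given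
   by [mean_close]. *)
pose B T := 2 * (1 + c) * (enorm (base_grad x T) * h).
have B0 T : 0 <= B T.
  by rewrite /B mulr_ge0 ?mulr_ge0 ?enorm_ge0 ?(ltW h0)// addr_ge0// ltW.
have mB T F F' : T \in cells M -> F \in faces M -> F' \in faces M ->
    F \subset T -> F' \subset T -> `|coef x F - coef x F'| <= B T.
  move=> TM FM FM' FT FT'.
  rewrite -(comb_mean hN hP htri hok hphi x TM FM FT) -(comb_mean hN hP htri hok hphi x TM FM' FT').
  have [y yT] := osimplex_nonempty (card_cell_gt0 (cell_full htri TM)).
  have yc := osimplex_csimplex yT; have loc := comb_local hphi x TM.
  have := mean_close hN hO htri hok hmin hin TM FM FT loc yc.
  have := mean_close hN hO htri hok hmin hin TM FM' FT' loc yc.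
  have : (1 + c) * (enorm (comb x T false).1 * hT T) <= (1 + c) * (enorm (base_grad x T) * h).
    by rewrite ler_wpM2l ?addr_ge0 ?(ltW c0)// ler_wpM2l ?enorm_ge0// hle.
  rewrite -/c /B -mulrA; set e := (1 + c) * _; set e' := (1 + c) * _ => ee.
  move: (face_mean F _) (face_mean F' _) (aff _ _) => m1 m2 m3.
  by rewrite !ler_norml => /andP[? ?] /andP[? ?]; apply/andP; split; lra.
have m0 F : F \in faces M -> F \notin interior_faces M -> coef x F = 0.
  by move=> _; exact: coef_out.
have := poincare N0 htri HD hrho hle hge h0 B0 mB m0; rewrite sum_coef_sqr -/Cp => /le_trans; apply.
rewrite !mulr_sumr; apply: ler_sum => T TM; rewrite /B -enorm_sqr.
by rewrite le_eqVlt; apply/orP; left; apply/eqP; field; rewrite gt_eqF.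
Qed.

(** The absorption step after testing with itself: coercive in [u] from below, linear in [u] from
    above, hence [u] is at most [L / k]. *)
Lemma energy_sandwich (k u p L : R) : 0 < k -> 0 <= u -> 0 <= L ->
  k * u ^+ 2 <= p -> p <= L * u -> p <= L ^+ 2 / k.
Proof.
move=> k0 u0 L0 kp pL; rewrite ler_pdivlMr//.
have kuL : k * u <= L.
  move: u0; rewrite le_eqVlt => /predU1P[<-|u0]; first by rewrite mulr0.
  have : k * u ^+ 2 <= L * u := le_trans kp pL.
  by rewrite expr2 mulrA ler_pM2r.
apply: (le_trans (ler_wpM2r (ltW k0) pL)).
by rewrite -mulrA (mulrC u) expr2 ler_wpM2l.
Qed.

(** This is [L ^+ 2 / k] from [energy_sandwich] without its powers of [h]; the leading 2 comes from
    the square of a sum of two square roots. *)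
Definition lift_constant : R := 2 * (b1 * c * V) ^+ 2 * w ^+ N / (b0 * c^-1 ^+ 2).

Lemma lift_energy_le x F : F \in Gfaces P M ->
  patch_energy F (comb_lift x F) (comb_lift x F) * h ^+ 2 <=
  lift_constant * h ^+ N * (face_sum x (T1 F) + face_sum x (T2 F)).
Proof.
move=> FG; have FI := Gface_interior hN hP htri FG; have FM := Gface_faces FG.
have [h1 h2 s1 s2 n12] := interior_two_cells htri FI.
have [rho0 q0] := shape_constants_gt0 h1.
have w0 : 0 < w by rewrite !mulr_gt0.
have [[y yE] pE] := comb_liftP hN hP htri hok hmin hrho b00 hb phi x FG.
set r := comb_lift x F in yE pE *; set p := patch_energy F r r in pE *.
set S1 := face_sum x (T1 F); set S2 := face_sum x (T2 F).
have S10 : 0 <= S1 := face_sum_ge0 x _; have S20 : 0 <= S2 := face_sum_ge0 x _.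
pose g1 := (usubmx y)^T; pose g2 := (dsubmx y)^T.
pose u := Num.sqrt (dot g1 g1 + dot g2 g2).
have u2 : u ^+ 2 = dot g1 g1 + dot g2 g2 by rewrite sqr_sqrtr// addr_ge0 ?dot_ge0.
pose k := b0 * c^-1 ^+ 2 * (h / w) ^+ N.
have k0 : 0 < k by rewrite /k !mulr_gt0 ?exprn_gt0 ?invr_gt0 ?divr_gt0.
have low : k * u ^+ 2 <= p.
  rewrite u2 /p yE; apply: (qfield_energy_lower hP htri hok hmin b00 hb FI).
    exact: vol_cell_ge.
  exact: vol_cell_ge.
have V0 : 0 < V by rewrite /V addr_gt0// !mulr_gt0// addr_gt0// mulr_gt0.
have gu1 : enorm g1 <= u by rewrite /u ler_wsqrtr// lerDl dot_ge0.
have gu2 : enorm g2 <= u by rewrite /u ler_wsqrtr// lerDr dot_ge0.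
have bb : 0 <= b1.
  have [z zT] := osimplex_nonempty (card_cell_gt0 (cell_full htri h1)).
  have /andP[l1 l2] := betaBK_bounds hok hb (osimplex_Omega hO htri h1 zT).
  by rewrite (le_trans _ (le_trans l1 l2))// ltW.
have extle T s (g : 'rV[R]_N) : enorm (ext P D T s g) <= c * enorm g.
  have /andP[_ H] := ext_bounds hO htri hok hmin T s g.
  rewrite -(ler_sqr (enorm_ge0 _)) ?nnegrE ?mulr_ge0 ?enorm_ge0 ?(ltW c0)//.
  by rewrite exprMn !enorm_sqr.
have nF1 : enorm (nF F) = 1.
  by have [_ _ _ /(_ _ FI)[_ ->]] := htri.
pose m := Num.sqrt S1 + Num.sqrt S2.
have m0 : 0 <= m by rewrite addr_ge0 ?sqrtr_ge0.
pose L := h ^+ N.-1 * (b1 * c * V * m).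
have L0 : 0 <= L by rewrite /L !mulr_ge0 ?exprn_ge0 ?(ltW h0) ?(ltW c0) ?(ltW V0).
have up : p <= L * u.
  rewrite pE (le_trans (ler_norm _))//.
  have C0 : 0 <= b1 * c * V * m * u by rewrite !mulr_ge0 ?(ltW c0) ?(ltW V0) ?sqrtr_ge0.
  have bnd : face_mbounded P D F (fun z => flux_average P D r F z * jump D (comb x) F z).
    apply: (flux_moment_mbounded hN hP htri hok b00 hb FG).
    exact: (jump_face_mbounded hN htri hok _ FI).
  apply: (@le_trans _ _ (hT (T1 F) ^+ N.-1 * (b1 * c * V * m * u))); last first.
    rewrite /L -[leRHS]mulrA ler_wpM2r//; apply: lerXn2r; rewrite ?nnegrE ?(ltW h0) ?hle//.
    exact: hT_ge0 (cell_full htri h1).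
  apply: (face_integral_le hN hP htri hok FM h1 s1 C0 bnd) => t Ft.
  have xF := params_osimplex hN FM Ft; set z := face_map F t in xF *.
  have Oz := Gface_Omega hP htri FG xF.
  have /andP[l1 l2] := betaBK_bounds hok hb Oz.
  have z1 := sub_osimplex_csimplex htri h1 s1 xF.
  have z2 := sub_osimplex_csimplex htri h2 s2 xF.
  have jz : `|jump D (comb x) F z| <= V * m.
    rewrite /jump /value (le_trans (ler_normB _ _))// /m mulrDr.
    by rewrite lerD// comb_value_le.
  have fz : `|flux_average P D r F z| <= b1 * c * u.
    have dl T s (g : 'rV[R]_N) : enorm g <= u ->
        `|betaBK P D z * dot (ext P D T s g) (nF F)| <= b1 * c * u.
      move=> gu; rewrite normrM -mulrA ler_pM//.
        by rewrite ger0_norm// (le_trans _ l1)// ltW.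
      rewrite (le_trans (dot_le _ _))// nF1 mulr1 (le_trans (extle _ _ _))//.
      by rewrite ler_wpM2l// ltW.
    have := dl (T1 F) (side D z) _ gu1; have := dl (T2 F) (side D z) _ gu2.
    rewrite /flux_average yE (qfield1 P D F y) (qfield2 _ htri FI).
    set A := betaBK P D z * _; set B := betaBK P D z * _.
    by rewrite !ler_norml => /andP[? ?] /andP[? ?]; apply/andP; split; lra.
  rewrite normrM (_ : b1 * c * V * m * u = b1 * c * u * (V * m)) ?ler_pM//; ring.
have := energy_sandwich k0 (sqrtr_ge0 _) L0 low up => fin.
apply: (le_trans (ler_wpM2r (sqr_ge0 h) fin)).
have m2 : m ^+ 2 <= 2 * (S1 + S2).
  rewrite /m -{2}(sqr_sqrtr S10) -{2}(sqr_sqrtr S20).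
  by have := sqr_ge0 (Num.sqrt S1 - Num.sqrt S2); rewrite !expr2; lra.
have hE : h ^+ N = h * h ^+ N.-1 by rewrite -exprS prednK.
have -> : L ^+ 2 / k * h ^+ 2 = (b1 * c * V) ^+ 2 * w ^+ N / (b0 * c^-1 ^+ 2) * h ^+ N * m ^+ 2.
  rewrite /L /k expr_div_n hE; field.
  by rewrite !gt_eqF// ?exprn_gt0// ?invr_gt0.
rewrite /lift_constant.
have X0 : 0 <= (b1 * c * V) ^+ 2 * w ^+ N / (b0 * c^-1 ^+ 2) * h ^+ N.
  rewrite mulr_ge0 ?exprn_ge0 ?(ltW h0)// divr_ge0//.
    by rewrite mulr_ge0 ?sqr_ge0// exprn_ge0// ltW.
  by rewrite mulr_ge0 ?sqr_ge0// ltW.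
apply: (le_trans (ler_wpM2l X0 m2)).
by rewrite le_eqVlt; apply/orP; left; apply/eqP; ring.
Qed.

Lemma patch_total_le x :
  \sum_(F in Gfaces P M) patch_energy F (gradh (comb x)) (gradh (comb x)) <= 4 * total_energy x.
Proof.
have e0 T : T \in cells M -> 0 <= energy T (gradh (comb x) T) (gradh (comb x) T).
  by move=> TM; exact: (energy_ge0 hP htri hok b00 hb TM).
apply: (le_trans (patch_sum_le e0)); rewrite ler_wpM2r ?sumr_ge0//.
by rewrite ler_nat; case: hN => ->.
Qed.

(** With [a] the total energy and [r] the lifting energy, the cross term costs at most
    [8 * r + 8^-1 * (4 * a)]. The first part is matched by the stabilization and the second is half
    of [a]. *)
Lemma qform_young x (A := qform (stiffness P D phi) x x) :
  total_energy x <= 2 * A /\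
  A <= 3 / 2 * total_energy x +
    16 * \sum_(F in Gfaces P M) patch_energy F (comb_lift x F) (comb_lift x F).
Proof.
have E := quadratic_form hN hP htri hok hmin hrho b00 hb hphi x.
rewrite -/A -/(total_energy x) in E.
set a := total_energy x in E *; set r := \sum_(F in _) patch_energy F _ _.
rewrite -/r in E; set g := \sum_(F in _) patch_energy F _ _ in E.
have gb : `|2 * g| <= 8 * r + 8^-1 * \sum_(F in Gfaces P M) patch_energy F (gradh (comb x)) (gradh (comb x)).
  rewrite /g /r !mulr_sumr -big_split (le_trans (ler_norm_sum _ _ _))//.
  apply: ler_sum => F FG.
  exact: (patch_energy_young hP htri hok b00 hb (Gface_interior hN hP htri FG)).
have := patch_total_le x; rewrite -/a => pa.
move: gb; rewrite ler_norml => /andP[g1 g2].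
by split; lra.
Qed.

Let G := N.+1%:R * (Cp * (2 * (1 + c))) ^+ 2.
Let Ca := b1 * c ^+ 2 * 2 ^+ N * (q * (rho * stb)) ^+ 2.

(** The quotient of the two spectral bounds with the powers of [h] removed. The factors 3 and 32 are
    [3 / 2] and 16 of [qform_young] doubled, since an interior face has two cells; [G + 1] makes the
    denominator of [lo] positive. *)
Definition condition_constant : R :=
  (3 * Ca + 32 * N.+1%:R * lift_constant) * (2 * (G + 1)) * w ^+ N / (b0 * c^-1 ^+ 2).

Lemma stiffness_cond2_le : cells M != finset.set0 ->
  (cond2 (stiffness P D phi) <= (condition_constant * h ^- 2)%:E)%E.
Proof.
move=> /set0Pn[T TM]; have [rho0 q0] := shape_constants_gt0 TM.
have w0 : 0 < w by rewrite !mulr_gt0.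
have G0 : 0 <= G by rewrite mulr_ge0// sqr_ge0.
have ci0 : 0 < b0 * c^-1 ^+ 2 by rewrite mulr_gt0// exprn_gt0// invr_gt0.
have bb : 0 <= b1.
  have [z zT] := osimplex_nonempty (card_cell_gt0 (cell_full htri TM)).
  have /andP[l1 l2] := betaBK_bounds hok hb (osimplex_Omega hO htri TM zT).
  by rewrite (le_trans _ (le_trans l1 l2))// ltW.
have Ca0 : 0 <= Ca by rewrite mulr_ge0 ?sqr_ge0// mulr_ge0 ?exprn_ge0// mulr_ge0// sqr_ge0.
have Cl0 : 0 <= lift_constant.
  rewrite divr_ge0 ?(ltW ci0)// mulr_ge0 ?exprn_ge0 ?(ltW w0)//.
  by rewrite mulr_ge0// sqr_ge0.
pose lo := b0 * c^-1 ^+ 2 * (h / w) ^+ N / (2 * (G + 1)).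
pose hi := (3 * Ca + 32 * N.+1%:R * lift_constant) * h ^+ N / h ^+ 2.
have hN0 : 0 < h ^+ N by rewrite exprn_gt0.
have lo0 : 0 < lo.
  by rewrite /lo divr_gt0 ?mulr_gt0 ?exprn_gt0 ?divr_gt0 ?invr_gt0// ltr_wpDl.
have hi0 : 0 <= hi.
  rewrite /hi divr_ge0 ?sqr_ge0// mulr_ge0 ?(ltW hN0)//.
  by apply: addr_ge0; [rewrite mulr_ge0|rewrite mulr_ge0// mulr_ge0].
have -> : condition_constant * h ^- 2 = hi / lo.
  rewrite /condition_constant /hi /lo expr_div_n.
  have : b0 * c^-1 ^+ 2 != 0 by rewrite gt_eqF.
  move: (b0 * c^-1 ^+ 2) => k k0.
  by field; rewrite k0 !gt_eqF ?exprn_gt0// ltr_wpDl.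
apply: cond2_le => // [|x|x].
- exact: (stiffness_sym hN hP htri hok hmin hrho b00 hb hphi).
- have [ta _] := qform_young x.
  rewrite /lo mulrAC ler_pdivrMr; last by rewrite mulr_gt0// ltr_wpDl.
  have := total_energy_ge x; have := norm_le_gradients x; rewrite -/G.
  set s := \sum_(T in _) _ => ns ts.
  have s0 : 0 <= s by apply: sumr_ge0 => A _; exact: dot_ge0.
  have k0 : 0 <= b0 * c^-1 ^+ 2 * (h / w) ^+ N.
    by rewrite mulr_ge0 ?(ltW ci0)// exprn_ge0// divr_ge0// ltW.
  move: (b0 * c^-1 ^+ 2 * (h / w) ^+ N) k0 ts => k k0 ts.
  apply: (@le_trans _ _ (k * ((G + 1) * s))).
    by rewrite ler_wpM2l// (le_trans ns)// ler_wpM2r// lerDl.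
  rewrite mulrCA (_ : _ * (2 * (G + 1)) = (G + 1) * (2 * qform (stiffness P D phi) x x)); last by ring.
  by rewrite ler_wpM2l ?addr_ge0//; exact: le_trans ts ta.
have [_ tb] := qform_young x.
rewrite /hi mulrAC ler_pdivlMr ?exprn_gt0//.
apply: (le_trans (ler_wpM2r (sqr_ge0 h) tb)); rewrite mulrDl.
have aL : total_energy x * h ^+ 2 <= Ca * h ^+ N * (2 * dot x^T x^T).
  apply: (le_trans (total_energy_le x)).
  rewrite (_ : b1 * c ^+ 2 * (2 * h) ^+ N * (q * (rho * stb)) ^+ 2 = Ca * h ^+ N).
    by rewrite ler_wpM2l ?sum_face_sum// mulr_ge0// ltW.
  by rewrite /Ca exprMn; ring.
have rL : (\sum_(F in Gfaces P M) patch_energy F (comb_lift x F) (comb_lift x F)) * h ^+ 2 <=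
    lift_constant * h ^+ N * (N.+1%:R * (2 * dot x^T x^T)).
  rewrite mulr_suml; apply: (@le_trans _ _ (\sum_(F in Gfaces P M)
      lift_constant * h ^+ N * (face_sum x (T1 F) + face_sum x (T2 F)))).
    by apply: ler_sum => F FG; exact: lift_energy_le.
  have l0 : 0 <= lift_constant * h ^+ N by rewrite mulr_ge0// ltW.
  rewrite -mulr_sumr ler_wpM2l//.
  apply: (le_trans (patch_sum_le (fun T _ => face_sum_ge0 x T))).
  by rewrite ler_wpM2l// sum_face_sum.
move: (dot _ _) aL rL => d aL rL; rewrite -!mulrA in aL rL *.
apply: (@le_trans _ _ (3 / 2 * (Ca * (h ^+ N * (2 * d))) + 16 * (lift_constant * (h ^+ N * (N.+1%:R * (2 * d)))))).
  by rewrite -!mulrA lerD ?ler_wpM2l//.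
by rewrite le_eqVlt; apply/orP; left; apply/eqP; field.
Qed.

End spectral_bounds.

(** * Constants determined by the continuous problem *)

Section problem_constants.
Context {R : realType} {N : nat} (P : interface_problem R N).
Implicit Types (x y : 'rV[R]_N).

Lemma domain_radius : convex_polytope_domain (Omega P) ->
  exists Dm : R, forall x, closure (Omega P) x -> enorm x <= Dm.
Proof.
move=> hO; have [_ [B [_ HB]] _] := hO; exists (N%:R * (B + 1 + 1)) => x cx.
have [y [Oy xy]] := cx _ (nbhsx_ballx x 1 ltr01).
apply: (le_trans (enorm_le_norm _)); rewrite ler_wpM2l//.
rewrite -(subrK y x) (le_trans (ler_normD _ _))// addrC lerD//.
  by apply: (HB (B + 1)) => //; rewrite ltrDl.
by move: xy; rewrite mx_norm_ball /ball_ /= => /ltW.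
Qed.

Lemma coefficient_bounds : well_posed P -> exists b0 b1 : R, 0 < b0 /\
  forall s x, closure (Omegas_ext P s) x -> b0 <= betaE P s x <= b1.
Proof.
move=> [_ _ _ _ H].
have [_ _ _ [mt [Mt [mt0 Ht]]] _] := H true; have [_ _ _ [mf [Mf [mf0 Hf]]] _] := H false.
exists (Num.min mt mf), (Num.max Mt Mf); split; first by rewrite lt_min mt0.
by move=> [] x cx; [have /andP[h1 h2] := Ht x cx|have /andP[h1 h2] := Hf x cx];
  rewrite ge_min le_max h1 h2 ?orbT.
Qed.

(** By compactness [dot a] has a maximum below [b] on [A]. In the distance, the factor 2 keeps the
    inequality strict and the added 1 covers a zero normal. *)
Lemma halfspace_clearance (A : set 'rV[R]_N) a (b : R) : compact A ->
  (forall y, A y -> dot a y < b) ->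
  exists d : R, 0 < d /\ forall x y, A y -> enorm (x - y) <= d -> dot a x < b.
Proof.
move=> cA Ab; have [->|/set0P A0] := eqVneq A set0; first by exists 1.
have [z /set_mem Az zmax] := compact_EVT_max A0 cA (continuous_subspaceT (@dot_continuous R N a)).
have bz : 0 < b - dot a z by rewrite subr_gt0 Ab.
have a1 : 0 < enorm a + 1 by rewrite ltr_wpDl// enorm_ge0.
exists ((b - dot a z) / (2 * (enorm a + 1))); split; first by rewrite divr_gt0// mulr_gt0.
move=> x y Ay; rewrite ler_pdivlMr ?mulr_gt0// => xy.
have h1 : dot a y <= dot a z by apply: zmax; exact: mem_set.
have h2 : dot a (x - y) <= enorm a * enorm (x - y) := le_trans (ler_norm _) (dot_le _ _).
have := enorm_ge0 (x - y); move: h2; rewrite dotBr => h2 h3; nra.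
Qed.

(** A polytope is cut out by finitely many half-spaces, so the smallest clearance is positive. The
    initial value 1 of the minimum covers an empty list of them. *)
Lemma interface_clearance : well_posed P -> exists h0 : R, 0 < h0 /\
  forall x y, Gamma P y -> enorm (x - y) <= h0 -> Omega P x.
Proof.
move=> [[_ _ [m [a [b OE]]]] [_ GO _ _] [cG _ _] _ _].
have Gk k y : Gamma P y -> dot (a k) y < b k.
  by move=> Gy; have : Omega P y by [rewrite GO; right]; rewrite OE; apply.
have /choice[d dP] k := halfspace_clearance cG (Gk k).
exists (\big[Num.min/1]_k d k); split.
  by apply: lt_bigmin => // k _; have [] := dP k.
move=> x y Gy xy; rewrite OE => k /=; have [_ H] := dP k.
by apply: (H x y) => //; apply: (le_trans xy); exact: bigmin_le.
Qed.

End problem_constants.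

Theorem lemma5p15 (R : realType) (N : nat) (hN : N = 2%N \/ N = 3%N)
    (P : interface_problem R N) (hP : well_posed P)
    (K : constants R) (hK : 0 < coef_min K) :
  exists h0 C : R, [/\ 0 < h0, 0 < C &
    forall (M : mesh R N) (D : discrete_interface M)
           (phi : 'I_#|interior_faces M| -> broken M),
      triangulation P M ->
      shape_regular M (c_shape K) ->
      quasi_uniform M (c_quasi K) ->
      resolves_interface P M ->
      hGamma P M <= h0 ->
      discrete_interface_ok P D K ->
      nodal_basis P D phi ->
      (cond2 (stiffness P D phi) <= (C * hmax M ^- 2)%:E)%E].
Proof.
have hO : convex_polytope_domain (Omega P) by case: hP.
have N0 : (0 < N)%N by case: hN => ->.
have [Dm HD] := domain_radius hO; have [b0 [b1 [b00 hb]]] := coefficient_bounds hP.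
have [h0 [h00 clear]] := interface_clearance hP.
pose C := @condition_constant R N K (c_shape K) b0 b1 (c_quasi K) Dm.
(* [C] is fixed before any mesh, when the signs of [c_shape K] and [c_quasi K] are unknown; this
   majorant is positive in all cases. *)
exists h0, (`|C| + 1); split; [exact: h00|exact: ltr_wpDl|].
move=> M D phi htri hrho hq _ hG hok hphi.
(* Each point of a cut cell is within [hT T <= hGamma P M <= h0] of a point of [Gamma] in that
   cell. *)
have hin T : T \in Gcells P M -> csimplex T `<=` Omega P.
  move=> TG x xT; have := TG; rewrite inE => /andP[TM /asboolP[y [yT Gy]]].
  apply: (clear x y Gy); apply: le_trans hG.
  apply: le_trans (le_bigmax_cond _ (hT (M := M)) TG).
  exact: (csimplex_dist (cell_full htri TM) xT (osimplex_csimplex yT)).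
(* A cell exists because the domain is nonempty; this makes [hmax M] positive. *)
have [T0 T0M] : exists T, T \in cells M.
  have [[z Oz] _ _] := hO; have [T TM _] := cells_cover htri (subset_closure Oz).
  by exists T.
have hle T : T \in cells M -> hT T <= hmax M by exact: le_bigmax_cond.
have h1 : 0 < hmax M := lt_le_trans (hT_gt0 (cell_full htri T0M) N0) (hle _ T0M).
have hge T : T \in cells M -> hmax M <= c_quasi K * hT T.
  move=> TM; have hT0 := hT_gt0 (cell_full htri TM) N0.
  by have := hq T TM; rewrite ler_pdivlMr// mulrC ler_pdivrMr.
have cM : cells M != finset.set0 by apply/set0Pn; exists T0.
apply: (le_trans (stiffness_cond2_le hN hP htri hok hK hin hrho b00 hb HD h1 hle hge hphi cM)).
rewrite lee_fin ler_wpM2r ?invr_ge0 ?sqr_ge0// -/C.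
by rewrite (le_trans (ler_norm _))// lerDl.
Qed.
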